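(* Let $\nu>0$, $d\in\{2,3\}$, and let $\omega,\hat\omega$ be kernels satisfying the kernel assumptions (K1)–(K4) stated in the context, with $\beta\in(-1,1)$ the exponent in (K4). For a $2\pi$-periodic mean-zero vector field $\bm f$ on $\Omega=(-\pi,\pi)^d$ let $(\bm u,p)$ be the $2\pi$-periodic mean-zero solution of the local Stokes system $$-\nu\Delta\bm u+\nabla p=\bm f,\qquad -\nabla\cdot\bm u=0\qquad\text{in }\Omega,$$ and, for $\delta>0$, let $(\bm u_\delta,p_\delta)$ be the $2\pi$-periodic mean-zero solution of the nonlocal Stokes system $$-\nu\mathcal L_\delta\bm u_\delta+\mathcal G_\delta p_\delta=\bm f,\qquad-\mathcal D_\delta\bm u_\delta=0\qquad\text{in }\Omega.$$ Then there is a constant $C$ independent of $\delta$ and $\bm f$ such that $$\|\bm u-\bm u_\delta\|_{[L^2(\Omega)]^d}\le C\delta^2\|\bm f\|_{[L^2(\Omega)]^d}$$ and $$\|p-p_\delta\|_{L^2(\Omega)}\le C\delta^{\min\{2,1+\eta\}}\|\bm f\|_{[H^\eta(\Omega)]^d}\qquad\text{for any }\eta\ge-\beta,$$ whenever the respective right-hand side is finite.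
   Context: Periodic functions (more generally periodic distributions) on $\Omega=(-\pi,\pi)^d$ with zero mean are identified with their Fourier coefficients: $g(\bm x)=(2\pi)^{-d}\sum_{\bm\xi\in\mathbb Z^d,\bm\xi\ne0}\widehat g(\bm\xi)e^{i\bm\xi\cdot\bm x}$, $\widehat g(\bm\xi)=\int_\Omega g(\bm x)e^{-i\bm\xi\cdot\bm x}d\bm x$. For mean-zero $g$ and $s\in\mathbb R$, $\|g\|_{H^s(\Omega)}^2=(2\pi)^{-d}\sum_{\bm\xi\neq0}|\bm\xi|^{2s}|\widehat g(\bm\xi)|^2$ and $\|\cdot\|_{L^2}=\|\cdot\|_{H^0}$. Kernels. $\omega,\hat\omega:(0,\infty)\to[0,\infty)$ are measurable, vanish on $(1,\infty)$, and for $\delta>0$ one sets $\underline\omega_\delta(r)=\delta^{-(d+2)}\omega(r/\delta)$, $\hat\omega_\delta(r)=\delta^{-(d+1)}\hat\omega(r/\delta)$. Assumptions: (K1) $\frac12\int_{\mathbb R^d}\underline\omega_\delta(|\bm x|)|\bm x|^2d\bm x=d$; (K2) $\int_{\mathbb R^d}\hat\omega_\delta(|\bm x|)|\bm x|d\bm x=d$; (K3) $r^{d-1}\hat\omega(r)$ is nonincreasing for $r\in(0,1)$; (K4) there are $\epsilon\in(0,1]$, $c>0$ and $\beta\in(-1,1)$ with $\hat\omega(r)=c\,r^{-d-\beta}$ for $r\in(0,\epsilon)$. Operators. With $\vec\omega_\delta(\bm x)=\hat\omega_\delta(|\bm x|)\bm x/|\bm x|$, $\mathcal L_\delta\bm u(\bm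 x)=\int_{\mathbb R^d}\underline\omega_\delta(|\bm x-\bm y|)(\bm u(\bm y)-\bm u(\bm x))d\bm y$, $\mathcal G_\delta p(\bm x)=\int_{\mathbb R^d}\vec\omega_\delta(\bm y-\bm x)(p(\bm y)-p(\bm x))d\bm y$, $\mathcal D_\delta\bm u(\bm x)=\int_{\mathbb R^d}\vec\omega_\delta(\bm y-\bm x)\cdot(\bm u(\bm y)+\bm u(\bm x))d\bm y$ (principal value where needed). In Fourier variables they act, and are extended to periodic distributions, by $\widehat{\mathcal L_\delta\bm u}=-\lambda_\delta\widehat{\bm u}$, $\widehat{\mathcal G_\delta p}=i\bm b_\delta\widehat p$, $\widehat{\mathcal D_\delta\bm u}=i\bm b_\delta^T\widehat{\bm u}$, where $\lambda_\delta(\bm\xi)=\int_{|\bm s|\le\delta}\underline\omega_\delta(|\bm s|)(1-\cos(\bm\xi\cdot\bm s))d\bm s$ and $\bm b_\delta(\bm\xi)=\int_{|\bm s|\le\delta}\hat\omega_\delta(|\bm s|)\frac{\bm s}{|\bm s|}\sin(\bm\xi\cdot\bm s)d\bm s$. Solutions are understood in this Fourier (distributional) sense; under these assumptions the nonlocal system has a unique mean-zero periodic solution. The constant $C$ may depend on $d,\nu,\omega,\hat\omega$. *)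

(* Defs.v *)
From HB Require Import structures.
From mathcomp Require Import all_boot all_order all_algebra.
From mathcomp Require Import all_classical all_reals all_analysis.
From mathcomp Require Import complex.

Set Implicit Arguments.
Unset Strict Implicit.
Unset Printing Implicit Defensive.

Import Order.TTheory GRing.Theory Num.Theory.
Import numFieldNormedType.Exports.
Local Open Scope classical_set_scope.
Local Open Scope ring_scope.

(* The carrier is [n.-tuple R] rather than ['rV[R]_n] because the library puts
   the product sigma-algebra on tuples only. *)
Definition Rn (R : realType) (n : nat) := (n.-tuple (measurableTypeR R))%type.

Section lebesgue_cons.
Context (R : realType) (n : nat).

Definition consRn (x : measurableTypeR R * Rn R n) : Rn R n.+1 :=
  [tuple of x.1 :: x.2].

Lemma measurable_consRn : measurable_fun [set: measurableTypeR R * Rn R n] consRn.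
Proof. exact: measurable_cons measurable_fst measurable_snd. Qed.

HB.instance Definition _ :=
  isMeasurableFun.Build _ _ _ _ consRn measurable_consRn.

Definition unconsRn (t : Rn R n.+1) : measurableTypeR R * Rn R n :=
  (thead t, [tuple of behead t]).

Lemma measurable_unconsRn : measurable_fun [set: Rn R n.+1] unconsRn.
Proof.
apply: measurable_fun_pair; first exact: measurable_tnth.
exact: measurable_behead.
Qed.

Lemma consRnK : cancel consRn unconsRn.
Proof.
by case=> x t; rewrite /unconsRn /consRn/=; congr pair; exact: val_inj.
Qed.

Variable m : {sigma_finite_measure set (Rn R n) -> \bar R}.

Definition lebesgue_cons : set (Rn R n.+1) -> \bar R :=
  pushforward ((@lebesgue_measure R) \x m)%E consRn.

Let lebesgue_cons0 : lebesgue_cons set0 = 0%E.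
Proof. by rewrite /lebesgue_cons /pushforward preimage_set0 measure0. Qed.

Let lebesgue_cons_ge0 A : (0 <= lebesgue_cons A)%E.
Proof. exact: measure_ge0. Qed.

Let lebesgue_cons_sigma_additive : semi_sigma_additive lebesgue_cons.
Proof.
move=> F mF tF mUF; rewrite /lebesgue_cons /pushforward preimage_bigcup.
apply: measure_semi_sigma_additive.
- by move=> k; rewrite -[X in measurable X]setTI; exact: measurable_consRn.
- apply/trivIsetP => /= i j _ _ ij; rewrite -preimage_setI.
  by move/trivIsetP : tF => /(_ _ _ _ _ ij) ->//; rewrite preimage_set0.
- rewrite -preimage_bigcup -[X in measurable X]setTI.
  exact: measurable_consRn.
Qed.

HB.instance Definition _ := isMeasure.Build _ _ _ lebesgue_cons
  lebesgue_cons0 lebesgue_cons_ge0 lebesgue_cons_sigma_additive.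

Lemma lebesgue_cons_sigma_finite : sigma_finite setT lebesgue_cons.
Proof.
have /sigma_finiteP[F [TF ndF Foo]] := sigma_finiteT (@lebesgue_measure R).
have /sigma_finiteP[G [TG ndG Goo]] := sigma_finiteT m.
exists (fun k => unconsRn @^-1` (F k `*` G k)).
  rewrite -preimage_bigcup (_ : \bigcup_k (F k `*` G k) = setT) ?preimage_setT//.
  rewrite -subTset => -[x y] _.
  have [i _ Fix] : (\bigcup_k F k) x by rewrite -TF.
  have [j _ Gjy] : (\bigcup_k G k) y by rewrite -TG.
  exists (maxn i j) => //; split.
  - by move: x Fix; exact/subsetPset/ndF/leq_maxl.
  - by move: y Gjy; exact/subsetPset/ndG/leq_maxr.
move=> k; have [mF Fk] := Foo k; have [mG Gk] := Goo k; split.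
  rewrite -[X in measurable X]setTI; apply: measurable_unconsRn => //.
  exact: measurableX.
rewrite /lebesgue_cons /pushforward -comp_preimage.
rewrite (_ : unconsRn \o consRn = id); last by apply/funext; exact: consRnK.
by rewrite preimage_id product_measure1E// lte_mul_pinfty// ge0_fin_numE.
Qed.

HB.instance Definition _ :=
  Measure_isSigmaFinite.Build _ _ _ lebesgue_cons lebesgue_cons_sigma_finite.

End lebesgue_cons.

Fixpoint lebesgueRn (R : realType) (n : nat) :
    {sigma_finite_measure set (Rn R n) -> \bar R} :=
  if n is n'.+1 then lebesgue_cons (lebesgueRn R n')
  else \d_([tuple] : Rn R 0).

Definition enorm (R : realType) (n : nat) (x : Rn R n) : R :=
  Num.sqrt (\sum_(i < n) tnth x i ^+ 2).

(* The profiles live on ]0, +oo[; their values on ]-oo, 0] are irrelevant since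
   they are only evaluated at |x| / delta, and the origin is negligible. *)

Section kernels.
Context (R : realType) (d : nat).

Definition scale_omega (omega : R -> R) (delta r : R) : R :=
  delta ^- (d + 2) * omega (r / delta).

Definition scale_omegahat (omegahat : R -> R) (delta r : R) : R :=
  delta ^- (d + 1) * omegahat (r / delta).

Definition kernel_profile (w : R -> R) : Prop :=
  [/\ measurable_fun (`]0, +oo[%classic : set R) (w : R -> R),
      forall r, 0 < r -> 0 <= w r &
      forall r, 1 < r -> w r = 0].

Record kernel_assumptions (omega omegahat : R -> R) (beta : R) : Prop := {
  omega_profile : kernel_profile omega;
  omegahat_profile : kernel_profile omegahat;
  kernel_K1 : forall delta, 0 < delta ->
    ((2^-1)%:E * \int[lebesgueRn R d]_x
       (scale_omega omega delta (enorm x) * enorm x ^+ 2)%:E = d%:R%:E)%E;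
  kernel_K2 : forall delta, 0 < delta ->
    (\int[lebesgueRn R d]_x
       (scale_omegahat omegahat delta (enorm x) * enorm x)%:E = d%:R%:E)%E;
  kernel_K3 : forall r s, 0 < r -> r <= s -> s < 1 ->
    s ^+ d.-1 * omegahat s <= r ^+ d.-1 * omegahat r;
  kernel_K4 : -1 < beta < 1 /\
    exists epsilon c, [/\ 0 < epsilon <= 1, 0 < c &
      forall r, 0 < r < epsilon -> omegahat r = c * r `^ (- d%:R - beta)]
}.

End kernels.

Section periodic_distributions.
Context (R : realType) (d : nat).
Implicit Types (xi : 'rV[int]_d) (s : R).

Definition freq_norm xi : R := Num.sqrt (\sum_(i < d) (xi 0 i)%:~R ^+ 2).

(* A periodic distribution is represented by its family of Fourier
   coefficients, a vector field by its components. *)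
Definition pdistr := 'rV[int]_d -> R[i].

Definition pfield := 'I_d -> pdistr.

(* Polynomial growth characterizes the coefficient families of distributions;
   the coefficient at 0 is the integral over the period cell. *)
Definition mean_zero (g : pdistr) : Prop :=
  g 0 = 0 /\
  exists (C : R) (N : nat),
    forall xi, Normc.normc (g xi) <= C * (1 + freq_norm xi) ^+ N.

Definition mean_zero_field (u : pfield) : Prop := forall j, mean_zero (u j).

Definition sqr_sobolev s (g : pdistr) : \bar R :=
  (((2 * pi) ^- d)%:E *
   \esum_(xi in [set xi | xi != 0%R])
     (freq_norm xi `^ (2 * s) * Normc.normc (g xi) ^+ 2)%:E)%E.

Definition sobolev_norm s (g : pdistr) : \bar R := sqrte (sqr_sobolev s g).

Definition sobolev_norm_field s (u : pfield) : \bar R :=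
  sqrte (\sum_(j < d) sqr_sobolev s (u j))%E.

Definition L2_norm (g : pdistr) : \bar R := sobolev_norm 0 g.

Definition L2_norm_field (u : pfield) : \bar R := sobolev_norm_field 0 u.

End periodic_distributions.

(* All operators act on Fourier coefficients, d/dx_j being multiplication by
   i xi_j. On functions, the nonlocal ones are
     L p(x) = int omega_delta(|x - y|) (p(y) - p(x)) dy,
     G p(x) = int w(y - x) (p(y) - p(x)) dy,
     D u(x) = int w(y - x) . (u(y) + u(x)) dy,
   with w(z) = omegahat_delta(|z|) z / |z|; their symbols are - lambda, i b and
   i b^T. *)

Section operators.
Context (R : realType) (d : nat).
Local Open Scope complex_scope.
Implicit Types (xi : 'rV[int]_d) (p : pdistr R d) (u : pfield R d).

Definition freq_dot xi (s : Rn R d) : R :=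
  \sum_(i < d) (xi 0 i)%:~R * tnth s i.

Definition laplacian (g : pdistr R d) : pdistr R d :=
  fun xi => - (freq_norm R xi ^+ 2)%:C * g xi.

Definition gradient p : pfield R d :=
  fun j xi => 'i * ((xi 0 j)%:~R)%:C * p xi.

Definition divergence u : pdistr R d :=
  fun xi => \sum_(j < d) 'i * ((xi 0 j)%:~R)%:C * u j xi.

Definition lambda_symbol (omega : R -> R) (delta : R) xi : R :=
  \int[lebesgueRn R d]_(s in [set s | enorm s <= delta])
    (scale_omega d omega delta (enorm s) * (1 - cos (freq_dot xi s))).

Definition b_symbol (omegahat : R -> R) (delta : R) xi (j : 'I_d) : R :=
  \int[lebesgueRn R d]_(s in [set s | enorm s <= delta])
    (scale_omegahat d omegahat delta (enorm s) * (tnth s j / enorm s) *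
     sin (freq_dot xi s)).

Definition nl_laplacian (omega : R -> R) (delta : R) (g : pdistr R d) :
    pdistr R d :=
  fun xi => - (lambda_symbol omega delta xi)%:C * g xi.

Definition nl_gradient (omegahat : R -> R) (delta : R) p : pfield R d :=
  fun j xi => 'i * (b_symbol omegahat delta xi j)%:C * p xi.

Definition nl_divergence (omegahat : R -> R) (delta : R) u : pdistr R d :=
  fun xi => \sum_(j < d) 'i * (b_symbol omegahat delta xi j)%:C * u j xi.

Definition local_stokes (nu : R) (f u : pfield R d) p : Prop :=
  (forall j xi, - nu%:C * laplacian (u j) xi + gradient p j xi = f j xi) /\
  (forall xi, - divergence u xi = 0).

Definition nonlocal_stokes (nu : R) (omega omegahat : R -> R) (delta : R)
    (f u : pfield R d) p : Prop :=
  (forall j xi, - nu%:C * nl_laplacian omega delta (u j) xi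
                + nl_gradient omegahat delta p j xi = f j xi) /\
  (forall xi, - nl_divergence omegahat delta u xi = 0).

End operators.

(* Main.v *)
Require Import Defs.
From HB Require Import structures.
From mathcomp Require Import all_boot all_order all_algebra.
From mathcomp Require Import all_classical all_reals all_analysis.
From mathcomp Require Import measurable_realfun complex ring lra.

Set Implicit Arguments.
Unset Strict Implicit.
Unset Printing Implicit Defensive.

Import Order.TTheory GRing.Theory Num.Theory.
Import numFieldNormedType.Exports.
Local Open Scope classical_set_scope.
Local Open Scope ring_scope.

(** The two systems are diagonal in Fourier variables. At a frequency [xi != 0],
    put [q = |xi|], [e = xi / q] and [phi = e . f]. Both are saddle point systems
    with the same direction [e], because the nonlocal gradient symbol is parallel
    to [xi]: [b = s e] for a scalar [s]. Hence
      [u = (f - phi e) / (nu q^2)], [p = - i phi / q],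
      [u_delta = (f - phi e) / (nu lambda)], [p_delta = - i phi / s],
    and the theorem amounts to two scalar bounds, uniform in [xi] and [delta]:
      [|q^-2 - lambda^-1| <= C delta^2],
      [|q^-1 - s^-1| <= C delta^min(2, 1 + eta) q^eta] for [eta >= - beta].

    Dilation and rotation reduce them to functions of [k = delta q]:
    [lambda = delta^-2 L(k)] and [s = delta^-1 B(k)], where, [z_0] being the first
    coordinate of [z],
      [L(k) = int omega(|z|) (1 - cos (k z_0)) dz],
      [B(k) = int omegahat(|z|) (z_0 / |z|) sin (k z_0) dz].
    The kernel moments give [L(k) = k^2 + O(k^4)] and [B(k) = k + O(k^3)], which
    settles [k <= 1] once [L] and [B] are bounded below. What remains is
    [L(k) >= c min(1, k^2)] ([cos_integral_bounds]) and [B(k) >= c k] for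
    [k <= 1], [B(k) >= c k^beta] for [k >= 1] ([sine_symbol_bounds]). The
    kernels are not assumed smooth, so these bounds are not a matter of
    integrating by parts.

    - For [L], polar coordinates turn the integral into a radial one, weighted by
      the average of [1 - cos (t cos theta)] over directions, and this average is
      at least [c min(1, t^2)] ([direction_average_ge]).
    - For [B], on each ray the kernel contributes
      [int m(r) sin (a r) dr] with [m(r) = r^(d-1) omegahat(r)] nonincreasing.
      Slicing [m] by its superlevel sets, which are intervals [(0, S)], writes
      this as a superposition of the nonnegative numbers
      [int_0^S sin (a r) dr = (1 - cos (a S)) / a]. The levels between
      [m(2 rho)] and [m(rho)] have [rho <= S <= 2 rho]; with [rho] a small multiple
      of [min(1, 1/k)] the power law near the origin makes them contribute the
      required amount ([nonincreasing_sine_integral_ge]).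

    Signed integrals are avoided: [B(k)] is handled as [k - D(k)], where
    [D(k) = int omegahat(|z|) (z_0 / |z|) (k z_0 - sin (k z_0)) dz] has a
    nonnegative integrand, so that Tonelli's theorem applies throughout.

    The measure on [R^n] is an iterated product, so its rotation invariance has to
    be derived: a plane rotation is a product of three shears, and a shear
    preserves the measure by Tonelli and translation invariance on the line
    ([exists_rotation]). Polar coordinates ([ge0_integral_polar]) follow from
    dilation invariance alone, without a measure on the sphere. *)

(** * Change of variables on the line, Tonelli on R^(n+1) *)

Section change_of_variable_1d.
Context {R : realType}.
Local Notation mu := (@lebesgue_measure R).
Local Open Scope ereal_scope.

(** Translates of half-open intervals have the same length, and these
    determine the measure. *)
Lemma ge0_integral_shift (a : R) (f : measurableTypeR R -> \bar R) :
  measurable_fun setT f -> (forall x, 0 <= f x) ->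
  \int[mu]_x f (x + a)%R = \int[mu]_x f x.
Proof.
move=> mf f0.
have mphi : measurable_fun setT ((fun x => x + a)%R : measurableTypeR R -> measurableTypeR R).
  exact: measurable_funD.
have /= := @ge0_integral_pushforward _ _ _ _ R _ mphi mu setT f measurableT mf
  (fun y _ => f0 y).
rewrite preimage_setT => <-.
apply: eq_measure_integral => A mA _; apply/esym.
apply: lebesgue_measure_unique => //= _ [[x y]] _ <-.
rewrite /pushforward.
have -> : (fun x => x + a)%R @^-1` `]x, y]%classic = `](x - a)%R, (y - a)%R]%classic.
  by apply/seteqP; split=> z /=; rewrite !in_itv/= ltrBlDr lerBrDr.
rewrite !lebesgue_measure_itv/= !lte_fin ltrD2r.
by case: ifP => // _; rewrite -!EFinB; congr EFin; ring.
Qed.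

Lemma ge0_integral_opp (f : measurableTypeR R -> \bar R) :
  measurable_fun setT f -> (forall x, 0 <= f x) ->
  \int[mu]_x f (- x)%R = \int[mu]_x f x.
Proof.
move=> mf f0.
have mphi : measurable_fun setT (-%R : measurableTypeR R -> measurableTypeR R) by exact: oppr_measurable.
have /= := @ge0_integral_pushforward _ _ _ _ R _ mphi mu setT f measurableT mf
  (fun y _ => f0 y).
rewrite preimage_setT => <-.
by apply: eq_measure_integral => A mA _; exact: lebesgue_measureN.
Qed.

Lemma ge0_integral_dilation (s : R) (f : measurableTypeR R -> \bar R) : (0 < s)%R ->
  measurable_fun setT f -> (forall x, 0 <= f x) ->
  s%:E * \int[mu]_x f (s * x)%R = \int[mu]_x f x.
Proof.
move=> s0 mf f0.
have mphi : measurable_fun setT ((fun x => s * x)%R : measurableTypeR R -> measurableTypeR R).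
  exact: measurable_funM.
have /= := @ge0_integral_pushforward _ _ _ _ R _ mphi mu setT f measurableT mf
  (fun y _ => f0 y).
rewrite preimage_setT => <-.
have sge : (0 <= s)%R by exact: ltW.
rewrite (_ : s%:E = (NngNum sge)%:num%:E)//.
rewrite -ge0_integral_mscale//.
apply: eq_measure_integral => A mA _; apply/esym.
apply: lebesgue_measure_unique => //= _ [[x y]] _ <-.
rewrite /mscale/= /pushforward.
have -> : (fun x => s * x)%R @^-1` `]x, y]%classic = `](x / s)%R, (y / s)%R]%classic.
  by apply/seteqP; split=> z /=; rewrite !in_itv/= ltr_pdivrMr// ler_pdivlMr// ![(z * s)%R]mulrC.
rewrite !lebesgue_measure_itv/= !lte_fin ltr_pM2r ?invr_gt0//.
case: ifP => // _; last by rewrite mule0.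
rewrite -!EFinB -EFinM; congr EFin; field; exact: lt0r_neq0.
Qed.

End change_of_variable_1d.

Section lebesgueRn.
Context {R : realType}.
Local Open Scope ereal_scope.
Local Notation mu := (@lebesgue_measure R).
Local Notation leb n := (lebesgueRn R n).

Lemma ge0_integralZl_T d (T : measurableType d) (nu : {measure set T -> \bar R})
    (f : T -> \bar R) (k : R) : measurable_fun setT f -> (forall x, 0 <= f x) ->
  (0 <= k)%R -> \int[nu]_x (k%:E * f x) = k%:E * \int[nu]_x f x.
Proof. by move=> mf f0 k0; rewrite ge0_integralZl_EFin. Qed.

Lemma ge0_integral_consRn n (f : Rn R n.+1 -> \bar R) :
  measurable_fun [set: Rn R n.+1] f -> (forall x, 0 <= f x) ->
  \int[leb n.+1]_z f z = \int[mu]_x \int[leb n]_t f (consRn (x, t)).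
Proof.
move=> mf f0 /=.
have /= -> := @ge0_integral_pushforward _ _ _ _ R _ (@measurable_consRn R n)
  (mu \x leb n) setT f measurableT mf (fun y _ => f0 y).
rewrite preimage_setT fubini_tonelli1//.
by apply: measurableT_comp => //; exact: measurable_consRn.
Qed.

Lemma ge0_integral_consRn2 n (f : Rn R n.+1 -> \bar R) :
  measurable_fun [set: Rn R n.+1] f -> (forall x, 0 <= f x) ->
  \int[leb n.+1]_z f z = \int[leb n]_t \int[mu]_x f (consRn (x, t)).
Proof.
move=> mf f0; rewrite ge0_integral_consRn//.
rewrite -(fubini_tonelli (m1 := mu) (m2 := leb n) (fun z => f (consRn z)))//.
by apply: measurableT_comp => //; exact: measurable_consRn.
Qed.

Lemma unconsRnK n : cancel (@unconsRn R n) (@consRn R n).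
Proof. by move=> t; rewrite /unconsRn /consRn/= [RHS]tuple_eta; exact: val_inj. Qed.

End lebesgueRn.

(** * Measure-preserving maps and dilations of R^n *)

Section Rn_structure.
Context {R : realType}.
Implicit Types n : nat.

Lemma tnth_consRn0 n (p : measurableTypeR R * Rn R n) : tnth (consRn p) ord0 = p.1.
Proof. by []. Qed.

Lemma tnth_consRnS n (p : measurableTypeR R * Rn R n) i :
  tnth (consRn p) (lift ord0 i) = tnth p.2 i.
Proof. by rewrite (tnth_nth 0) (tnth_nth 0). Qed.

Lemma Rn_ind n (P : Rn R n.+1 -> Prop) : (forall x t, P (consRn (x, t))) -> forall z, P z.
Proof. by move=> H z; rewrite -(unconsRnK z); case: (unconsRn z). Qed.

Lemma enorm_ge0 n (z : Rn R n) : 0 <= enorm z.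
Proof. exact: sqrtr_ge0. Qed.

Lemma sqr_enorm n (z : Rn R n) : enorm z ^+ 2 = \sum_(i < n) tnth z i ^+ 2.
Proof. by rewrite sqr_sqrtr// sumr_ge0// => i _; exact: sqr_ge0. Qed.

Lemma enorm_eq n (y z : Rn R n) : enorm y ^+ 2 = enorm z ^+ 2 -> enorm y = enorm z.
Proof. by rewrite !sqr_enorm /enorm => ->. Qed.

Lemma sqr_enorm_cons n (p : measurableTypeR R * Rn R n) :
  enorm (consRn p) ^+ 2 = p.1 ^+ 2 + enorm p.2 ^+ 2.
Proof.
rewrite !sqr_enorm big_ord_recl tnth_consRn0; congr (_ + _).
by apply: eq_bigr => i _; rewrite tnth_consRnS.
Qed.

Lemma ler_tnth_enorm n (z : Rn R n) i : `|tnth z i| <= enorm z.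
Proof.
rewrite -ler_sqr ?nnegrE ?enorm_ge0// real_normK ?num_real// sqr_enorm.
by rewrite (bigD1 i)//= lerDl sumr_ge0// => j _; exact: sqr_ge0.
Qed.

Lemma measurable_consRnP d (T : measurableType d) n (f : T -> measurableTypeR R)
    (g : T -> Rn R n) : measurable_fun setT f -> measurable_fun setT g ->
  measurable_fun setT (fun x => consRn (f x, g x)).
Proof.
move=> mf mg; apply: measurableT_comp; first exact: measurable_consRn.
exact: measurable_fun_pair.
Qed.

Lemma measurable_enorm n : measurable_fun [set: Rn R n] (@enorm R n).
Proof.
apply: (@measurableT_comp _ _ _ _ _ _ (Num.sqrt : measurableTypeR R -> measurableTypeR R)).
  by apply: continuous_measurable_fun => x; exact: sqrt_continuous.
apply: (@measurable_sum _ _ _ _ _ _ (fun i (z : Rn R n) => tnth z i ^+ 2)) => i.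
by apply: measurable_funX; exact: measurable_tnth.
Qed.

Definition scaleRn n (s : R) (z : Rn R n) : Rn R n := [tuple s * tnth z i | i < n].

Lemma tnth_scaleRn n s (z : Rn R n) i : tnth (scaleRn s z) i = s * tnth z i.
Proof. by rewrite tnth_mktuple. Qed.

Lemma scaleRn_cons n s (p : measurableTypeR R * Rn R n) :
  scaleRn s (consRn p) = consRn (s * p.1, scaleRn s p.2).
Proof.
apply: eq_from_tnth => i; rewrite tnth_scaleRn.
by case: (unliftP ord0 i) => [j|] ->; rewrite ?tnth_consRn0 ?tnth_consRnS ?tnth_scaleRn.
Qed.

Lemma enorm_scaleRn n s (z : Rn R n) : 0 <= s -> enorm (scaleRn s z) = s * enorm z.
Proof.
move=> s0; apply/eqP; rewrite -(@eqrXn2 _ 2%N)// ?mulr_ge0 ?enorm_ge0//.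
rewrite exprMn !sqr_enorm mulr_sumr; apply/eqP/eq_bigr => i _.
by rewrite tnth_scaleRn exprMn.
Qed.

Lemma measurable_scaleRn d (T : measurableType d) n (f : T -> measurableTypeR R)
    (g : T -> Rn R n) : measurable_fun setT f -> measurable_fun setT g ->
  measurable_fun setT (fun x => scaleRn (f x) (g x)).
Proof.
move=> mf mg; apply/measurable_fun_tnthP => i.
have -> : (@tnth n (measurableTypeR R))^~ i \o (fun x => scaleRn (f x) (g x))
   = (fun x => f x * tnth (g x) i).
  by apply/funext => x /=; rewrite tnth_scaleRn.
apply: measurable_funM => //.
by apply: (measurableT_comp (f := fun z : Rn R n => tnth z i)) => //; exact: measurable_tnth.
Qed.

End Rn_structure.

Section measure_preserving.
Context {R : realType}.
Local Open Scope ereal_scope.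
Local Notation mu := (@lebesgue_measure R).
Local Notation leb n := (lebesgueRn R n).

(** Only nonnegative test functions are required; signed integrals follow by
    splitting into positive and negative parts. *)
Definition preserves n (T : Rn R n -> Rn R n) :=
  measurable_fun setT T /\
  forall f : Rn R n -> \bar R, measurable_fun setT f -> (forall z, 0 <= f z) ->
    \int[leb n]_z f (T z) = \int[leb n]_z f z.

Lemma preserves_id n : preserves (@id (Rn R n)).
Proof. by split. Qed.

Lemma preserves_comp n (S T : Rn R n -> Rn R n) :
  preserves S -> preserves T -> preserves (S \o T).
Proof.
move=> [mS pS] [mT pT]; split; first exact: measurableT_comp.
move=> f mf f0; rewrite -(pS f)//.
by rewrite -[RHS](pT (fun z => f (S z)))//; exact: measurableT_comp.
Qed.

Lemma preserves_integral n (T : Rn R n -> Rn R n) f :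
  preserves T -> measurable_fun setT f ->
  \int[leb n]_z f (T z) = \int[leb n]_z f z.
Proof.
move=> [_ pT] mf; rewrite integralE [RHS]integralE; congr (_ - _).
  rewrite -[RHS]pT//; last exact: measurable_funepos.
  by apply: eq_integral => z _; rewrite !funeposE.
rewrite -[RHS]pT//; last exact: measurable_funeneg.
by apply: eq_integral => z _; rewrite !funenegE.
Qed.

(** Maps that move the first coordinate by an amount depending on the others;
    shears and the reflection [flip] are of this form. *)
Definition head_map n (h : R -> Rn R n -> R) (z : Rn R n.+1) : Rn R n.+1 :=
  consRn (h (unconsRn z).1 (unconsRn z).2, (unconsRn z).2).

(** Maps that fix the first coordinate and move the others; together with
    [head_map] these are the two orders of integration in Tonelli's theorem. *)
Definition tail_map n (S : R -> Rn R n -> Rn R n) (z : Rn R n.+1) : Rn R n.+1 :=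
  consRn ((unconsRn z).1, S (unconsRn z).1 (unconsRn z).2).

Lemma preserves_head n (h : measurableTypeR R -> Rn R n -> measurableTypeR R) :
  measurable_fun setT (fun p => h p.1 p.2) ->
  (forall t f, measurable_fun setT f -> (forall x, 0 <= f x) ->
     \int[mu]_x f (h x t) = \int[mu]_x f x) ->
  preserves (head_map h).
Proof.
move=> mh ph; split.
  apply: measurable_consRnP.
    by apply: measurableT_comp mh _; exact: measurable_unconsRn.
  apply: (measurableT_comp (f := snd)) => //; exact: measurable_unconsRn.
move=> f mf f0.
have mT : measurable_fun setT (head_map h).
  apply: measurable_consRnP.
    by apply: measurableT_comp mh _; exact: measurable_unconsRn.
  apply: (measurableT_comp (f := snd)) => //; exact: measurable_unconsRn.
rewrite (ge0_integral_consRn2 (f := fun z => f (head_map h z)) (measurableT_comp mf mT)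
  (fun=> f0 _)) (ge0_integral_consRn2 mf f0).
apply: eq_integral => t _; rewrite -[RHS](ph t (fun x => f (consRn (x, t))))//.
  by apply: eq_integral => x _; rewrite /head_map consRnK.
by apply: measurableT_comp => //; exact: measurable_consRnP.
Qed.

Lemma preserves_tail n (S : measurableTypeR R -> Rn R n -> Rn R n) :
  measurable_fun setT (fun p => S p.1 p.2) ->
  (forall x, preserves (S x)) -> preserves (tail_map S).
Proof.
move=> mS pS.
have mT : measurable_fun setT (tail_map S).
  apply: measurable_consRnP.
    apply: (measurableT_comp (f := fst)) => //; exact: measurable_unconsRn.
  by apply: measurableT_comp mS _; exact: measurable_unconsRn.
split=> // f mf f0.
rewrite (ge0_integral_consRn (f := fun z => f (tail_map S z)) (measurableT_comp mf mT)
  (fun=> f0 _)) (ge0_integral_consRn mf f0).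
apply: eq_integral => x _; rewrite -[RHS]((pS x).2 (fun t => f (consRn (x, t))))//.
  by apply: eq_integral => t _; rewrite /tail_map consRnK.
by apply: measurableT_comp => //; exact: measurable_consRnP.
Qed.

Definition flip n : Rn R n.+1 -> Rn R n.+1 := head_map (fun x _ => (- x)%R).

Lemma preserves_flip n : preserves (@flip n).
Proof.
apply: preserves_head => [|t f mf f0]; last exact: ge0_integral_opp.
by apply: measurable_funN; exact: measurable_fst.
Qed.

Lemma preserves_shear n (h : Rn R n -> measurableTypeR R) : measurable_fun setT h ->
  preserves (head_map (fun x t => x + h t)%R).
Proof.
move=> mh; apply: preserves_head => [|t f mf f0]; last exact: ge0_integral_shift.
apply: measurable_funD; first exact: measurable_fst.
by apply: measurableT_comp mh _; exact: measurable_snd.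
Qed.

(** One-dimensional dilation in each variable in turn, hence the factor [s ^
    n]. *)
Lemma ge0_integral_scaleRn n (s : R) (f : Rn R n -> \bar R) : (0 < s)%R ->
  measurable_fun setT f -> (forall z, 0 <= f z) ->
  (s ^+ n)%:E * \int[leb n]_z f (scaleRn s z) = \int[leb n]_z f z.
Proof.
move=> s0; elim: n f => [|n IH] f mf f0.
  rewrite expr0 mul1e; apply: eq_integral => z _; congr f.
  by apply: eq_from_tnth => -[].
have mc x : measurable_fun setT (fun t : Rn R n => f (consRn (x, t))).
  by apply: measurableT_comp => //; exact: measurable_consRnP.
have ms : measurable_fun setT (fun z : Rn R n.+1 => f (scaleRn s z)).
  by apply: measurableT_comp => //; exact: measurable_scaleRn.
rewrite (ge0_integral_consRn ms (fun=> f0 _)) (ge0_integral_consRn mf f0).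
have mF : measurable_fun setT
    (fun x : measurableTypeR R => \int[leb n]_t f (consRn (x, t))).
  apply: (measurable_fun_fubini_tonelli_F (m2 := leb n) (fun p => f (consRn p))) => //.
  by apply: measurableT_comp => //; exact: measurable_consRn.
have F0 (x : measurableTypeR R) : 0 <= \int[leb n]_t f (consRn (x, t)).
  by apply: integral_ge0 => t _; exact: f0.
rewrite -[RHS](ge0_integral_dilation s0 mF F0).
rewrite exprS EFinM -muleA; congr (_ * _).
rewrite -ge0_integralZl_EFin//; last 3 first.
- by move=> x _; exact: integral_ge0.
- apply: (measurable_fun_fubini_tonelli_F (m2 := leb n)
    (fun p => f (scaleRn s (consRn p)))) => //.
  by apply: measurableT_comp => //; apply: measurable_scaleRn => //; exact: measurable_consRn.
- by rewrite exprn_ge0// ltW.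
apply: eq_integral => x _; rewrite -[RHS]IH//; congr (_ * _).
by apply: eq_integral => t _; rewrite scaleRn_cons.
Qed.

End measure_preserving.

(** * Rotations *)

Section rotations.
Context {R : realType}.
Arguments unconsRn : simpl never.
Arguments consRn : simpl never.

Definition rot n (c s : R) (z : Rn R n.+2) : Rn R n.+2 :=
  let: (x, t) := unconsRn z in let: (y, t') := unconsRn t in
  consRn (c * x - s * y, consRn (s * x + c * y, t')).

Lemma rot_cons n (c s x y : R) (t : Rn R n) :
  rot c s (consRn (x, consRn (y, t))) =
  consRn (c * x - s * y, consRn (s * x + c * y, t)).
Proof. by rewrite /rot !consRnK. Qed.

Lemma eq_consRn2 n (x x' y y' : R) (t : Rn R n) : x = x' -> y = y' ->
  consRn (x, consRn (y, t)) = consRn (x', consRn (y', t)).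
Proof. by move=> -> ->. Qed.

Definition shear0 n (a : R) : Rn R n.+2 -> Rn R n.+2 :=
  head_map (fun x t => x + a * (unconsRn t).1).

Definition shear1 n (a : R) : Rn R n.+2 -> Rn R n.+2 :=
  tail_map (fun x => head_map (fun y _ => y + a * x)).

Lemma preserves_shear0 n a : preserves (@shear0 n a).
Proof.
apply: preserves_shear; apply: measurable_funM => //.
by apply: (measurableT_comp (f := fst)) => //; exact: measurable_unconsRn.
Qed.

Lemma preserves_shear1 n a : preserves (@shear1 n a).
Proof.
have mu1 : measurable_fun setT (fun p : measurableTypeR R * Rn R n.+1 => (unconsRn p.2).1).
  apply: (measurableT_comp (f := fst)) => //.
  by apply: measurableT_comp; [exact: measurable_unconsRn|exact: measurable_snd].
apply: preserves_tail => [|x]; last exact: (preserves_shear (h := fun=> a * x)).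
apply: measurable_consRnP.
  by apply: measurable_funD => //; apply: measurable_funM => //; exact: measurable_fst.
apply: (measurableT_comp (f := snd)) => //.
by apply: measurableT_comp; [exact: measurable_unconsRn|exact: measurable_snd].
Qed.

(** The three-shear factorization of a rotation of angle [theta]; [(1 - c) /
    s] is [tan (theta / 2)], which is why [s != 0] is needed. *)
Lemma rot_shears n (c s : R) : c ^+ 2 + s ^+ 2 = 1 -> s != 0 ->
  @rot n c s = shear0 (- ((1 - c) / s)) \o shear1 s \o shear0 (- ((1 - c) / s)).
Proof.
move=> cs1 s0; apply/funext; apply: Rn_ind => x; apply: Rn_ind => y t.
rewrite rot_cons /= /shear0 /shear1 /head_map /tail_map !consRnK/=.
set b := (1 - c) / s.
have bs : b * s = 1 - c by rewrite /b divfK.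
have bc : b * (1 + c) = s.
  apply: (mulIf s0); rewrite mulrAC bs -expr2.
  transitivity ((c ^+ 2 + s ^+ 2) - c ^+ 2); [rewrite cs1|]; ring.
have cE : c = 1 - b * s by rewrite bs; ring.
apply: eq_consRn2; last by rewrite [c in LHS]cE; ring.
 rewrite -[s in LHS]bc cE; ring.
Qed.

(** The factorization into shears fails for the half turn, which is the square
    of a quarter turn. *)
Lemma preserves_rot n (c s : R) : c ^+ 2 + s ^+ 2 = 1 -> preserves (@rot n c s).
Proof.
have main c' s' : c' ^+ 2 + s' ^+ 2 = 1 -> s' != 0 -> preserves (@rot n c' s').
  move=> cs1 s0; rewrite rot_shears//.
  by do 2?apply: preserves_comp; [exact: preserves_shear0|exact: preserves_shear1
    |exact: preserves_shear0].
move=> cs1; have [s0|] := eqVneq s 0; last exact: main.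
move: cs1; rewrite s0 expr0n/= addr0 => /eqP; rewrite sqrf_eq1 => /orP[] /eqP ->.
  rewrite (_ : rot 1 0 = id); first exact: preserves_id.
  apply/funext; apply: Rn_ind => x; apply: Rn_ind => y t.
  by rewrite rot_cons -[RHS]/(consRn (x, consRn (y, t))); apply: eq_consRn2; ring.
rewrite (_ : rot (-1) 0 = rot 0 1 \o rot 0 1).
  by apply: preserves_comp; apply: main; rewrite ?oner_eq0// expr0n/= expr1n add0r.
apply/funext; apply: Rn_ind => x; apply: Rn_ind => y t.
transitivity (rot 0 1 (rot 0 1 (consRn (x, consRn (y, t))))); last by [].
by rewrite (rot_cons 0 1 x y) !rot_cons; apply: eq_consRn2; ring.
Qed.

(** A rotation carrying the first axis to [e], built one plane at a time: rotate
    the first two coordinates so that the tail of [e] is aligned with its own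
    first axis, and recurse on the tail. The third property says that only the
    [e]-component of the image depends on the first coordinate; it replaces the
    matrix of the rotation when the direction of the gradient symbol is found. *)
Lemma exists_rotation n (e : Rn R n.+1) : enorm e = 1 ->
  exists (O : Rn R n.+1 -> Rn R n.+1) (L : Rn R n -> 'I_n.+1 -> R),
  [/\ preserves O, forall z, enorm (O z) = enorm z,
      forall x t j, tnth (O (consRn (x, t))) j = tnth e j * x + L t j &
      forall z, \sum_i tnth e i * tnth (O z) i = tnth z ord0].
Proof.
elim: n e => [e|n IH].
  move=> e1.
  have e01 : tnth e ord0 ^+ 2 = 1.
    by rewrite -(expr1n _ 2) -e1 sqr_enorm big_ord1.
  have H j (z : Rn R 1) : tnth z j = tnth z ord0 by rewrite ord1.
  move/eqP : (e01); rewrite sqrf_eq1 => /orP[] /eqP e0.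
    exists id, (fun _ _ => 0); split => //.
    - by move=> x t j; rewrite ord1 e0 mul1r addr0.
    - by move=> z; rewrite big_ord1 e0 mul1r.
  exists (@flip _ 0), (fun _ _ => 0); split; first exact: preserves_flip.
  - apply: Rn_ind => x t; apply: enorm_eq.
    by rewrite /flip /head_map !sqr_enorm_cons !consRnK/= sqrrN.
  - by move=> x t j; rewrite ord1 e0 mulN1r addr0 /flip /head_map consRnK.
  - apply: Rn_ind => x t.
    by rewrite big_ord1 e0 mulN1r /flip /head_map consRnK tnth_consRn0 opprK.
apply: Rn_ind => c e'' ce.
set s := enorm e''.
(* When the tail of [e] vanishes any unit vector will do. *)
have [e' e'1 e'E] : exists2 e', enorm e' = 1 & e'' = scaleRn s e'.
  have [s0|s0] := eqVneq s 0.
    exists (consRn (1, scaleRn 0 [tuple of behead e''])).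
      apply/eqP; rewrite -(@eqrXn2 _ 2%N) ?enorm_ge0// sqr_enorm_cons/= enorm_scaleRn//.
      by rewrite mul0r expr0n addr0.
    apply: eq_from_tnth => i; rewrite tnth_scaleRn s0 mul0r.
    by apply/eqP; rewrite -normr_le0 -s0; exact: ler_tnth_enorm.
  exists (scaleRn s^-1 e''); first by rewrite enorm_scaleRn ?invr_ge0 ?enorm_ge0// mulVf.
  by apply: eq_from_tnth => i; rewrite !tnth_scaleRn mulVKf.
have cs1 : c ^+ 2 + s ^+ 2 = 1 by rewrite -(sqr_enorm_cons (c, e'')) ce expr1n.
have [ O' [L' [pO' isoO' decO' dotO']]] := IH _ e'1.
exists (tail_map (fun=> O') \o rot c s).
exists (fun t j => if unlift ord0 j is Some j'
   then tnth e' j' * (c * (unconsRn t).1) + L' (unconsRn t).2 j' else - s * (unconsRn t).1).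
split.
- apply: preserves_comp; last exact: preserves_rot.
  apply: preserves_tail => //.
  by apply: measurableT_comp; [exact: pO'.1|exact: measurable_snd].
- apply: Rn_ind => x; apply: Rn_ind => y t; apply: enorm_eq.
  rewrite /= rot_cons /tail_map consRnK/= sqr_enorm_cons isoO' !sqr_enorm_cons/=.
  transitivity ((c ^+ 2 + s ^+ 2) * (x ^+ 2 + y ^+ 2) + enorm t ^+ 2); first by ring.
  by rewrite cs1; ring.
- move=> x; apply: Rn_ind => y t j.
  rewrite /comp rot_cons /tail_map !consRnK.
  case: (unliftP ord0 j) => [j'|] ->.
    by rewrite !tnth_consRnS  decO' e'E tnth_scaleRn/=; ring.
  by rewrite !tnth_consRn0/=; ring.
- apply: Rn_ind => x; apply: Rn_ind => y t.
  rewrite /= rot_cons /tail_map !consRnK/= big_ord_recl !tnth_consRn0/=.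
  rewrite (eq_bigr (fun i => s * (tnth e' i * tnth (O' (consRn (s * x + c * y, t))) i))).
    rewrite -mulr_sumr dotO' tnth_consRn0/=.
    transitivity ((c ^+ 2 + s ^+ 2) * x); first by ring.
    by rewrite cs1 mul1r.
  by move=> i _; rewrite !tnth_consRnS /= e'E tnth_scaleRn mulrA.
Qed.

End rotations.

(** * Polar coordinates *)

Section polar.
Context {R : realType}.
Local Open Scope ereal_scope.
Local Notation mu := (@lebesgue_measure R).
Local Notation leb n := (lebesgueRn R n).

(** Density of the measure on the annulus [1/2 <= |w| <= 1] that plays the
    role of the surface measure of the sphere in polar coordinates. *)
Definition annulus_weight n (w : Rn R n.+1) : R :=
  (if (2^-1 <= enorm w) && (enorm w <= 1) then enorm w ^- n.+2 else 0)%R.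

Lemma annulus_weight_ge0 n (w : Rn R n.+1) : (0 <= annulus_weight w)%R.
Proof. by rewrite /annulus_weight; case: ifP => // _; rewrite invr_ge0 exprn_ge0// enorm_ge0. Qed.

Lemma measurable_invr : measurable_fun setT (@GRing.inv R : measurableTypeR R -> measurableTypeR R).
Proof. 
have -> : @GRing.inv R = (fun x => x * (x ^+ 2) `^ (- 1))%R.
  apply/funext => x; rewrite powR_inv1 ?sqr_ge0//.
  by have [->|x0] := eqVneq x 0%R; [rewrite invr0 mul0r|field].
apply: measurable_funM => //; apply: (@measurableT_comp _ _ _ _ _ _
  (fun y : measurableTypeR R => (y `^ (- 1))%R : measurableTypeR R)).
  exact: measurable_powR.
exact: measurable_funX.
Qed.

Lemma measurable_annulus_weight n : measurable_fun setT (@annulus_weight n).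
Proof.
have me := @measurable_enorm R n.+1.
apply: measurable_fun_ifT => //.
  by apply: measurable_and; apply: measurable_fun_ler.
apply: (measurableT_comp measurable_invr).
exact: measurable_funX.
Qed.

(** The integrand on the ray through [w], with the Jacobian of polar
    coordinates. *)
Definition radial_integrand n (F : Rn R n.+1 -> \bar R) (w : Rn R n.+1) (r : R) :=
  (if (0 < r)%R then (r ^+ n)%:E * F (scaleRn (r / enorm w) w) else 0).

Lemma radial_integrand_ge0 n F (w : Rn R n.+1) r :
  (forall z, 0 <= F z) -> 0 <= radial_integrand F w r.
Proof.
move=> F0; rewrite /radial_integrand; case: ifP => // r0.
by rewrite mule_ge0// lee_fin exprn_ge0// ltW.
Qed.

Lemma measurable_radial_integrand n (F : Rn R n.+1 -> \bar R) : measurable_fun setT F ->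
  measurable_fun setT
    (fun p : measurableTypeR R * Rn R n.+1 => radial_integrand F p.2 p.1).
Proof.
move=> mF; apply: measurable_fun_ifT => //.
  by apply: measurable_fun_ltr => //; exact: measurable_fst.
apply: emeasurable_funM.
  by apply/measurable_EFinP; apply: measurable_funX; exact: measurable_fst.
apply: measurableT_comp => //.
apply: measurable_scaleRn; last exact: measurable_snd.
apply: measurable_funM; first exact: measurable_fst.
apply: (measurableT_comp measurable_invr).
by apply: measurableT_comp; [exact: measurable_enorm|exact: measurable_snd].
Qed.

(** Its integral over [s] is [1] for every [z != 0]: the interval [[|z|, 2|z|]]
    has length [|z|]. *)
Let layer (s : R) n (z : Rn R n.+1) : R :=
  (if (enorm z <= s) && (s <= 2 * enorm z) then (enorm z)^-1 else 0)%R.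

Let layer_ge0 s n (z : Rn R n.+1) : (0 <= layer s z)%R.
Proof. by rewrite /layer; case: ifP => // _; rewrite invr_ge0 enorm_ge0. Qed.

Let measurable_layer n :
  measurable_fun setT (fun p : measurableTypeR R * Rn R n.+1 => layer p.1 p.2).
Proof.
have me : measurable_fun setT (fun p : measurableTypeR R * Rn R n.+1 => enorm p.2).
  by apply: measurableT_comp; [exact: measurable_enorm|exact: measurable_snd].
apply: measurable_fun_ifT => //.
  apply: measurable_and; apply: measurable_fun_ler => //.
  exact: measurable_funM.
exact: (measurableT_comp measurable_invr).
Qed.

Let integral_layer n (z : Rn R n.+1) : enorm z != 0%R ->
  \int[mu]_s (layer s z)%:E = 1.
Proof.
move=> z0; have zp : (0 < enorm z)%R by rewrite lt_neqAle eq_sym z0 enorm_ge0.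
transitivity (\int[mu]_(s in [set` `[enorm z, (2 * enorm z)%R]]) cst ((enorm z)^-1)%:E s).
  rewrite [RHS]integral_mkcond; apply: eq_integral => s _.
  by rewrite patchE /layer mem_setE in_itv/=; case: ifP.
rewrite integral_cst//= lebesgue_measure_itv/= lte_fin.
rewrite ifT; last by lra.
by rewrite -EFinB -EFinM; congr EFin; field.
Qed.

(** Inserting [1 = int 1_(|z| <= s <= 2|z|) / |z| ds], exchanging the integrals
    and dilating [z = s w] leaves an integral over directions [w] smeared over an
    annulus and over the radius [s]; a last dilation [r = s |w|] makes the inner
    integral depend on the direction of [w] only. *)
Lemma ge0_integral_polar n (F : Rn R n.+1 -> \bar R) :
  measurable_fun setT F -> (forall z, 0 <= F z) ->
  (forall z, enorm z = 0%R -> F z = 0) ->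
  \int[leb n.+1]_z F z = \int[leb n.+1]_w ((annulus_weight w)%:E *
    \int[mu]_r radial_integrand F w r).
Proof.
move=> mF F0 Fz.
pose G (p : measurableTypeR R * Rn R n.+1) := (layer p.1 p.2)%:E * F p.2.
have mG : measurable_fun setT G.
  apply: emeasurable_funM; first by apply/measurable_EFinP; exact: measurable_layer.
  by apply: measurableT_comp => //; exact: measurable_snd.
have G0 p : 0 <= G p by rewrite mule_ge0// lee_fin layer_ge0.
transitivity (\int[leb n.+1]_z \int[mu]_s G (s, z)).
  apply: eq_integral => z _; rewrite /G/=.
  have [z0|z0] := eqVneq (enorm z) 0%R.
    by rewrite Fz//; under eq_integral do rewrite mule0; rewrite integral0.
  rewrite ge0_integralZr//.
  - by rewrite integral_layer// mul1e.
  - apply/measurable_EFinP.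
    apply: (measurableT_comp (measurable_layer (n := n)) (g := fun s => (s, z))).
    exact: measurable_fun_pair.
  - by move=> s _; rewrite lee_fin layer_ge0.
rewrite -(fubini_tonelli (m1 := mu) (m2 := leb n.+1))//.
pose H (p : measurableTypeR R * Rn R n.+1) : \bar R :=
  (if (0 < p.1)%R then (p.1 ^+ n)%:E * F (scaleRn p.1 p.2) else 0).
have H0 p : 0 <= H p.
  by rewrite /H; case: ifP => // p0; rewrite mule_ge0// lee_fin exprn_ge0// ltW.
have mH : measurable_fun setT H.
  apply: measurable_fun_ifT => //.
    by apply: measurable_fun_ltr => //; exact: measurable_fst.
  apply: emeasurable_funM.
    by apply/measurable_EFinP; apply: measurable_funX; exact: measurable_fst.
  apply: measurableT_comp => //.
  by apply: measurable_scaleRn; [exact: measurable_fst|exact: measurable_snd].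
pose a (w : Rn R n.+1) : R :=
  (if (2^-1 <= enorm w) && (enorm w <= 1) then (enorm w)^-1 else 0)%R.
have a0 w : (0 <= a w)%R.
  by rewrite /a; case: ifP => // _; rewrite invr_ge0 enorm_ge0.
have ma : measurable_fun setT a.
  have me := @measurable_enorm R n.+1.
  apply: measurable_fun_ifT => //.
    by apply: measurable_and; apply: measurable_fun_ler.
  exact: (measurableT_comp measurable_invr).
have maH : measurable_fun setT (fun p => (a p.2)%:E * H p).
  apply: emeasurable_funM => //; apply/measurable_EFinP.
  by apply: measurableT_comp => //; exact: measurable_snd.
transitivity (\int[mu]_s \int[leb n.+1]_w ((a w)%:E * H (s, w))).
  apply: eq_integral => s _; have [s0|s0] := ltP 0%R s; last first.
    rewrite !integral0_eq// => z _; rewrite /G/H/=.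
      by rewrite ltNge s0/= mule0.
    rewrite /layer; case: ifP => [/andP[zs _]|]; last by rewrite mul0e.
    rewrite Fz ?mule0//; apply/eqP; rewrite eq_le enorm_ge0 andbT.
    exact: le_trans s0.
  rewrite -[LHS](ge0_integral_scaleRn s0)//; last 1 first.
    apply: (measurableT_comp (f := G) (g := fun w => (s, w))) => //.
    exact: measurable_fun_pair.
  rewrite -ge0_integralZl_EFin//; last 2 first.
  - apply: (measurableT_comp (f := G) (g := fun w => (s, scaleRn s w))) => //.
    by apply: measurable_fun_pair => //; exact: measurable_scaleRn.
  - by rewrite exprn_ge0// ltW.
  apply: eq_integral => w _; rewrite /G/H/= s0 muleA [RHS]muleA -!EFinM.
  congr (_%:E * _); rewrite /layer/a enorm_scaleRn ?(ltW s0)//.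
  have -> : (s * enorm w <= s)%R = (enorm w <= 1)%R by rewrite -[leRHS]mulr1 ler_pM2l.
  have -> : (s <= 2 * (s * enorm w))%R = (2^-1 <= enorm w)%R.
    by rewrite mulrCA -[leLHS]mulr1 ler_pM2l// -ler_pdivrMl// mulr1.
  rewrite andbC; case: ifP => [/andP[w2 _]|_]; last by rewrite mulr0 mul0r.
  by rewrite exprS; field; rewrite !gt_eqF//; apply: lt_le_trans w2; rewrite invr_gt0.
rewrite (fubini_tonelli (m1 := mu) (m2 := leb n.+1) (fun p => (a p.2)%:E * H p))//; last first.
  by move=> p; rewrite mule_ge0// lee_fin.
apply: eq_integral => w _.
have mHw : measurable_fun setT (fun s : measurableTypeR R => H (s, w)).
  apply: (measurableT_comp (f := H) (g := fun s => (s, w))) => //.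
transitivity (\int[mu]_s ((a w)%:E * H (s, w))) => //.
rewrite ge0_integralZl_EFin// /a /annulus_weight.
case: ifP => [/andP[w2 _]|_]; last by rewrite !mul0e.
have wp : (0 < enorm w)%R by apply: lt_le_trans w2; rewrite invr_gt0.
have wi : (0 < (enorm w)^-1)%R by rewrite invr_gt0.
rewrite -(ge0_integral_dilation wi mHw)//.
have -> : (enorm w ^- n.+2 = (enorm w)^-1 * (enorm w)^-1 * (enorm w)^-1 ^+ n)%R.
  by rewrite -exprVn 2!exprS mulrA.
rewrite 2![in RHS]EFinM -2![in RHS]muleA; congr (_ * (_ * _)).
rewrite -ge0_integralZl_EFin//; last 3 first.
- by move=> r _; apply: radial_integrand_ge0.
- exact: (measurableT_comp (measurable_radial_integrand mF) (g := fun r => (r, w))).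
- by rewrite exprn_ge0// ltW.
apply: eq_integral => r _; rewrite /H /radial_integrand/= pmulr_rgt0//.
case: ifP => r0; last by rewrite mule0.
by rewrite muleA -EFinM -exprMn (mulrC r).
Qed.

End polar.

(** * Taylor bounds for sine and cosine *)

Section elementary_trigonometry.
Context {R : realType}.
Implicit Types x y : R.

(** Each Taylor bound below is the antiderivative of the preceding one. *)
Lemma ge0_of_derive (f f' : R -> R) : (forall x, is_derive x 1 f (f' x)) -> f 0 = 0 ->
  (forall x, 0 <= x -> 0 <= f' x) -> forall x, 0 <= x -> 0 <= f x.
Proof.
move=> df f0 f'0 x; rewrite le_eqVlt => /predU1P[<-|x0]; first by rewrite f0.
have [|c] := @MVT _ f f' 0 x x0 (fun y _ => df y).
  apply: continuous_subspaceT => y; apply: differentiable_continuous.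
  by apply/derivable1_diffP; exact: ex_derive.
rewrite in_itv/= => /andP[/ltW c0 _]; rewrite f0 !subr0 => ->.
by rewrite mulr_ge0 ?f'0 // ltW.
Qed.

Local Ltac derive_poly := apply: is_derive_eq; rewrite /GRing.scale /=; field.

Lemma sin_le_id x : 0 <= x -> 0 <= x - sin x.
Proof.
have D (y : R) : is_derive y 1 (fun x : R => x - sin x)
  ((fun x => 1 - cos x) y) by derive_poly.
apply: (ge0_of_derive D).
- by rewrite sin0 subr0.
- by move=> y _; rewrite subr_ge0 cos_le1.
Qed.

Lemma abs_sin_le x : `|sin x| <= `|x|.
Proof.
have H y : 0 <= y -> `|sin y| <= `|y|.
  move=> y0; rewrite (ger0_norm y0) ler_norml -subr_ge0 -[X in _ && X]subr_ge0.
  rewrite (sin_le_id y0) andbT opprK.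
  have D (z : R) : is_derive z 1 (fun z : R => sin z + z) ((fun z => cos z + 1) z).
    by derive_poly.
  apply: (ge0_of_derive D) y0; first by rewrite sin0 addr0.
  by move=> z _; rewrite -lerBlDr sub0r cos_geN1.
have [/H//|/ltW x0] := leP 0 x.
by rewrite -normrN -sinN -(normrN x) H// oppr_ge0.
Qed.

Lemma cos_ge_quadratic_ge0 x : 0 <= x -> 0 <= x ^+ 2 / 2 - (1 - cos x).
Proof.
have D (y : R) : is_derive y 1 (fun x : R => x ^+ 2 / 2 - (1 - cos x))
  ((fun x => x - sin x) y) by derive_poly.
apply: (ge0_of_derive D).
- by rewrite cos0; lra.
- exact: sin_le_id.
Qed.

Lemma sin_ge_cubic x : 0 <= x -> 0 <= x ^+ 3 / 6 - (x - sin x).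
Proof.
have D (y : R) : is_derive y 1 (fun x : R => x ^+ 3 / 6 - (x - sin x))
  ((fun x => x ^+ 2 / 2 - (1 - cos x)) y) by derive_poly.
apply: (ge0_of_derive D).
- by rewrite sin0; lra.
- exact: cos_ge_quadratic_ge0.
Qed.

Lemma cos_le_quartic_ge0 x : 0 <= x -> 0 <= x ^+ 4 / 24 - (x ^+ 2 / 2 - (1 - cos x)).
Proof.
have D (y : R) : is_derive y 1 (fun x : R => x ^+ 4 / 24 - (x ^+ 2 / 2 - (1 - cos x)))
  ((fun x => x ^+ 3 / 6 - (x - sin x)) y) by derive_poly.
apply: (ge0_of_derive D).
- by rewrite cos0; lra.
- exact: sin_ge_cubic.
Qed.

Lemma sin_le_quintic x : 0 <= x -> 0 <= x ^+ 5 / 120 - (x ^+ 3 / 6 - (x - sin x)).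
Proof.
have D (y : R) : is_derive y 1 (fun x : R => x ^+ 5 / 120 - (x ^+ 3 / 6 - (x - sin x)))
  ((fun x => x ^+ 4 / 24 - (x ^+ 2 / 2 - (1 - cos x))) y) by derive_poly.
apply: (ge0_of_derive D).
- by rewrite sin0; lra.
- exact: cos_le_quartic_ge0.
Qed.

Lemma ge0_even (f : R -> R) : (forall x, f (- x) = f x) -> (forall x, 0 <= x -> 0 <= f x) ->
  forall x, 0 <= f x.
Proof.
move=> fN f0 x; have [x0|/ltW x0] := leP 0 x; first exact: f0.
by rewrite -fN f0// oppr_ge0.
Qed.

Lemma cos_ge_quadratic x : 0 <= x ^+ 2 / 2 - (1 - cos x).
Proof.
apply: (@ge0_even (fun x => x ^+ 2 / 2 - (1 - cos x))) x => [x|x].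
  by rewrite cosN sqrrN.
exact: cos_ge_quadratic_ge0.
Qed.

Lemma cos_le_quartic x : x ^+ 2 / 2 - (1 - cos x) <= x ^+ 4 / 24.
Proof.
rewrite -subr_ge0.
apply: (@ge0_even (fun x => x ^+ 4 / 24 - (x ^+ 2 / 2 - (1 - cos x)))) x => [x|x].
  by rewrite cosN sqrrN; congr (_ / _ - _); ring.
exact: cos_le_quartic_ge0.
Qed.

Lemma cos_le_quadratic x : `|x| <= 1 -> x ^+ 2 / 4 <= 1 - cos x.
Proof.
move=> x1; have x2 : x ^+ 2 <= 1 by rewrite -(real_normK (num_real x)) exprn_ile1.
have := cos_le_quartic x; have -> : x ^+ 4 = x ^+ 2 * x ^+ 2 by ring.
by have := sqr_ge0 x; set y := x ^+ 2 in x2 *; nra.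
Qed.

Lemma mul_sub_sin_ge0 x : 0 <= x * (x - sin x).
Proof.
apply: (@ge0_even (fun x => x * (x - sin x))) x => [x|x x0].
  by rewrite sinN; ring.
by rewrite mulr_ge0// sin_le_id.
Qed.

Lemma mul_sub_sin_le x : x * (x - sin x) <= x ^+ 4 / 6.
Proof.
rewrite -subr_ge0.
apply: (@ge0_even (fun x => x ^+ 4 / 6 - x * (x - sin x))) x => [x|x x0].
  by rewrite sinN; ring.
rewrite (_ : _ - _ = x * (x ^+ 3 / 6 - (x - sin x))); last by field.
by rewrite mulr_ge0// sin_ge_cubic.
Qed.

(** Up to [y = 2] the quintic Taylor bound is enough; beyond, [sin y <= 1 <= y
    / 2]. *)
Lemma sub_sin_ge_min y : 0 < y -> y * Num.min 1 (y ^+ 2) / 15 <= y - sin y.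
Proof.
move=> y0; have [y2|y2] := leP y 2.
  have := sin_le_quintic (ltW y0); rewrite -subr_ge0 => H.
  have : y * Num.min 1 (y ^+ 2) <= y * y ^+ 2 by rewrite ler_pM2l// ge_min lexx orbT.
  have yy : y ^+ 2 <= 4 by rewrite expr2; nra.
  have e5 : y ^+ 5 = y * y ^+ 2 * y ^+ 2 by ring.
  have e3 : y ^+ 3 = y * y ^+ 2 by ring.
  rewrite e5 e3 in H.
  have : 0 <= y * y ^+ 2 by rewrite mulr_ge0 ?sqr_ge0// ltW.
  by move: yy H; set a := y * y ^+ 2; set b := y ^+ 2; set m := y * _; nra.
have : y * Num.min 1 (y ^+ 2) <= y * 1 by rewrite ler_pM2l// ge_min lexx.
by have := sin_le1 y; lra.
Qed.

End elementary_trigonometry.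

(** * Sine integrals of nonincreasing functions *)

Section layer_cake.
Context {R : realType}.
Local Open Scope ereal_scope.
Local Notation mu := (@lebesgue_measure R).

Lemma integral_derive_itv (F f : R -> R) (S : R) : (0 <= S)%R -> continuous f ->
  (forall x : R, is_derive x (1 : R)%R F (f x)) ->
  \int[mu]_(x in `]0%R, S[) (f x)%:E = (F S - F 0)%:E.
Proof.
move=> S0 cf dF; have [->|Sn0] := eqVneq S 0%R.
  by rewrite set_itvE integral_set0 subrr.
have Sp : (0 < S)%R by rewrite lt_neqAle eq_sym Sn0.
have dvF x : derivable F x 1 by exact: ex_derive.
have cF : continuous F.
  by move=> x; apply: differentiable_continuous; apply/derivable1_diffP; exact: dvF.
rewrite -(@integral_itv_bndoo _ _ _ (EFin \o f) true false); last first.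
  apply/measurable_EFinP; apply: measurable_funTS; exact: continuous_measurable_fun.
rewrite (continuous_FTC2 (F := F))//.
- exact: continuous_subspaceT.
- split.
  + by move=> x _.
  + by apply: cvg_at_right_filter; exact: cF.
  + by apply: cvg_at_left_filter; exact: cF.
- by move=> x _; rewrite derive1E derive_val.
Qed.

(** Extension by zero to the line: the kernel profiles and the radial
    integrands are only meaningful for positive radii. *)
Definition on_pos (f : R -> R) (r : R) : R := (if 0 < r then f r else 0)%R.

Definition superlevel (m g : R -> R) (t r : R) : R :=
  (if [&& 0 < r, 0 <= t & t < m r] then g r else 0)%R.

Lemma measurable_on_pos (f : measurableTypeR R -> measurableTypeR R) : measurable_fun setT f ->
  measurable_fun setT (on_pos f : measurableTypeR R -> measurableTypeR R).
Proof. by move=> mf; apply: measurable_fun_ifT => //; exact: measurable_fun_ltr. Qed.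

Lemma measurable_superlevel (m g : measurableTypeR R -> measurableTypeR R) :
  measurable_fun setT m -> measurable_fun setT g ->
  measurable_fun setT (fun p : measurableTypeR R * measurableTypeR R =>
    superlevel m g p.1 p.2 : measurableTypeR R).
Proof.
move=> mm mg.
have m1 : measurable_fun setT (@fst (measurableTypeR R) (measurableTypeR R)).
  exact: measurable_fst.
have m2 : measurable_fun setT (@snd (measurableTypeR R) (measurableTypeR R)).
  exact: measurable_snd.
apply: measurable_fun_ifT => //; last exact: measurableT_comp.
apply: measurable_and; first by apply: measurable_fun_ltr.
apply: measurable_and; first by apply: measurable_fun_ler.
by apply: measurable_fun_ltr => //; exact: measurableT_comp.
Qed.

(** Tonelli applied to [m r = int 1_(0 <= t < m r) dt]. *)
Lemma layer_cake (m g : measurableTypeR R -> measurableTypeR R) :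
  measurable_fun setT m -> measurable_fun setT g ->
  (forall r : R, 0 < r -> 0 <= m r)%R -> (forall r : R, 0 < r -> 0 <= g r)%R ->
  \int[mu]_r (on_pos (fun r => m r * g r)%R r)%:E =
  \int[mu]_t \int[mu]_r (superlevel m g t r)%:E.
Proof.
move=> mm mg m0 g0.
rewrite (fubini_tonelli (m1 := mu) (m2 := mu)
  (fun p => (superlevel m g p.1 p.2)%:E)); last 2 first.
- by apply/measurable_EFinP; exact: measurable_superlevel.
- move=> p; rewrite lee_fin /superlevel; case: ifP => // /and3P[+ _ _]; exact: g0.
apply: eq_integral => r _ /=; rewrite /on_pos /superlevel.
have [r0|r0] := ltP 0%R r; last by rewrite integral0.
transitivity (\int[mu]_(t in `[0%R, m r[) cst (g r)%:E t); last first.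
  rewrite [LHS]integral_mkcond; apply: eq_integral => t _.
  by rewrite patchE mem_setE in_itv/=; case: ifP.
rewrite integral_cst//= lebesgue_measure_itv/= lte_fin.
case: ifPn => [_|]; first by rewrite -EFinB -EFinM subr0 mulrC.
rewrite -leNgt => mr0; rewrite mule0 (_ : m r = 0%R) ?mul0r//.
by apply/eqP; rewrite eq_le mr0 m0.
Qed.

(** The superlevel set [{0 < r < 1 : t < m r}] is an initial interval, open or
    closed at its right end [S]. The value of [m] at [1] is not controlled by
    monotonicity, so both points [1] and [S] are removed before comparing. *)
Lemma superlevel_itv (m : measurableTypeR R -> measurableTypeR R) (t : R) :
  measurable_fun setT m ->
  (forall r s : R, 0 < r -> r <= s -> s < 1 -> m s <= m r)%R ->
  (forall r : R, 1 < r -> m r = 0)%R -> (0 <= t)%R ->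
  exists S : R, [/\ (0 <= S)%R, (forall r, 0 < r < 1 -> t < m r -> r <= S)%R,
    (forall r, 0 < r < 1 -> m r <= t -> S <= r)%R &
    forall g : measurableTypeR R -> measurableTypeR R, measurable_fun setT g ->
    \int[mu]_r (superlevel m g t r)%:E = \int[mu]_(r in `]0%R, S[) (g r)%:E].
Proof.
move=> mm mdec m1 t0.
pose A := [set r : R | r = 0%R \/ (0 < r < 1)%R /\ (t < m r)%R].
have A0 : A 0%R by left.
have hA : has_sup A.
  split; first by exists 0%R.
  by exists 1%R => r [->//|[/andP[_ /ltW]]].
pose S := sup A.
have S0 : (0 <= S)%R by exact: (ub_le_sup hA.2).
have AS r : (0 < r < 1)%R -> (t < m r)%R -> (r <= S)%R.
  by move=> r01 tm; apply: (ub_le_sup hA.2); right.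
have SA r : (0 < r)%R -> (r < S)%R -> (r < 1 /\ t < m r)%R.
  move=> r0 rS; have [s As rs] := sup_gt (ex_intro _ _ A0) rS.
  case: As rs => [->|[/andP[s0 s1] tms] rs]; first by rewrite ltNge ltW.
  split; first exact: lt_trans s1.
  by apply: (lt_le_trans tms); apply: mdec => //; exact: ltW.
exists S; split=> //.
  move=> r /andP[r0 r1] mrt; rewrite leNgt; apply/negP => rS.
  by have [_] := SA _ r0 rS; rewrite ltNge mrt.
move=> g mg.
have msl : measurable_fun setT (fun r : measurableTypeR R => (superlevel m g t r)%:E).
  apply/measurable_EFinP.
  apply: (measurableT_comp (f := fun p => superlevel m g p.1 p.2) (g := fun r => (t, r))).
    exact: measurable_superlevel.
  exact: measurable_fun_pair.
have mD : measurable ([set: measurableTypeR R] `\ 1%R `\ S).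
  by apply: measurableD => //; apply: measurableD.
pose h : measurableTypeR R -> \bar R :=
  (EFin \o g) \_ ([set` `]0%R, S[] : set (measurableTypeR R)).
have mh : measurable_fun setT h.
  apply/(measurable_restrictT (EFin \o g)) => //.
  by apply: measurable_funTS; apply/measurable_EFinP.
transitivity (\int[mu]_(r in [set: measurableTypeR R] `\ 1%R `\ S) (superlevel m g t r)%:E).
  rewrite integral_setD1//; last exact: measurable_funTS.
  by rewrite integral_setD1//; [exact: measurableD|exact: measurable_funTS].
rewrite [RHS]integral_mkcond -/h.
transitivity (\int[mu]_(r in [set: measurableTypeR R] `\ 1%R `\ S) h r); last first.
  rewrite integral_setD1//; last exact: measurable_funTS.
  by rewrite integral_setD1//; [exact: measurableD|exact: measurable_funTS].
apply: eq_integral => r; rewrite inE/= => -[[_ r1] rS].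
rewrite /h patchE mem_setE in_itv/= /superlevel t0/=.
have [r0|r0] //= := ltP 0%R r.
have [rlt|rge] := ltP r S.
  by rewrite (SA r r0 rlt).2.
case: ifP => // tmr; exfalso; apply: rS; apply/eqP.
rewrite eq_le rge andbT; apply: AS => //; rewrite r0/= ltNge le_eqVlt.
rewrite negb_or eq_sym; apply/andP; split; first exact/eqP.
by apply/negP => r1'; move: tmr; rewrite m1// ltNge t0.
Qed.

(** A quantitative form of [int m(r) sin (a r) dr >= 0], written without
    subtraction so that both integrals may be treated as nonnegative. On the slice
    at level [t] the difference of the two sides is [(1 - cos (a S)) / a >= 0]. For
    [m (2 rho) <= t < m rho] the end point satisfies [rho <= S <= 2 rho], hence
    [a S <= 1] and the slice contributes at least [a rho ^ 2 / 4]. *)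
Lemma nonincreasing_sine_integral_ge (m : measurableTypeR R -> measurableTypeR R)
    (a rho : R) :
  measurable_fun setT m -> (forall r : R, 0 < r -> 0 <= m r)%R ->
  (forall r s : R, 0 < r -> r <= s -> s < 1 -> m s <= m r)%R ->
  (forall r : R, 1 < r -> m r = 0)%R ->
  (0 < a)%R -> (0 < rho)%R -> (2 * rho < 1)%R -> (2 * rho * a <= 1)%R ->
  \int[mu]_r (on_pos (fun r => m r * (a * r - sin (a * r)))%R r)%:E +
    ((m rho - m (2 * rho)) * (a * rho ^+ 2 / 4))%:E <=
  \int[mu]_r (on_pos (fun r => m r * (a * r))%R r)%:E.
Proof.
move=> mm m0 mdec m1 a0 rho0 rho1 rhoa.
pose g1 : measurableTypeR R -> measurableTypeR R := fun r => (a * r)%R.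
pose g2 : measurableTypeR R -> measurableTypeR R := fun r => (a * r - sin (a * r))%R.
have cg1 : continuous (g1 : R -> R).
  by move=> x; apply: cvgM; [exact: cvg_cst|exact: cvg_id].
have cg2 : continuous (g2 : R -> R).
  move=> x; apply: cvgB; first exact: cg1.
  apply: (@continuous_comp _ _ _ (g1 : R -> R) (@sin R)); first exact: cg1.
  exact: continuous_sin.
have mg1 : measurable_fun setT g1 by exact: continuous_measurable_fun.
have mg2 : measurable_fun setT g2 by exact: continuous_measurable_fun.
have g10 r : (0 < r)%R -> (0 <= g1 r)%R by move=> r0; rewrite mulr_ge0// ltW.
have g20 r : (0 < r)%R -> (0 <= g2 r)%R by move=> r0; apply: sin_le_id; exact: g10.
rewrite (layer_cake mm mg1)// (layer_cake mm mg2)//.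
set low := (a * rho ^+ 2 / 4)%R.
have low0 : (0 <= low)%R by rewrite /low divr_ge0// mulr_ge0 ?sqr_ge0// ltW.
have m2 : (m (2 * rho) <= m rho)%R by apply: mdec => //; lra.
pose c (t : R) : R := (if (m (2 * rho)%R <= t) && (t < m rho) then low else 0)%R.
have -> : ((m rho - m (2 * rho)%R) * low)%:E = \int[mu]_t (c t)%:E.
  transitivity (\int[mu]_(t in `[m (2 * rho)%R, m rho[) cst low%:E t).
    rewrite integral_cst//= lebesgue_measure_itv/= lte_fin.
    case: ifPn => [_|]; first by rewrite -EFinB -EFinM mulrC.
    rewrite -leNgt => mr; rewrite mule0 (_ : m rho = m (2 * rho)%R) ?subrr ?mul0r//.
    by apply/eqP; rewrite eq_le mr m2.
  rewrite integral_mkcond; apply: eq_integral => t _.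
  by rewrite patchE mem_setE in_itv/= /c; case: ifP.
have mI (g : measurableTypeR R -> measurableTypeR R) : measurable_fun setT g ->
    (forall r : R, 0 < r -> 0 <= g r)%R ->
    measurable_fun setT (fun t : measurableTypeR R => \int[mu]_r (superlevel m g t r)%:E).
  move=> mg g0.
  apply: (measurable_fun_fubini_tonelli_F (m2 := mu) (fun p => (superlevel m g p.1 p.2)%:E)).
    by apply/measurable_EFinP; exact: measurable_superlevel.
  move=> p; rewrite lee_fin /superlevel; case: ifP => // /and3P[+ _ _]; exact: g0.
have I0 (g : R -> R) t : (forall r : R, 0 < r -> 0 <= g r)%R -> 0 <= \int[mu]_r (superlevel m g t r)%:E.
  move=> g0; apply: integral_ge0 => r _.
  rewrite lee_fin /superlevel; case: ifP => // /and3P[+ _ _]; exact: g0.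
have mc : measurable_fun setT (fun t : measurableTypeR R => (c t)%:E).
  apply/measurable_EFinP; apply: measurable_fun_ifT => //.
  apply: measurable_and; first exact: measurable_fun_ler.
  exact: measurable_fun_ltr.
have c0 t : 0 <= (c t)%:E by rewrite lee_fin /c; case: ifP.
rewrite -ge0_integralD//; [|by move=> t _; exact: I0|exact: mI].
apply: ge0_le_integral => //.
- by move=> t _; rewrite adde_ge0// I0.
- by apply: emeasurable_funD => //; exact: mI.
- exact: mI.
move=> t _; have [t0|t0] := leP 0%R t; last first.
  have sl0 (g : R -> R) : \int[mu]_r (superlevel m g t r)%:E = 0.
    by apply: integral0_eq => r _; rewrite /superlevel leNgt t0/= andbF.
  rewrite !sl0 add0e /c; case: ifP => // /andP[mt _].
  by move: t0; rewrite ltNge (le_trans _ mt)// m0// mulr_gt0.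
have [S [S0 AS SA IS]] := superlevel_itv mm mdec m1 t0.
have D1 (x : R) : is_derive x (1 : R)%R (fun x : R => a * x ^+ 2 / 2)%R (a * x : R)%R.
  by apply: is_derive_eq; rewrite /GRing.scale/=; field.
have D2 (x : R) : is_derive x (1 : R)%R (fun x : R => a * x ^+ 2 / 2 + cos (a * x) / a)%R
  (a * x - sin (a * x) : R)%R.
  by apply: is_derive_eq; rewrite /GRing.scale/=; field; rewrite gt_eqF.
rewrite !IS// (integral_derive_itv S0 cg1 D1) (integral_derive_itv S0 cg2 D2).
rewrite -EFinD lee_fin mulr0 cos0 expr0n/= !mulr0 !mul0r add0r subr0.
rewrite -subr_ge0 (_ : _ - _ = (1 - cos (a * S)) / a - c t)%R; last by field; rewrite gt_eqF.
rewrite subr_ge0 /c; case: ifP => [/andP[mt tm]|_]; last first.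
  by rewrite divr_ge0 ?(ltW a0)// subr_ge0 cos_le1.
have rS : (rho <= S)%R by apply: AS => //; rewrite rho0/=; lra.
have Sr : (S <= 2 * rho)%R by apply: SA => //; rewrite mulr_gt0.
have aS : (`|a * S| <= 1)%R.
  rewrite ger0_norm; last by rewrite mulr_ge0// ltW.
  by apply: le_trans rhoa; rewrite mulrC ler_wpM2r// ltW.
rewrite ler_pdivlMr//; apply: le_trans (cos_le_quadratic aS).
rewrite /low (_ : _ * a = (a * rho) ^+ 2 / 4)%R; last by field.
rewrite ler_wpM2r// lerXn2r ?nnegrE// ?mulr_ge0 ?(ltW a0) ?(ltW rho0)//.
by rewrite ler_wpM2l// ltW.
Qed.

End layer_cake.

(** * Integrals of radial functions *)

Section radial_integrals.
Context {R : realType}.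
Local Open Scope ereal_scope.
Local Notation mu := (@lebesgue_measure R).
Local Notation leb n := (lebesgueRn R n).
Local Notation RR := (measurableTypeR R).

Definition dotRn n (e z : Rn R n) : R := (\sum_(i < n) tnth e i * tnth z i)%R.

Lemma measurable_dotRn n (e : Rn R n) : measurable_fun setT (dotRn e : Rn R n -> RR).
Proof.
apply: (@measurable_sum _ _ _ _ _ _ (fun i (z : Rn R n) => tnth e i * tnth z i)%R) => i.
by apply: measurable_funM => //; exact: measurable_tnth.
Qed.

Lemma measurable_enorm_comp n (u : Rn R n -> RR) (H : RR * RR -> \bar R) :
  measurable_fun setT u -> measurable_fun setT H ->
  measurable_fun setT (fun z : Rn R n => H (enorm z, u z)).
Proof.
move=> mu_ mH; apply: (measurableT_comp (f := H)) => //.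
by apply: measurable_fun_pair => //; exact: measurable_enorm.
Qed.

(** Change of variables by the rotation that carries the first axis to [e]. *)
Lemma integral_dot_rotation n (e : Rn R n.+1) (H : RR * RR -> \bar R) :
  enorm e = 1%R -> measurable_fun setT H ->
  \int[leb n.+1]_z H (enorm z, dotRn e z) = \int[leb n.+1]_z H (enorm z, tnth z ord0).
Proof.
move=> e1 mH; have [T [L [pT isoT _ dotT]]] := exists_rotation e1.
rewrite -[LHS](preserves_integral (T := T))//; last first.
  by apply: measurable_enorm_comp => //; exact: measurable_dotRn.
by apply: eq_integral => z _; rewrite isoT /dotRn dotT.
Qed.

Definition basisRn n (j : 'I_n) : Rn R n := [tuple (i == j)%:R | i < n].

Lemma dot_basisRn n (j : 'I_n) z : dotRn (basisRn j) z = tnth z j.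
Proof.
rewrite /dotRn (bigD1 j)//= tnth_mktuple eqxx mul1r big1 ?addr0// => i /negPf ij.
by rewrite tnth_mktuple ij mul0r.
Qed.

Lemma enorm_basisRn n (j : 'I_n) : enorm (basisRn j) = 1%R.
Proof.
apply/eqP; rewrite -(@eqrXn2 _ 2%N) ?enorm_ge0// sqr_enorm expr1n (bigD1 j)//=.
rewrite tnth_mktuple eqxx expr1n big1 ?addr0// => i /negPf ij.
by rewrite tnth_mktuple ij expr0n.
Qed.

(** All coordinates have the same second moment under a radial weight, and
    they add up to the moment of [|z| ^ 2]. *)
Lemma second_moment n (w : RR -> RR) : measurable_fun setT w -> (forall r, 0 <= w r)%R ->
  n.+1%:R%:E * \int[leb n.+1]_z (w (enorm z) * tnth z ord0 ^+ 2)%:E =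
  \int[leb n.+1]_z (w (enorm z) * enorm z ^+ 2)%:E.
Proof.
move=> mw w0.
have mH : measurable_fun setT (fun p : RR * RR => (w p.1 * p.2 ^+ 2)%:E).
  apply/measurable_EFinP; apply: measurable_funM.
    by apply: measurableT_comp => //; exact: measurable_fst.
  by apply: measurable_funX; exact: measurable_snd.
have mj (j : 'I_n.+1) : measurable_fun setT
    (fun z : Rn R n.+1 => (w (enorm z) * tnth z j ^+ 2)%:E).
  apply: (measurable_enorm_comp (u := fun z => tnth z j) (H := fun p => (w p.1 * p.2 ^+ 2)%:E)) => //.
  exact: measurable_tnth.
transitivity (\sum_(j < n.+1) \int[leb n.+1]_z (w (enorm z) * tnth z j ^+ 2)%:E); last first.
  rewrite -ge0_integral_sum//; last by move=> j z _; rewrite lee_fin mulr_ge0 ?sqr_ge0.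
  by apply: eq_integral => z _; rewrite sumEFin sqr_enorm mulr_sumr.
rewrite (eq_bigr (fun=> \int[leb n.+1]_z (w (enorm z) * tnth z ord0 ^+ 2)%:E)); last first.
  move=> j _; rewrite -[RHS](integral_dot_rotation (enorm_basisRn j) mH).
  by apply: eq_integral => z _; rewrite dot_basisRn.
rewrite (eq_bigr (fun=> 1%:E * \int[leb n.+1]_z (w (enorm z) * tnth z ord0 ^+ 2)%:E)).
  rewrite -ge0_sume_distrl; last by move=> i _; rewrite lee_fin.
  by rewrite sumEFin sumr_const card_ord.
by move=> i _; rewrite mul1e.
Qed.

(** Cosine of the angle between [w] and the first axis. *)
Definition cosangle n (w : Rn R n.+1) : R := (tnth w ord0 / enorm w)%R.

Lemma measurable_cosangle n : measurable_fun setT (@cosangle n : Rn R n.+1 -> RR).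
Proof.
apply: measurable_funM; first exact: measurable_tnth.
by apply: (measurableT_comp measurable_invr); exact: measurable_enorm.
Qed.

(** Polar coordinates for functions of [|z|] and [z_0], which are functions of
    the radius and the angle only. *)
Lemma integral_polar_radial n (h : RR * RR -> R) :
  measurable_fun setT (h : RR * RR -> RR) -> (forall p, 0 <= h p)%R ->
  (forall y, h (0, y) = 0)%R ->
  \int[leb n.+1]_z (h (enorm z, tnth z ord0))%:E =
  \int[leb n.+1]_w ((annulus_weight w)%:E *
    \int[mu]_r (on_pos (fun r => r ^+ n * h (r, r * cosangle w))%R r)%:E).
Proof.
move=> mh h0 hz; pose F (z : Rn R n.+1) : \bar R := (h (enorm z, tnth z ord0))%:E.
have mF : measurable_fun setT F.
  apply: (measurable_enorm_comp (u := fun z => tnth z ord0) (H := fun p => (h p)%:E)).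
    exact: measurable_tnth.
  exact/measurable_EFinP.
have F0 z : 0 <= F z by rewrite lee_fin.
have Fz z : enorm z = 0%R -> F z = 0 by rewrite /F => ->; rewrite hz.
rewrite (ge0_integral_polar mF F0 Fz).
apply: eq_integral => w _; rewrite /annulus_weight.
case: ifP => [/andP[w2 _]|_]; last by rewrite !mul0e.
have wp : (0 < enorm w)%R by apply: lt_le_trans w2; rewrite invr_gt0.
congr (_ * _); apply: eq_integral => r _; rewrite /radial_integrand /on_pos.
case: ifPn => // r0; rewrite -EFinM enorm_scaleRn ?tnth_scaleRn; last first.
  by rewrite divr_ge0// ltW.
by rewrite divfK ?gt_eqF// mulrAC -mulrA.
Qed.

Lemma measurable_cosangle_integrand n (h : RR * RR -> R) :
  measurable_fun setT (h : RR * RR -> RR) ->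
  measurable_fun setT (fun p : Rn R n.+1 * RR =>
    (on_pos (fun r => r ^+ n * h (r, r * cosangle p.1))%R p.2)%:E).
Proof.
move=> mh; apply/measurable_EFinP; apply: measurable_fun_ifT => //.
  by apply: measurable_fun_ltr => //; exact: measurable_snd.
apply: measurable_funM; first by apply: measurable_funX; exact: measurable_snd.
apply: measurableT_comp => //; apply: measurable_fun_pair; first exact: measurable_snd.
apply: measurable_funM; first exact: measurable_snd.
by apply: measurableT_comp; [exact: measurable_cosangle|exact: measurable_fst].
Qed.

(** A set of positive measure that serves twice: as a part of the annulus where
    [cosangle] stays away from zero, and, one dimension lower, as a set of tails
    over which the first coordinate may range freely without leaving the
    annulus. *)
Definition box n (z : Rn R n.+1) : bool :=
  ([&& 2^-1 <= (unconsRn z).1, (unconsRn z).1 <= 5 / 8 & enorm (unconsRn z).2 <= 8^-1])%R.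

Lemma box_enorm n (z : Rn R n.+1) : box z ->
  (2^-1 <= enorm z <= 3 / 4)%R /\ (2^-1 <= tnth z ord0)%R.
Proof.
rewrite /box -{4 5 6}(unconsRnK z); case: (unconsRn z) => x t /= /and3P[x1 x2 t1].
have H : (enorm (consRn (x, t)) ^+ 2 = x ^+ 2 + enorm t ^+ 2)%R by rewrite sqr_enorm_cons.
have := enorm_ge0 (consRn (x, t)%R); have := enorm_ge0 t => t0.
rewrite tnth_consRn0/=; set y := enorm (consRn _)%R in H *; move=> y0.
by move: H; rewrite !expr2 => H; split=> //; apply/andP; split; nra.
Qed.

Lemma measurable_box n : measurable_fun setT (@box n).
Proof.
have m1 : measurable_fun setT (fun z : Rn R n.+1 => (unconsRn z).1).
  by apply: (measurableT_comp (f := fst)) => //; exact: measurable_unconsRn.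
have m2 : measurable_fun setT (fun z : Rn R n.+1 => enorm (unconsRn z).2).
  apply: measurableT_comp; first exact: measurable_enorm.
  by apply: (measurableT_comp (f := snd)) => //; exact: measurable_unconsRn.
apply: measurable_and; first exact: measurable_fun_ler.
by apply: measurable_and; exact: measurable_fun_ler.
Qed.

Definition indic_of T (P : T -> bool) (z : T) : R := (if P z then 1 else 0)%R.

Lemma indic_of_ge0 T (P : T -> bool) z : (0 <= indic_of P z)%R.
Proof. by rewrite /indic_of; case: ifP. Qed.

Lemma measurable_indic_of d (T : measurableType d) (P : T -> bool) :
  measurable_fun setT P -> measurable_fun setT (indic_of P : T -> RR).
Proof. by move=> mP; apply: measurable_fun_ifT. Qed.

Lemma measurable_indic_ofE d (T : measurableType d) (Q : T -> bool) :
  measurable_fun setT Q -> measurable_fun setT (fun z => (indic_of Q z)%:E).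
Proof. by move=> mQ; apply/measurable_EFinP; exact: measurable_indic_of. Qed.

(** Fubini for a set that contains the product of an interval and a set of
    tails. *)
Lemma integral_slab n (a b : R) (g : Rn R n -> bool) (P : Rn R n.+1 -> bool) :
  (a < b)%R -> measurable_fun setT g -> measurable_fun setT P ->
  (forall x t, (a <= x <= b)%R -> g t -> P (consRn (x, t))) ->
  (b - a)%:E * \int[leb n]_t (indic_of g t)%:E <= \int[leb n.+1]_z (indic_of P z)%:E.
Proof.
move=> ab mg mP gP.
have mPc : measurable_fun setT (fun p : RR * Rn R n => P (consRn p)).
  by apply: measurableT_comp => //; exact: measurable_consRn.
rewrite [leRHS]ge0_integral_consRn//; [|exact: measurable_indic_ofE
  |by move=> z; rewrite lee_fin indic_of_ge0].
set I := \int[leb n]_t _.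
have I0 : 0 <= I by apply: integral_ge0 => t _; rewrite lee_fin indic_of_ge0.
have -> : (b - a)%:E * I = \int[mu]_x (if (a <= x <= b)%R then I else 0).
  transitivity (\int[mu]_(x in [set` `[a, b]%R]) cst I x).
    by rewrite integral_cst//= lebesgue_measure_itv/= lte_fin ab -EFinB muleC.
  rewrite integral_mkcond; apply: eq_integral => x _.
  by rewrite patchE mem_setE in_itv.
apply: ge0_le_integral => //.
- by move=> x _; case: ifP.
- apply: measurable_fun_ifT => //.
  by apply: measurable_and; exact: measurable_fun_ler.
- by apply: (measurable_fun_fubini_tonelli_F (m2 := leb n)
    (fun p => (indic_of P (consRn p))%:E)) => [|p];
    [exact: measurable_indic_ofE|rewrite lee_fin indic_of_ge0].
- move=> x _; have J0 : 0 <= \int[leb n]_t (indic_of P (consRn (x, t)))%:E.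
    by apply: integral_ge0 => t _; rewrite lee_fin indic_of_ge0.
  case: ifPn => // xab; apply: ge0_le_integral => //.
  + by move=> t _; rewrite lee_fin indic_of_ge0.
  + exact: measurable_indic_ofE.
  + by apply: (measurable_indic_ofE (Q := fun t => P (consRn (x, t))));
    apply: measurableT_comp => //; exact: measurable_consRnP.
  + move=> t _; rewrite lee_fin /indic_of; case: ifP => [gt|_]; last by case: ifP.
    by rewrite gP.
Qed.

Lemma measurable_in_ball n (eps : R) :
  measurable_fun setT (fun z : Rn R n => enorm z <= eps)%R.
Proof. by apply: measurable_fun_ler => //; exact: measurable_enorm. Qed.

Lemma integral_ball_gt0 n (eps : R) : (0 < eps)%R ->
  0 < \int[leb n]_z (indic_of (fun z : Rn R n => enorm z <= eps)%R z)%:E.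
Proof.
elim: n eps => [|n IH] eps e0.
  rewrite /= integral_dirac//=; last first.
    by apply/measurable_EFinP; apply: measurable_indic_of; exact: measurable_in_ball.
  rewrite diracT mul1e lte_fin /indic_of ifT// /enorm big_ord0 sqrtr0; exact: ltW.
have e2 : (0 < eps / 2)%R by rewrite divr_gt0.
apply: (@lt_le_trans _ _ ((eps / 2 - 0)%:E *
   \int[leb n]_z (indic_of (fun z : Rn R n => enorm z <= eps / 2)%R z)%:E)).
  by rewrite mule_gt0// ?lte_fin ?subr0//; exact: IH.
apply: integral_slab => //; [exact: measurable_in_ball|exact: measurable_in_ball|].
move=> x t /andP[x0 xe] te.
rewrite -ler_sqr ?nnegrE ?enorm_ge0 ?(ltW e0)// sqr_enorm_cons/= !expr2.
have := enorm_ge0 t; nra.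
Qed.

Lemma integral_box_gt0 n : 0 < \int[leb n.+1]_z (indic_of (@box n) z)%:E.
Proof.
apply: (@lt_le_trans _ _ ((5 / 8 - 2^-1)%:E *
   \int[leb n]_z (indic_of (fun z : Rn R n => enorm z <= 8^-1)%R z)%:E)).
  by rewrite mule_gt0// ?lte_fin; [lra|apply: integral_ball_gt0; rewrite invr_gt0].
apply: integral_slab => //.
- by lra.
- exact: measurable_in_ball.
- exact: measurable_box.
- by move=> x t /andP[x0 xe] te; rewrite /box consRnK/= x0 xe te.
Qed.

End radial_integrals.

(** * Averages of 1 - cos over directions *)

Section laplacian_symbol.
Context {R : realType}.
Local Open Scope ereal_scope.
Local Notation mu := (@lebesgue_measure R).
Local Notation leb n := (lebesgueRn R n).
Local Notation RR := (measurableTypeR R).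

(** Lets a positive integral serve as a constant, finite or not. *)
Lemma gt0_ereal_lower_bound (x : \bar R) : 0 < x -> exists2 v : R, (0 < v)%R & v%:E <= x.
Proof.
case: x => [r|_|//]; first by rewrite lte_fin => r0; exists r.
by exists 1%R; rewrite ?leey.
Qed.

Lemma measurable_radial2 (w : RR -> RR) (g : RR -> RR) :
  measurable_fun setT w -> measurable_fun setT g ->
  measurable_fun setT (fun p : RR * RR => w p.1 * g p.2 : RR)%R.
Proof.
move=> mw mg; apply: measurable_funM.
  by apply: measurableT_comp => //; exact: measurable_fst.
by apply: measurableT_comp => //; exact: measurable_snd.
Qed.

Lemma measurable_radial2_Rn n (w : RR -> RR) (g : RR -> RR) :
  measurable_fun setT w -> measurable_fun setT g ->
  measurable_fun setT (fun z : Rn R n.+1 => (w (enorm z) * g (tnth z ord0))%:E).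
Proof.
move=> mw mg.
apply: (measurable_enorm_comp (u := fun z => tnth z ord0)
  (H := fun p => (w p.1 * g p.2)%:E)); first exact: measurable_tnth.
by apply/measurable_EFinP; exact: measurable_radial2.
Qed.

Lemma measurable_1cos (k : R) : measurable_fun setT (fun y : RR => 1 - cos (k * y) : RR)%R.
Proof.
apply: measurable_funB => //; apply: continuous_measurable_fun => x.
apply: (@continuous_comp _ _ _ (fun y : R => k * y)%R (@cos R)); last exact: continuous_cos.
by apply: cvgM; [exact: cvg_cst|exact: cvg_id].
Qed.

Lemma measurable_sub_sin (k : R) :
  measurable_fun setT (fun y : RR => y * (k * y - sin (k * y)) : RR)%R.
Proof.
apply: measurable_funM => //; apply: measurable_funB; first exact: measurable_funM.
apply: continuous_measurable_fun => x.
apply: (@continuous_comp _ _ _ (fun y : R => k * y)%R (@sin R)); last exact: continuous_sin.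
by apply: cvgM; [exact: cvg_cst|exact: cvg_id].
Qed.

Lemma le_integral_radial n (w g1 g2 : RR -> RR) :
  measurable_fun setT w -> measurable_fun setT g1 -> measurable_fun setT g2 ->
  (forall r, 0 <= w r)%R -> (forall r, 1 < r -> w r = 0)%R ->
  (forall y, 0 <= g1 y)%R -> (forall y, `|y| <= 1 -> g1 y <= g2 y)%R ->
  (forall y, 0 <= g2 y)%R ->
  \int[leb n.+1]_z (w (enorm z) * g1 (tnth z ord0))%:E <=
  \int[leb n.+1]_z (w (enorm z) * g2 (tnth z ord0))%:E.
Proof.
move=> mw mg1 mg2 w0 w1 g10 g12 g20; apply: ge0_le_integral => //.
- by move=> z _; rewrite lee_fin mulr_ge0.
- exact: measurable_radial2_Rn.
- exact: measurable_radial2_Rn.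
- move=> z _; rewrite lee_fin; have [z1|z1] := leP (enorm z) 1%R.
    by rewrite ler_wpM2l// g12// (le_trans (ler_tnth_enorm _ _)).
  by rewrite w1// !mul0r.
Qed.

Lemma integral_radialZ n (w g : RR -> RR) (a : R) :
  measurable_fun setT w -> measurable_fun setT g ->
  (forall r, 0 <= w r)%R -> (forall y, 0 <= g y)%R -> (0 <= a)%R ->
  \int[leb n.+1]_z (w (enorm z) * (a * g (tnth z ord0)))%:E =
  a%:E * \int[leb n.+1]_z (w (enorm z) * g (tnth z ord0))%:E.
Proof.
move=> mw mg w0 g0 a0; rewrite -ge0_integralZl_EFin//.
- by apply: eq_integral => z _; rewrite -EFinM mulrCA.
- by move=> z _; rewrite lee_fin mulr_ge0.
- exact: measurable_radial2_Rn.
Qed.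

Lemma integral_radialD n (w g1 g2 : RR -> RR) :
  measurable_fun setT w -> measurable_fun setT g1 -> measurable_fun setT g2 ->
  (forall r, 0 <= w r)%R -> (forall y, 0 <= g1 y)%R -> (forall y, 0 <= g2 y)%R ->
  \int[leb n.+1]_z (w (enorm z) * (g1 (tnth z ord0) + g2 (tnth z ord0)))%:E =
  \int[leb n.+1]_z (w (enorm z) * g1 (tnth z ord0))%:E +
  \int[leb n.+1]_z (w (enorm z) * g2 (tnth z ord0))%:E.
Proof.
move=> mw mg1 mg2 w0 g10 g20; rewrite -ge0_integralD//.
- by apply: eq_integral => z _; rewrite -EFinD mulrDr.
- by move=> z _; rewrite lee_fin mulr_ge0.
- exact: measurable_radial2_Rn.
- by move=> z _; rewrite lee_fin mulr_ge0.
- exact: measurable_radial2_Rn.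
Qed.

(** Average of [1 - cos (t cos theta)] over the sphere, up to the total mass
    of the smeared surface measure. *)
Definition direction_average n (t : R) : \bar R :=
  \int[leb n.+2]_w (annulus_weight w * (1 - cos (t * cosangle w)))%:E.

Lemma annulus_weight_ge1 n (w : Rn R n.+1) : (2^-1 <= enorm w)%R -> (enorm w <= 1)%R ->
  (1 <= annulus_weight w)%R.
Proof.
move=> w2 w1; rewrite /annulus_weight w2 w1/= invf_ge1 ?exprn_gt0//.
  exact: exprn_ile1 (enorm_ge0 _) w1.
all: by apply: lt_le_trans w2; rewrite invr_gt0.
Qed.

(** The cosine [g] of the angle along a line at distance [q] from the axis has
    slope at most [2], so [1 - cos (t g)] dominates half the derivative of
    [g - sin (t g) / t]. This avoids changing variables to the angle. *)
Lemma cos_slope_integral_ge (t q : R) : (0 < t)%R -> (2^-1 <= q <= 3 / 4)%R ->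
  (Num.min 1 (t ^+ 2) / 15 / 16)%:E <=
  \int[mu]_(x in `]0%R, 2^-1%R[) (1 - cos (t * (x / Num.sqrt (x ^+ 2 + q ^+ 2))))%:E.
Proof.
move=> t0 /andP[q1 q2].
pose g (x : R) : R := (x / Num.sqrt (x ^+ 2 + q ^+ 2))%R.
pose s (x : R) : R := Num.sqrt (x ^+ 2 + q ^+ 2).
have xq (x : R) : (0 < x ^+ 2 + q ^+ 2)%R.
  by rewrite ltr_wpDl ?sqr_ge0// exprn_gt0//; lra.
have s0 (x : R) : (0 < s x)%R by rewrite sqrtr_gt0.
have s2 (x : R) : (s x ^+ 2 = x ^+ 2 + q ^+ 2)%R by rewrite sqr_sqrtr// ltW.
have Ds (x : R) : is_derive x (1 : R)%R s (x / s x)%R.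
  have := xq x => H.
  have Dp : is_derive x (1:R)%R (fun x : R => x ^+ 2 + q ^+ 2)%R (2 * x)%R.
    by apply: is_derive_eq; rewrite /GRing.scale/=; ring.
  have := is_derive1_comp (f := @Num.sqrt R) (g := fun x : R => (x ^+ 2 + q ^+ 2)%R) (x := x)
    (is_derive1_sqrt H) Dp.
  by move=> h; apply: is_derive_eq; rewrite -/(s x); field; rewrite gt_eqF.
have Dg (x : R) : is_derive x (1 : R)%R g (q ^+ 2 / s x ^+ 3)%R.
  have sx : s x != 0%R by rewrite gt_eqF.
  have Dv := is_deriveV sx (Ds x).
  apply: is_derive_eq; rewrite /GRing.scale/=. 
  rewrite -/(s x); have -> : (q ^+ 2 = s x ^+ 2 - x ^+ 2)%R by rewrite s2; ring.
  by field.
(* [f] is the derivative of [G], and [2^-1 * f] bounds the integrand below. *)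
pose G (x : R) : R := (g x - sin (t * g x) / t)%R.
pose f (x : R) : R := ((1 - cos (t * g x)) * (q ^+ 2 / s x ^+ 3))%R.
have DG (x : R) : is_derive x (1 : R)%R G (f x).
  have Dgx := Dg x.
  by apply: is_derive_eq; rewrite /GRing.scale/= /f; field; rewrite !gt_eqF.
have cont (h h' : R -> R) : (forall x : R, is_derive x (1 : R)%R h (h' x)) -> continuous h.
  move=> Dh x; apply: differentiable_continuous; apply/derivable1_diffP.
  exact: ex_derive.
have cg := cont _ _ Dg; have cs := cont _ _ Ds.
have ccos : continuous (fun x : R => 1 - cos (t * g x) : R)%R.
  move=> x; apply: cvgB; first exact: cvg_cst.
  apply: (@continuous_comp _ _ _ (fun y : R => t * g y)%R (@cos R)); last exact: continuous_cos.
  by apply: cvgM; [exact: cvg_cst|exact: cg].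
have cf : continuous f.
  move=> x; apply: cvgM; first exact: ccos.
  apply: cvgM; first exact: cvg_cst.
  apply: cvgV; first by rewrite gt_eqF// exprn_gt0.
  apply: (@continuous_comp _ _ _ s (fun y : R => y ^+ 3)%R); first exact: cs.
  exact: exprn_continuous.
have f0 (x : R) : (0 <= f x)%R.
  by rewrite mulr_ge0 ?subr_ge0 ?cos_le1// divr_ge0 ?sqr_ge0// exprn_ge0// ltW.
have fle (x : R) : (2^-1 * f x <= 1 - cos (t * g x))%R.
  have qs : (q <= s x)%R.
    rewrite -ler_sqr ?nnegrE ?(ltW (s0 x))//; last by lra.
    by rewrite s2 lerDr sqr_ge0.
  have h : (q ^+ 2 / s x ^+ 3 <= 2)%R.
    rewrite ler_pdivrMr ?exprn_gt0// exprS.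
    have := sqr_ge0 q; have : (q ^+ 2 <= s x ^+ 2)%R.
      by rewrite ler_sqr ?nnegrE ?(ltW (s0 x))//; lra.
    by set a := (q ^+ 2)%R; set b := (s x ^+ 2)%R; nra.
  have : (0 <= 1 - cos (t * g x))%R by rewrite subr_ge0 cos_le1.
  rewrite /f; set a := (1 - _)%R; set b := (_ / _)%R in h *; nra.
have mono : (2^-1)%:E * \int[mu]_(x in `]0%R, 2^-1%R[) (f x)%:E <=
   \int[mu]_(x in `]0%R, 2^-1%R[) (1 - cos (t * g x))%:E.
  have mT (h : R -> R) : continuous h -> measurable_fun (`]0%R, 2^-1%R[ : set R) (EFin \o h).
    move=> ch; apply/measurable_EFinP; apply: measurable_funTS.
    exact: continuous_measurable_fun.
  rewrite -ge0_integralZl_EFin//; last 2 first.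
  - by move=> x _; rewrite lee_fin.
  - exact: mT.
  apply: ge0_le_integral => //.
  - by move=> x _; rewrite -EFinM lee_fin mulr_ge0.
  - by apply: (mT (fun x => 2^-1 * f x)%R) => x; apply: cvgM; [exact: cvg_cst|exact: cf].
  - exact: mT.
  - by move=> x _; rewrite -EFinM lee_fin fle.
apply: le_trans mono; rewrite (integral_derive_itv _ cf DG) ?invr_ge0// -EFinM lee_fin.
have g0 : g 0%R = 0%R by rewrite /g mul0r.
rewrite /G g0 mulr0 sin0 mul0r !subr0.
have s1 : (s 2^-1 <= 1)%R.
  rewrite -(ler_sqr (x := s _)) ?nnegrE ?(ltW (s0 _))// s2 expr1n !expr2; nra.
set y := (g 2^-1)%R.
have y2 : (2^-1 <= y)%R by rewrite /y/g ler_pdivlMr ?s0// -/(s _) ger_pMr// invr_gt0.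
have ty : (0 < t * y)%R by rewrite mulr_gt0//; lra.
have H := sub_sin_ge_min ty.
have m4 : (Num.min 1 (t ^+ 2) / 4 <= Num.min 1 ((t * y) ^+ 2))%R.
  rewrite le_min; apply/andP; split.
    have : (Num.min 1 (t ^+ 2) <= 1)%R by rewrite ge_min lexx.
    by lra.
  have : (Num.min 1 (t ^+ 2) <= t ^+ 2)%R by rewrite ge_min lexx orbT.
  have : (2^-1 * 2^-1 <= y * y)%R by nra.
  have := sqr_ge0 t; rewrite exprMn (expr2 y).
  by set a := (t ^+ 2)%R; set b := (y * y)%R; nra.
have mp : (0 <= Num.min 1 (t ^+ 2))%R by rewrite le_min ler01 sqr_ge0.
have -> : (y - sin (t * y) / t = (t * y - sin (t * y)) / t)%R by field; rewrite gt_eqF.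
apply: (@le_trans _ _ (2^-1 * (y * Num.min 1 ((t * y) ^+ 2) / 15))%R).
  by move: m4 mp; set a := (Num.min 1 (t ^+ 2))%R; set b := (Num.min _ _)%R; nra.
rewrite ler_wpM2l ?invr_ge0// ler_pdivlMr//; apply: le_trans H.
by rewrite le_eqVlt; apply/orP; left; apply/eqP; field.
Qed.

End laplacian_symbol.

(** * The symbol of the nonlocal Laplacian on the first axis *)

Section laplacian_symbol_bounds.
Context {R : realType}.
Local Open Scope ereal_scope.
Local Notation mu := (@lebesgue_measure R).
Local Notation leb n := (lebesgueRn R n).
Local Notation RR := (measurableTypeR R).

Lemma enorm_consRn n (p : RR * Rn R n) :
  enorm (consRn p) = Num.sqrt (p.1 ^+ 2 + enorm p.2 ^+ 2).
Proof. by rewrite -sqr_enorm_cons sqrtr_sqr ger0_norm// enorm_ge0. Qed.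

Lemma measurable_direction n (t : R) : measurable_fun setT
  (fun w : Rn R n.+2 => (annulus_weight w * (1 - cos (t * cosangle w)))%:E).
Proof.
apply/measurable_EFinP; apply: measurable_funM; first exact: measurable_annulus_weight.
exact: (measurableT_comp (measurable_1cos t) (@measurable_cosangle R n.+1)).
Qed.

(** Restrict to lines parallel to the axis whose tail lies in [box], where
    [annulus_weight >= 1], and bound the integral along each of them. *)
Lemma direction_average_ge n : exists2 c : R, (0 < c)%R &
  forall t, (0 < t)%R -> (c * Num.min 1 (t ^+ 2))%:E <= direction_average n t.
Proof.
have [v v0 vbox] := gt0_ereal_lower_bound (@integral_box_gt0 R n).
exists (v / 15 / 16)%R => [|t t0]; first by rewrite !divr_gt0.
have mp : (0 <= Num.min 1 (t ^+ 2) / 15 / 16)%R.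
  by rewrite !divr_ge0// le_min ler01 sqr_ge0.
have pos (w : Rn R n.+2) : (0 <= annulus_weight w * (1 - cos (t * cosangle w)))%R.
  by rewrite mulr_ge0 ?annulus_weight_ge0// subr_ge0 cos_le1.
rewrite /direction_average ge0_integral_consRn2//; last exact: measurable_direction.
have mbox : measurable_fun setT (fun w : Rn R n.+1 => (indic_of (R := R) (@box R n) w)%:E).
  exact: (measurable_indic_ofE (@measurable_box R n)).
apply: (@le_trans _ _ ((Num.min 1 (t ^+ 2) / 15 / 16)%:E *
    \int[leb n.+1]_w (indic_of (@box R n) w)%:E)).
  rewrite (_ : v / 15 / 16 * _ = Num.min 1 (t ^+ 2) / 15 / 16 * v)%R; last by field.
  by rewrite EFinM lee_wpmul2l.
rewrite -ge0_integralZl_EFin//; last by move=> w _; rewrite lee_fin indic_of_ge0.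
apply: ge0_le_integral => //.
- by move=> w _; rewrite -EFinM lee_fin mulr_ge0// indic_of_ge0.
- exact: emeasurable_funM.
- apply: (measurable_fun_fubini_tonelli_G (m1 := mu) (fun p : RR * Rn R n.+1 =>
   (annulus_weight (consRn p) * (1 - cos (t * cosangle (consRn p))))%:E)) => [|p].
    apply: (measurableT_comp (f := fun w : Rn R n.+2 =>
      (annulus_weight w * (1 - cos (t * cosangle w)))%:E)); first exact: measurable_direction.
    exact: measurable_consRn.
  by rewrite lee_fin.
move=> w _; rewrite /indic_of; case: ifPn => [wb|_]; last first.
  by rewrite mule0; apply: integral_ge0 => x _; rewrite lee_fin.
have [/andP[w1 w2] _] := box_enorm wb.
have wb' : (2^-1 <= enorm w <= 3 / 4)%R by rewrite w1.
rewrite mule1; apply: le_trans (cos_slope_integral_ge t0 wb') _.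
rewrite integral_mkcond; apply: ge0_le_integral => //.
- by move=> x _; rewrite patchE; case: ifP => // _; rewrite lee_fin subr_ge0 cos_le1.
- apply/(measurable_restrictT (fun x : RR => (1 - cos (t * (x / Num.sqrt (x ^+ 2 + enorm w ^+ 2))))%:E)) => //.
  apply: measurable_funTS; apply/measurable_EFinP.
  apply: (measurableT_comp (measurable_1cos t)).
  apply: measurable_funM => //; apply: (measurableT_comp measurable_invr).
  apply: (@measurableT_comp _ _ _ _ _ _ (Num.sqrt : RR -> RR)).
    by apply: continuous_measurable_fun => x; exact: sqrt_continuous.
  by apply: measurable_funD => //; exact: measurable_funX.
- apply: (measurableT_comp (f := fun w : Rn R n.+2 =>
      (annulus_weight w * (1 - cos (t * cosangle w)))%:E)); first exact: measurable_direction.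
  exact: measurable_consRnP.
move=> x _; rewrite patchE; case: ifPn => [|_]; last by rewrite lee_fin.
rewrite mem_setE in_itv/= => /andP[x0 x1].
rewrite lee_fin /cosangle tnth_consRn0 enorm_consRn/= ler_peMl ?subr_ge0 ?cos_le1//.
have := sqr_enorm_cons (x, w); have := enorm_ge0 (consRn (x, w)%R).
set y := enorm _ => y0 /=; rewrite !expr2 => yy.
by apply: annulus_weight_ge1; rewrite -/y; nra.
Qed.

Lemma min_sqr_mul (k r : R) : (0 <= r <= 1)%R -> (Num.min 1 (k ^+ 2) * r ^+ 2 <= Num.min 1 ((k * r) ^+ 2))%R.
Proof.
move=> /andP[r0 r1]; have r2 : (r ^+ 2 <= 1)%R by exact: exprn_ile1.
rewrite le_min exprMn ler_wpM2r ?sqr_ge0 ?ge_min ?lexx ?orbT// andbT.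
apply: mulr_ile1 => //; rewrite ?sqr_ge0//.
  by rewrite le_min ler01 sqr_ge0.
by rewrite ge_min lexx.
Qed.

(** In polar coordinates the integral is
    [int_0^1 r^(d-1) W(r) Phi(k r) dr] with [Phi] the direction average, and
    [Phi(k r) >= c min(1, k^2) r^2] since [r <= 1]. What is left is the radial
    moment [int r^(d+1) W(r) dr], which is positive because the moment on [R^d] is. *)
Lemma cos_integral_bounds n (W : RR -> RR) (M : R) :
  measurable_fun setT W -> (forall r, 0 <= W r)%R -> W 0%R = 0%R ->
  (forall r, 1 < r -> W r = 0)%R -> (0 < M)%R ->
  \int[leb n.+2]_z (W (enorm z) * enorm z ^+ 2)%:E = M%:E ->
  exists2 c : R, (0 < c)%R & forall k, (0 < k)%R ->
    (c * Num.min 1 (k ^+ 2))%:E <=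
    \int[leb n.+2]_z (W (enorm z) * (1 - cos (k * tnth z ord0)))%:E.
Proof.
move=> mW W0 W00 W1 M0 WM.
have [c c0 cD] := direction_average_ge n.
pose M2 := \int[mu]_r (on_pos (fun r => r ^+ n.+1 * (W r * r ^+ 2))%R r)%:E.
have M2ge0 : 0 <= M2.
  apply: integral_ge0 => r _; rewrite lee_fin /on_pos; case: ifP => // r0.
  by rewrite !mulr_ge0 ?exprn_ge0// ltW.
(* If the radial moment vanished, so would the moment on [R^d]. *)
have M2gt0 : 0 < M2.
  rewrite lt_neqAle M2ge0 andbT; apply/eqP => M20.
  move: WM; rewrite (@integral_polar_radial _ _ (fun p => W p.1 * p.1 ^+ 2)%R)//.
  - rewrite /= -/M2 -M20; under eq_integral do rewrite mule0.
    by rewrite integral0 => -[] /eqP; rewrite lt_eqF.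
  - apply: measurable_funM; last by apply: measurable_funX; exact: measurable_fst.
    by apply: measurableT_comp => //; exact: measurable_fst.
  - by move=> p; rewrite mulr_ge0 ?sqr_ge0.
  - by move=> y; rewrite W00 mul0r.
have [v v0 vM2] := gt0_ereal_lower_bound M2gt0.
exists (c * v)%R => [|k k0]; first exact: mulr_gt0.
have mm0 : (0 <= Num.min 1 (k ^+ 2))%R by rewrite le_min ler01 sqr_ge0.
pose h (p : RR * RR) : R := (W p.1 * (1 - cos (k * p.2)))%R.
have mh : measurable_fun setT (h : RR * RR -> RR).
  exact: (measurable_radial2 mW (measurable_1cos k)).
have h0 p : (0 <= h p)%R by rewrite mulr_ge0// subr_ge0 cos_le1.
rewrite (@integral_polar_radial _ _ h)//; last by move=> y; rewrite /h W00 mul0r.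
have mH := measurable_cosangle_integrand (n := n.+1) mh.
pose K (p : Rn R n.+2 * RR) : \bar R := (annulus_weight p.1)%:E *
  (on_pos (fun r => r ^+ n.+1 * h (r, r * cosangle p.1))%R p.2)%:E.
have on0 (w : Rn R n.+2) r : (0 <= on_pos (fun r => r ^+ n.+1 * h (r, r * cosangle w)) r)%R.
  by rewrite /on_pos; case: ifP => // r0; rewrite mulr_ge0// exprn_ge0// ltW.
have K0 p : 0 <= K p by rewrite /K -EFinM lee_fin mulr_ge0 ?annulus_weight_ge0.
have mK : measurable_fun setT K.
  apply: emeasurable_funM => //; apply/measurable_EFinP.
  by apply: measurableT_comp; [exact: measurable_annulus_weight|exact: measurable_fst].
have -> : \int[leb n.+2]_w ((annulus_weight w)%:E *
    \int[mu]_r (on_pos (fun r => r ^+ n.+1 * h (r, r * cosangle w))%R r)%:E) =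
    \int[leb n.+2]_w \int[mu]_r K (w, r).
  apply: eq_integral => w _; rewrite -ge0_integralZl_EFin ?annulus_weight_ge0//.
    by move=> r _; rewrite lee_fin.
  by apply: (measurableT_comp mH (g := fun r => (w, r))); exact: measurable_fun_pair.
rewrite (fubini_tonelli (m1 := leb n.+2) (m2 := mu) K)//.
apply: (@le_trans _ _ ((c * Num.min 1 (k ^+ 2))%:E * M2)).
  rewrite (_ : c * v * _ = c * Num.min 1 (k ^+ 2) * v)%R; last by ring.
  by rewrite EFinM lee_wpmul2l// lee_fin mulr_ge0// ltW.
rewrite /M2 -ge0_integralZl_EFin//; last 3 first.
- by move=> r _; rewrite lee_fin /on_pos; case: ifP => // r0; rewrite !mulr_ge0 ?exprn_ge0// ltW.
- apply/measurable_EFinP; apply: measurable_on_pos; apply: measurable_funM.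
    exact: measurable_funX.
  by apply: measurable_funM => //; exact: measurable_funX.
- by rewrite mulr_ge0// ltW.
apply: ge0_le_integral => //.
- move=> r _; rewrite -EFinM lee_fin mulr_ge0//; first by rewrite mulr_ge0// ltW.
  by rewrite /on_pos; case: ifP => // r0; rewrite !mulr_ge0 ?exprn_ge0// ltW.
- apply: emeasurable_funM => //.
  apply/measurable_EFinP; apply: measurable_on_pos; apply: measurable_funM.
    exact: measurable_funX.
  by apply: measurable_funM => //; exact: measurable_funX.
- exact: (measurable_fun_fubini_tonelli_G (m1 := leb n.+2) K).
move=> r _; rewrite /K /on_pos/=; case: ifPn => r0; last first.
  by rewrite mule0; apply: integral_ge0 => w _; rewrite mule0.
have [r1|r1] := leP r 1%R; last first.
  rewrite W1// !(mul0r, mulr0) mule0; apply: integral_ge0 => w _.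
  by rewrite /h W1// mul0r mulr0 mule0.
rewrite (_ : (fun w : Rn R n.+2 => _) = (fun w => (r ^+ n.+1 * W r)%:E *
    (annulus_weight w * (1 - cos (k * r * cosangle w)))%:E)); last first.
  apply/funext => w; rewrite /h/= -!EFinM; congr EFin; rewrite -(mulrA k).
  by set C := (1 - _)%R; rewrite [LHS]mulrCA !mulrA (mulrAC _ (annulus_weight w)).
have rW : (0 <= r ^+ n.+1 * W r)%R by rewrite mulr_ge0// exprn_ge0// ltW.
rewrite ge0_integralZl_EFin//; last 2 first.
- by move=> w _; rewrite lee_fin mulr_ge0 ?annulus_weight_ge0// subr_ge0 cos_le1.
- exact: measurable_direction.
have kr : (0 < k * r)%R by rewrite mulr_gt0.
apply: (@le_trans _ _ ((r ^+ n.+1 * W r)%:E * (c * Num.min 1 ((k * r) ^+ 2))%:E)); last first.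
  by rewrite lee_wpmul2l// cD.
rewrite -!EFinM lee_fin.
have -> : (c * Num.min 1 (k ^+ 2) * (r ^+ n.+1 * (W r * r ^+ 2)) =
    r ^+ n.+1 * W r * (c * (Num.min 1 (k ^+ 2) * r ^+ 2)))%R.
  by set a := (r ^+ n.+1)%R; set b := Num.min _ _; ring.
rewrite ler_wpM2l// ler_wpM2l ?(ltW c0)// min_sqr_mul// (ltW r0)//.
Qed.

Lemma cancel_natmul_ereal n (x y : \bar R) (a : R) :
  n.+1%:R%:E * x = y -> y = (a * n.+1%:R)%:E -> x = a%:E.
Proof.
move=> <-; have n0 : (0 < n.+1%:R :> R)%R by rewrite ltr0n.
case: x => [x||].
- by rewrite -EFinM => -[] /eqP; rewrite mulrC (inj_eq (mulIf (lt0r_neq0 n0))) => /eqP ->.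
- by rewrite gt0_muley ?lte_fin.
- by rewrite gt0_muleNy ?lte_fin.
Qed.

(** Taylor expansion of the cosine; the moment hypothesis makes the quadratic
    term exactly [k ^ 2], and [W] is supported in the unit ball, so the
    quartic term is controlled by the same moment. *)
Lemma cos_integral_expansion n (W : RR -> RR) k :
  measurable_fun setT W -> (forall r, 0 <= W r)%R ->
  (forall r, 1 < r -> W r = 0)%R -> (0 < k)%R ->
  \int[leb n.+1]_z (W (enorm z) * enorm z ^+ 2)%:E = (2 * n.+1%:R)%:E ->
  let I := \int[leb n.+1]_z (W (enorm z) * (1 - cos (k * tnth z ord0)))%:E in
  I <= (k ^+ 2)%:E /\ (k ^+ 2)%:E <= I + (k ^+ 4 / 12)%:E.
Proof.
move=> mW W0 W1 k0 WM I.
have M2 : \int[leb n.+1]_z (W (enorm z) * tnth z ord0 ^+ 2)%:E = 2%:E.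
  exact: (cancel_natmul_ereal (@second_moment R n W mW W0) WM).
pose g a (y : RR) : RR := (a * y ^+ 2)%R.
have mg a : measurable_fun setT (g a).
  by apply: measurable_funM => //; exact: measurable_funX.
have g0 a : (0 <= a)%R -> forall y, (0 <= g a y)%R.
  by move=> a0 y; rewrite mulr_ge0// sqr_ge0.
have gI a : (0 <= a)%R -> \int[leb n.+1]_z (W (enorm z) * g a (tnth z ord0))%:E = (a * 2)%:E.
  move=> a0; rewrite EFinM -M2.
  have msq : measurable_fun setT (fun y : RR => y ^+ 2 : RR)%R by exact: measurable_funX.
  exact: (integral_radialZ n mW msq W0 (fun y => sqr_ge0 y) a0).
have c0 (y : RR) : (0 <= 1 - cos (k * y))%R by rewrite subr_ge0 cos_le1.
have k20 : (0 <= k ^+ 2 / 2)%R by rewrite divr_ge0// sqr_ge0.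
have k40 : (0 <= k ^+ 4 / 24)%R by rewrite divr_ge0// exprn_ge0// ltW.
split.
  rewrite (_ : k ^+ 2 = k ^+ 2 / 2 * 2)%R; last by field.
  rewrite -gI//.
  rewrite /I; apply: (le_integral_radial n mW (measurable_1cos k) (mg _) W0 W1 c0 _ (g0 _ k20)).
  move=> y _; rewrite /g; have := cos_ge_quadratic (k * y); rewrite exprMn; lra.
rewrite (_ : k ^+ 4 / 12 = k ^+ 4 / 24 * 2)%R; last by field.
rewrite -gI// {1}(_ : k ^+ 2 = k ^+ 2 / 2 * 2)%R; last by field.
rewrite -gI// /I -(integral_radialD n mW (measurable_1cos k) (mg _) W0 c0 (g0 _ k40)).
have ms : measurable_fun setT (fun y : RR => (1 - cos (k * y)) + g (k ^+ 4 / 24) y : RR)%R.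
  by apply: (measurable_funD (f := fun y : RR => 1 - cos (k * y))%R); [exact: measurable_1cos|exact: mg].
apply: (le_integral_radial n mW (mg _) ms W0 W1 (g0 _ k20)).
- move=> y y1; rewrite /g; have := cos_le_quartic (k * y); rewrite !exprMn.
  have y4 : (y ^+ 4 <= y ^+ 2)%R.
    have -> : (y ^+ 4 = y ^+ 2 * y ^+ 2)%R by ring.
    by rewrite ler_piMr ?sqr_ge0// -(real_normK (num_real y)) exprn_ile1.
  have := ler_wpM2l k40 y4.
  set a := (y ^+ 4)%R; set b := (y ^+ 2)%R; set c := (k ^+ 4)%R; set d := (k ^+ 2)%R; lra.
- by move=> y; rewrite addr_ge0// g0.
Qed.

End laplacian_symbol_bounds.

(** * The symbol of the nonlocal gradient on the first axis *)

Section gradient_symbol_bounds.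
Context {R : realType}.
Local Open Scope ereal_scope.
Local Notation mu := (@lebesgue_measure R).
Local Notation leb n := (lebesgueRn R n).
Local Notation RR := (measurableTypeR R).
Context (n : nat) (W : RR -> RR).
Hypotheses (mW : measurable_fun setT W) (W0 : forall r : R, (0 <= W r)%R)
  (WN : forall r : R, (r <= 0)%R -> W r = 0%R) (W1 : forall r : R, (1 < r)%R -> W r = 0%R).
Hypothesis WM : \int[leb n.+2]_z (W (enorm z) * enorm z)%:E = (n.+2%:R)%:E.

Let V (r : RR) : RR := (W r / r)%R.

Let mV : measurable_fun setT V.
Proof. by apply: measurable_funM => //; exact: measurable_invr. Qed.

Let V0 (r : R) : (0 <= V r)%R.
Proof.
rewrite /V; have [r0|r0] := ltP 0%R r; first by rewrite divr_ge0// ltW.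
by rewrite WN// mul0r.
Qed.

Let V1 (r : R) : (1 < r)%R -> V r = 0%R.
Proof. by move=> r1; rewrite /V W1// mul0r. Qed.

(** The amount by which the gradient symbol [int W(|z|) (z_0 / |z|) sin (k z_0) dz]
    falls short of its linear part [k]. *)
Definition sine_defect (k : R) : \bar R :=
  \int[leb n.+2]_z (W (enorm z) / enorm z *
    (tnth z ord0 * (k * tnth z ord0 - sin (k * tnth z ord0))))%:E.

(** This is the slope at [0] of the gradient symbol: the normalization of the
    kernel makes the nonlocal gradient consistent. *)
Lemma sqr_moment : \int[leb n.+2]_z (W (enorm z) / enorm z * tnth z ord0 ^+ 2)%:E = 1%:E.
Proof.
apply: (@cancel_natmul_ereal R n.+1 _ _ 1%R (@second_moment R n.+1 V mV V0)).
rewrite mul1r -WM; apply: eq_integral => z _; rewrite /V; congr EFin.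
have [->|z0] := eqVneq (enorm z) 0%R; first by rewrite expr0n/= !mulr0.
by rewrite expr2 mulrA divfK.
Qed.

Lemma mul_sub_sin_scaled (k y : R) : (0 < k)%R ->
  (0 <= y * (k * y - sin (k * y)) <= k ^+ 3 / 6 * y ^+ 4)%R.
Proof.
move=> k0; have -> : (y * (k * y - sin (k * y)) = (k * y * (k * y - sin (k * y))) / k)%R.
  by field; rewrite gt_eqF.
rewrite divr_ge0 ?mul_sub_sin_ge0 ?(ltW k0)//= ler_pdivrMr//.
by apply: le_trans (mul_sub_sin_le _) _; rewrite le_eqVlt; apply/orP; left; apply/eqP; field.
Qed.

Lemma sine_defect_le (k : R) : (0 < k)%R -> sine_defect k <= (k ^+ 3 / 6)%:E.
Proof.
move=> k0; have k60 : (0 <= k ^+ 3 / 6)%R by rewrite divr_ge0// exprn_ge0// ltW.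
have msq : measurable_fun setT (fun y : RR => y ^+ 2 : RR)%R by exact: measurable_funX.
have mg : measurable_fun setT (fun y : RR => (k ^+ 3 / 6) * y ^+ 2 : RR)%R.
  exact: measurable_funM.
rewrite -[leRHS]mule1 -sqr_moment.
rewrite -(integral_radialZ n.+1 mV msq V0 (fun y => sqr_ge0 y) k60).
apply: (le_integral_radial n.+1 mV (measurable_sub_sin k) mg V0 V1).
- by move=> y; have /andP[] := mul_sub_sin_scaled y k0.
- move=> y y1; have /andP[_] := mul_sub_sin_scaled y k0; move/le_trans; apply.
  rewrite ler_wpM2l//.
  have -> : (y ^+ 4 = y ^+ 2 * y ^+ 2)%R by ring.
  by rewrite ler_piMr ?sqr_ge0// -(real_normK (num_real y)) exprn_ile1.
- by move=> y; rewrite mulr_ge0// sqr_ge0.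
Qed.

Hypothesis Wmono : forall r s : R, (0 < r)%R -> (r <= s)%R -> (s < 1)%R ->
  (s ^+ n.+1 * W s <= r ^+ n.+1 * W r)%R.

Let m (r : RR) : RR := (r ^+ n.+1 * W r)%R.

Let mm : measurable_fun setT m.
Proof. by apply: measurable_funM => //; exact: measurable_funX. Qed.

Let m0 (r : R) : (0 < r)%R -> (0 <= m r)%R.
Proof. by move=> r0; rewrite mulr_ge0// exprn_ge0// ltW. Qed.

(** On the ray with cosine [th] the frequency is [k |th|]; by evenness only
    [|th|] matters. *)
Lemma radial_sine_ge (k rho th : R) : (0 < k)%R -> (0 < rho)%R -> (2 * rho < 1)%R ->
  (2 * rho * k <= 1)%R -> (`|th| <= 1)%R ->
  \int[mu]_r (on_pos (fun r => r ^+ n.+1 *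
     (V r * (r * th * (k * (r * th) - sin (k * (r * th))))))%R r)%:E +
    ((m rho - m (2 * rho)) * (k * th ^+ 2 * rho ^+ 2 / 4))%:E <=
  \int[mu]_r (on_pos (fun r => r ^+ n.+1 * (V r * (k * (r * th) ^+ 2)))%R r)%:E.
Proof.
move=> k0 rho0 rho1 rhok th1.
have W1' (r : R) : (1 < r)%R -> m r = 0%R by move=> r1; rewrite /m W1// mulr0.
have [->|th0] := eqVneq th 0%R.
  rewrite integral0_eq; last first.
    by move=> r _; rewrite /on_pos; case: ifP => // _; rewrite !(mulr0, mul0r).
  rewrite expr0n/= !(mulr0, mul0r) adde0; apply: integral_ge0 => r _.
  rewrite lee_fin /on_pos; case: ifP => // r0.
  by rewrite mulr_ge0 ?exprn_ge0 ?(ltW r0)// mulr_ge0 ?V0// mulr_ge0 ?sqr_ge0// ltW.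
have tp : (0 < `|th|)%R by rewrite normr_gt0.
pose a := (k * `|th|)%R.
have a0 : (0 < a)%R by rewrite mulr_gt0.
have rhoa : (2 * rho * a <= 1)%R.
  apply: le_trans rhok; rewrite ler_wpM2l//; first by rewrite mulr_ge0// ltW.
  by rewrite ler_piMr// ltW.
have H := nonincreasing_sine_integral_ge mm m0 Wmono W1' a0 rho0 rho1 rhoa.
(* [y |-> y - sin y] is odd, so [th] and [k * th] may be replaced by moduli. *)
have E1 (r : R) : on_pos (fun r => r ^+ n.+1 *
     (V r * (r * th * (k * (r * th) - sin (k * (r * th))))))%R r =
   (`|th| * on_pos (fun r => m r * (a * r - sin (a * r))) r)%R.
  rewrite /on_pos; case: ifPn => r0; last by rewrite mulr0.
  rewrite /V /m /a; have [t0|t0] := ltP 0%R th.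
    rewrite gtr0_norm// (_ : k * th * r = k * (r * th))%R; last by ring.
    by field; rewrite gt_eqF.
  rewrite ler0_norm// (_ : k * - th * r = - (k * (r * th)))%R; last by ring.
  by rewrite sinN; field; rewrite gt_eqF.
have E2 (r : R) : on_pos (fun r => r ^+ n.+1 * (V r * (k * (r * th) ^+ 2)))%R r =
   (`|th| * on_pos (fun r => m r * (a * r)) r)%R.
  rewrite /on_pos; case: ifPn => r0; last by rewrite mulr0.
  rewrite /V /m /a (_ : `|th| * _ = `|th| ^+ 2 * (r ^+ n.+1 * W r * k * r))%R; last by ring.
  by rewrite real_normK ?num_real//; field; rewrite gt_eqF.
under eq_integral do rewrite E1 EFinM.
under [X in _ <= X]eq_integral do rewrite E2 EFinM.
have g0 (r : R) : (0 < r)%R -> (0 <= a * r)%R by move=> r0; rewrite mulr_ge0// ltW.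
have mg (g : RR -> RR) : measurable_fun setT g ->
    measurable_fun setT (fun r : RR => (on_pos (fun r => m r * g r)%R r)%:E).
  move=> mg; apply/measurable_EFinP; apply: measurable_on_pos.
  exact: measurable_funM.
have pos (g : R -> R) : (forall r, 0 < r -> 0 <= g r)%R ->
    forall r, 0 <= (on_pos (fun r => m r * g r)%R r)%:E.
  by move=> gr r; rewrite lee_fin /on_pos; case: ifP => // r0; rewrite mulr_ge0 ?m0 ?gr.
have ms : measurable_fun setT (fun r : RR => a * r - sin (a * r) : RR)%R.
  apply: continuous_measurable_fun => x; apply: cvgB.
    by apply: cvgM; [exact: cvg_cst|exact: cvg_id].
  apply: (@continuous_comp _ _ _ (fun y : R => a * y)%R (@sin R)); last exact: continuous_sin.
  by apply: cvgM; [exact: cvg_cst|exact: cvg_id].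
have ma : measurable_fun setT (fun r : RR => a * r : RR)%R by exact: measurable_funM.
have p1 := pos (fun r => a * r - sin (a * r))%R (fun r r0 => sin_le_id (g0 r r0)).
have p2 := pos _ g0.
rewrite (ge0_integralZl_T mu (mg _ ms) p1 (normr_ge0 th)).
rewrite (ge0_integralZl_T mu (mg _ ma) p2 (normr_ge0 th)).
rewrite (_ : _ * _ = `|th| * ((m rho - m (2 * rho)) * (a * rho ^+ 2 / 4)))%R; last first.
  by rewrite /a -(real_normK (num_real th)); field.
by rewrite EFinM -muleDr ?fin_num_adde_defl// lee_wpmul2l.
Qed.

(** Integrate [radial_sine_ge] over the directions. On [box] the squared
    cosine is at least [1/4] and the weight at least [1], which produces the
    constant [1/16]. *)
Lemma sine_defect_ge : exists2 c : R, (0 < c)%R & forall k rho : R,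
  (0 < k)%R -> (0 < rho)%R -> (2 * rho < 1)%R -> (2 * rho * k <= 1)%R ->
  sine_defect k + (c * ((m rho - m (2 * rho)) * (k * rho ^+ 2)))%:E <= k%:E.
Proof.
have [v v0 vbox] := gt0_ereal_lower_bound (@integral_box_gt0 R n.+1).
exists (v / 16)%R => [|k rho k0 rho0 rho1 rhok]; first by rewrite divr_gt0.
pose h1 (p : RR * RR) : R := (V p.1 * (k * p.2 ^+ 2))%R.
pose h2 (p : RR * RR) : R := (V p.1 * (p.2 * (k * p.2 - sin (k * p.2))))%R.
have mg1 : measurable_fun setT (fun y : RR => k * y ^+ 2 : RR)%R.
  by apply: measurable_funM => //; exact: measurable_funX.
have mh1 : measurable_fun setT (h1 : RR * RR -> RR).
  exact: (measurable_radial2 mV mg1).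
have mh2 : measurable_fun setT (h2 : RR * RR -> RR).
  exact: (measurable_radial2 mV (measurable_sub_sin k)).
have h10 p : (0 <= h1 p)%R by rewrite mulr_ge0// mulr_ge0 ?sqr_ge0// ltW.
have h20 p : (0 <= h2 p)%R by rewrite mulr_ge0//; have /andP[] := mul_sub_sin_scaled p.2 k0.
have h1z y : (h1 (0, y) = 0)%R by rewrite /h1/= /V invr0 mulr0 mul0r.
have h2z y : (h2 (0, y) = 0)%R by rewrite /h2/= /V invr0 mulr0 mul0r.
have -> : k%:E = \int[leb n.+2]_z (h1 (enorm z, tnth z ord0))%:E.
  have msq : measurable_fun setT (fun y : RR => y ^+ 2 : RR)%R by exact: measurable_funX.
  rewrite -[LHS]mule1 -sqr_moment.
  by rewrite -(integral_radialZ n.+1 mV msq V0 (fun y => sqr_ge0 y) (ltW k0)).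
rewrite /sine_defect -/(\int[leb n.+2]_z (h2 (enorm z, tnth z ord0))%:E).
rewrite (integral_polar_radial n.+1 mh1 h10 h1z) (integral_polar_radial n.+1 mh2 h20 h2z).
set D := ((m rho - m (2 * rho)) * (k * rho ^+ 2))%R.
have D0 : (0 <= D)%R.
  rewrite mulr_ge0// ?subr_ge0.
    by apply: Wmono => //; lra.
  by rewrite mulr_ge0 ?sqr_ge0// ltW.
pose I (h : RR * RR -> R) (w : Rn R n.+2) : \bar R :=
  \int[mu]_r (on_pos (fun r => r ^+ n.+1 * h (r, r * cosangle w))%R r)%:E.
have I0 h w : (forall p, 0 <= h p)%R -> 0 <= I h w.
  move=> hp; apply: integral_ge0 => r _; rewrite lee_fin /on_pos; case: ifP => // r0.
  by rewrite mulr_ge0// exprn_ge0// ltW.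
have mI (h : RR * RR -> R) : measurable_fun setT (h : RR * RR -> RR) ->
    (forall p, 0 <= h p)%R -> measurable_fun setT (I h).
  move=> mh hp; have := measurable_cosangle_integrand (n := n.+1) mh => mH.
  apply: (measurable_fun_fubini_tonelli_F (m2 := mu) _ mH) => p.
  rewrite lee_fin /on_pos; case: ifP => // r0; by rewrite mulr_ge0// exprn_ge0// ltW.
have maw : measurable_fun setT (fun w : Rn R n.+2 => (annulus_weight w)%:E).
  by apply/measurable_EFinP; exact: measurable_annulus_weight.
have mbox : measurable_fun setT (fun w : Rn R n.+2 => (indic_of (R := R) (@box R n.+1) w)%:E).
  exact: (measurable_indic_ofE (@measurable_box R n.+1)).
have D16 : (0 <= D / 16)%R by rewrite divr_ge0.
apply: (@le_trans _ _ (\int[leb n.+2]_w ((annulus_weight w)%:E * I h2 w) +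
   (D / 16)%:E * \int[leb n.+2]_w (indic_of (@box R n.+1) w)%:E)).
  rewrite leeD2l// (_ : v / 16 * D = D / 16 * v)%R; last by field.
  by rewrite EFinM lee_wpmul2l.
rewrite -ge0_integralZl_EFin//; last by move=> w _; rewrite lee_fin indic_of_ge0.
have ma2 : measurable_fun setT (fun w => (annulus_weight w)%:E * I h2 w).
  by apply: emeasurable_funM => //; exact: mI.
have ma1 : measurable_fun setT (fun w => (annulus_weight w)%:E * I h1 w).
  by apply: emeasurable_funM => //; exact: mI.
have a2 w : 0 <= (annulus_weight w)%:E * I h2 w.
  by rewrite mule_ge0 ?lee_fin ?annulus_weight_ge0 ?I0.
rewrite -ge0_integralD//; last 2 first.
- by move=> w _; rewrite -EFinM lee_fin mulr_ge0// indic_of_ge0.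
- exact: emeasurable_funM.
apply: ge0_le_integral => //.
- by move=> w _; rewrite adde_ge0// -EFinM lee_fin mulr_ge0// indic_of_ge0.
- by apply: emeasurable_funD => //; exact: emeasurable_funM.
move=> w _; have th1 : (`|cosangle w| <= 1)%R.
  rewrite /cosangle normrM normfV (ger0_norm (enorm_ge0 _)).
  have [->|w0] := eqVneq (enorm w) 0%R; first by rewrite invr0 mulr0.
  by rewrite ler_pdivrMr ?mul1r ?ler_tnth_enorm// lt_neqAle eq_sym w0 enorm_ge0.
have H := radial_sine_ge k0 rho0 rho1 rhok th1.
set X := ((m rho - m (2 * rho)) * _)%R in H.
have XE : X = (D * cosangle w ^+ 2 / 4)%R by rewrite /X /D; field.
have X0 : (0 <= X)%R by rewrite XE divr_ge0// mulr_ge0// sqr_ge0.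
have Ile : I h2 w + X%:E <= I h1 w by exact: H.
rewrite /indic_of; case: ifPn => [wb|_]; last first.
  rewrite mule0 adde0 lee_wpmul2l ?lee_fin ?annulus_weight_ge0//.
  by apply: le_trans Ile; rewrite leeDl// lee_fin.
have [/andP[w1 w2] w0] := box_enorm wb.
have aw : (1 <= annulus_weight w)%R by apply: annulus_weight_ge1 => //; lra.
apply: (@le_trans _ _ ((annulus_weight w)%:E * (I h2 w + X%:E))); last first.
  by rewrite lee_wpmul2l ?lee_fin ?annulus_weight_ge0.
rewrite (@muleDr R (annulus_weight w)%:E (I h2 w) X%:E) ?fin_num_adde_defl//.
rewrite leeD2l// mule1 -EFinM lee_fin.
have c2 : (2^-1 <= cosangle w)%R.
  rewrite /cosangle ler_pdivlMr; last by lra.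
  by lra.
have c4 : (4^-1 <= cosangle w ^+ 2)%R by rewrite expr2; nra.
apply: (@le_trans _ _ X); last by rewrite ler_peMl.
by rewrite XE; have := ler_wpM2l D0 c4; lra.
Qed.

(** Take [rho = eps / 4] for [k <= 1] and [rho = eps / (4 k)] for [k >= 1]. Near the
    origin [m(r) = c0 r^(-1-beta)], so [m(rho) - m(2 rho)] is a multiple of
    [rho^(-1-beta)], positive because [beta > -1], and [sine_defect_ge] gives a
    lower bound of order [k rho^(1-beta)]. *)
Lemma sine_symbol_bounds (c0 eps beta : R) : (0 < c0)%R -> (0 < eps <= 1)%R ->
  (-1 < beta < 1)%R ->
  (forall r, 0 < r < eps -> W r = c0 * r `^ (- n.+2%:R - beta))%R ->
  exists2 c : R, (0 < c)%R & forall k : R, (0 < k)%R ->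
    [/\ (k <= 1)%R -> sine_defect k + (c * k)%:E <= k%:E &
        (1 <= k)%R -> sine_defect k + (c * k `^ beta)%:E <= k%:E].
Proof.
move=> c00 /andP[eps0 eps1] /andP[beta1 beta2] WE.
have [v v0 H] := sine_defect_ge.
have mE r : (0 < r < eps)%R -> (m r = c0 * r `^ (- 1 - beta))%R.
  move=> r0; rewrite /m WE// mulrCA -powR_mulrn; last by case/andP: r0 => /ltW.
  rewrite -powRD; last by case/andP: r0 => r0 _; rewrite (gt_eqF r0) implybT.
  by congr (_ * _ `^ _)%R; rewrite -(natr1 n.+1); ring.
pose q := (1 - 2 `^ (- 1 - beta))%R.
have q0 : (0 < q)%R.
  rewrite subr_gt0 -opprD powRN invf_lt1 ?powR_gt0//.
  have b1 : (0 < 1 + beta)%R by lra.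
  rewrite -[ltLHS](_ : 1 `^ (1 + beta) = 1)%R; last by rewrite powR1.
  by rewrite gt0_ltr_powR ?nnegrE ?ltr1n.
have main k rho : (0 < k)%R -> (0 < rho)%R -> (2 * rho < eps)%R -> (2 * rho * k <= 1)%R ->
    sine_defect k + (v * c0 * q * (k * rho `^ (1 - beta)))%:E <= k%:E.
  move=> k0 r0 re rk; have := H k rho k0 r0 _ rk; rewrite (lt_le_trans re eps1) => /(_ isT).
  rewrite !mE ?mulr_gt0 ?r0//=; last by apply: lt_trans re; rewrite ltr_pMl// ltr1n.
  rewrite powRM ?(ltW r0)//.
  have -> : (rho ^+ 2 = rho `^ 2)%R by rewrite powR_mulrn// ltW.
  have -> : (rho `^ (1 - beta) = rho `^ (-1 - beta) * rho `^ 2)%R.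
    by rewrite -powRD ?(gt_eqF r0) ?implybT//; congr (_ `^ _)%R; ring.
  set a := (rho `^ (- 1 - beta))%R; set b := (rho `^ 2)%R; rewrite /q; set e := (2 `^ _)%R.
  by congr (_ + _%:E <= _); ring.
exists (v * c0 * q * (eps / 4) `^ (1 - beta))%R.
  by rewrite !mulr_gt0// powR_gt0// divr_gt0.
move=> k k0; split=> k1.
  have e4 : (0 < eps / 4)%R by rewrite divr_gt0.
  rewrite -(mulrA (v * c0 * q)%R) (mulrC (_ `^ _)%R k).
  by apply: main => //; [lra|nra].
have e4 : (0 < eps / (4 * k))%R by rewrite divr_gt0// mulr_gt0.
have ek : (eps / (4 * k) <= eps / 4)%R.
  by rewrite ler_pM2l// lef_pV2 ?posrE ?mulr_gt0//; nra.
have kE : (k * (eps / (4 * k)) `^ (1 - beta) = (eps / 4) `^ (1 - beta) * k `^ beta)%R.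
  have -> : (eps / (4 * k) = (eps / 4) * k^-1)%R by field; rewrite gt_eqF.
  rewrite powRM ?invr_ge0 ?(ltW k0)// ?divr_ge0 ?(ltW eps0)// mulrCA; congr (_ * _)%R.
  rewrite -powR_inv1 ?(ltW k0)// -powRrM -{1}(powRr1 (ltW k0)) -powRD ?(gt_eqF k0) ?implybT//.
  by congr (_ `^ _)%R; ring.
rewrite -(mulrA (v * c0 * q)%R) -kE; apply: main => //; first by lra.
have -> : (2 * (eps / (4 * k)) * k = eps / 2)%R by field; rewrite gt_eqF.
by lra.
Qed.

End gradient_symbol_bounds.

(** * Reduction of the symbols to the first axis *)

Section symbols.
Context {R : realType}.
Local Notation leb n := (lebesgueRn R n).
Local Notation RR := (measurableTypeR R).

Lemma measurable_profile (w : R -> R) : kernel_profile w ->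
  measurable_fun setT (on_pos w : RR -> RR).
Proof.
case=> mw _ _.
have -> : on_pos w = w \_ (`]0, +oo[ : set R).
  by apply/funext => r; rewrite patchE mem_setE in_itv/= andbT.
by apply/(measurable_restrictT (w : RR -> RR)).
Qed.

Lemma profile_ge0 (w : R -> R) : kernel_profile w -> forall r, 0 <= on_pos w r.
Proof. by case=> _ w0 _ r; rewrite /on_pos; case: ifP => // /w0. Qed.

Lemma profile_npos (w : R -> R) (r : R) : r <= 0 -> on_pos w r = 0.
Proof. by rewrite /on_pos leNgt; case: ifP. Qed.

Lemma profile_gt1 (w : R -> R) : kernel_profile w -> forall r, 1 < r -> on_pos w r = 0.
Proof. by case=> _ _ w1 r r1; rewrite /on_pos w1// if_same. Qed.

Definition direction n (xi : 'rV[int]_n) : Rn R n :=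
  [tuple (xi 0 i)%:~R / freq_norm R xi | i < n].

Lemma freq_norm_ge1 n (xi : 'rV[int]_n) : xi != 0 -> 1 <= freq_norm R xi.
Proof.
move=> /rV0Pn[i xii]; rewrite -(sqrtr1 R) ler_wsqrtr// (bigD1 i)//=.
rewrite ler_wpDr ?sumr_ge0// => [j _|]; first exact: sqr_ge0.
rewrite -rmorphXn/= -[1]/(1%:~R) ler_int.
by rewrite -gtz0_ge1 lt_neqAle sqr_ge0 andbT eq_sym sqrf_eq0.
Qed.

Lemma freq_norm_sqr n (xi : 'rV[int]_n) :
  freq_norm R xi ^+ 2 = \sum_(i < n) (xi 0 i)%:~R ^+ 2.
Proof. by rewrite sqr_sqrtr// sumr_ge0// => i _; exact: sqr_ge0. Qed.

Lemma enorm_direction n (xi : 'rV[int]_n) : xi != 0 -> enorm (direction xi) = 1.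
Proof.
move=> /freq_norm_ge1 x1; have x0 : 0 < freq_norm R xi by lra.
apply/eqP; rewrite -(@eqrXn2 _ 2%N) ?enorm_ge0// sqr_enorm expr1n.
under eq_bigr do rewrite tnth_mktuple expr_div_n.
by rewrite -mulr_suml -freq_norm_sqr divff// expf_neq0// gt_eqF.
Qed.

Lemma freq_dotE n (xi : 'rV[int]_n) s : xi != 0 ->
  freq_dot xi s = freq_norm R xi * dotRn (direction xi) s.
Proof.
move=> /freq_norm_ge1 x1; have x0 : 0 < freq_norm R xi by lra.
rewrite /freq_dot /dotRn mulr_sumr; apply: eq_bigr => i _.
by rewrite tnth_mktuple; field; rewrite gt_eqF.
Qed.

Lemma freq_dot0 n (xi : 'rV[int]_n) (s : Rn R n) : enorm s = 0 -> freq_dot xi s = 0.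
Proof.
move=> s0; apply: big1 => i _; have := ler_tnth_enorm s i.
by rewrite s0 normr_le0 => /eqP ->; rewrite mulr0.
Qed.

(** Extending the kernel profile by zero makes the restriction of the integral
    to the ball of radius [delta] automatic; the value at the origin is
    replaced by zero, where the integrands vanish anyway. *)
Lemma on_pos_ball (w : R -> R) (delta r : R) : kernel_profile w -> 0 < delta -> 0 <= r ->
  (if r <= delta then (if r == 0 then 0 else w (r / delta)) else 0) = on_pos w (r / delta).
Proof.
move=> hw d0 r0; rewrite /on_pos; case: ifPn => [rd|].
  case: eqVneq => [->|rn0]; first by rewrite mul0r ltxx.
  by rewrite divr_gt0// lt_neqAle eq_sym rn0.
rewrite -ltNge => rd; case: ifPn => // _; case: hw => _ _ ->//.
by rewrite ltr_pdivlMr// mul1r.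
Qed.

Lemma integral_dot_rotation_scale n (e : Rn R n.+1) (H : RR * RR -> R) (delta : R) :
  enorm e = 1 -> 0 < delta -> measurable_fun setT (H : RR * RR -> RR) -> (forall p, 0 <= H p) ->
  (\int[leb n.+1]_z (H (enorm z, dotRn e z))%:E =
  \int[leb n.+1]_z (delta ^+ n.+1 * H (delta * enorm z, delta * tnth z ord0))%:E)%E.
Proof.
move=> e1 d0 mH H0; have mHE : measurable_fun setT (EFin \o H) by apply/measurable_EFinP.
rewrite (integral_dot_rotation (H := EFin \o H) e1 mHE).
have mHz : measurable_fun setT (fun z : Rn R n.+1 => (H (enorm z, tnth z ord0))%:E).
  apply: (measurable_enorm_comp (u := fun z => tnth z ord0) (H := EFin \o H)) => //.
  exact: measurable_tnth.
rewrite -(ge0_integral_scaleRn d0 mHz) => [|z]; last by rewrite lee_fin.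
rewrite -(ge0_integralZl_T (leb n.+1)).
- by apply: eq_integral => z _; rewrite enorm_scaleRn ?(ltW d0)// tnth_scaleRn EFinM.
- by apply: (measurableT_comp mHz (g := scaleRn delta)); exact: measurable_scaleRn.
- by move=> z; rewrite lee_fin.
- by rewrite exprn_ge0// ltW.
Qed.

(** No finiteness is assumed: both sides vanish when [x] is infinite. *)
Lemma fine_posZ (a : R) (x : \bar R) : 0 < a -> fine (a%:E * x)%E = a * fine x.
Proof.
move=> a0; case: x => [x||]//=.
- by rewrite gt0_muley ?lte_fin//= mulr0.
- by rewrite gt0_muleNy ?lte_fin//= mulr0.
Qed.

Lemma scale_omega1 n (w : R -> R) r : scale_omega n w 1 r = w r.
Proof. by rewrite /scale_omega expr1n invr1 mul1r mulr1. Qed.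

Lemma scale_omegahat1 n (w : R -> R) r : scale_omegahat n w 1 r = w r.
Proof. by rewrite /scale_omegahat expr1n invr1 mul1r mulr1. Qed.

Section with_kernels.
Context (n : nat) (omega omegahat : R -> R) (beta : R).
Hypothesis hker : kernel_assumptions n.+2 omega omegahat beta.

Let W := on_pos omega.
Let Wh := on_pos omegahat.

Lemma omega_moment :
  (\int[leb n.+2]_z (W (enorm z) * enorm z ^+ 2)%:E = (2 * n.+2%:R)%:E)%E.
Proof.
have := kernel_K1 hker ltr01.
rewrite (eq_integral (fun z => (W (enorm z) * enorm z ^+ 2)%:E)); last first.
  move=> z _; rewrite scale_omega1 /W /on_pos lt_neqAle enorm_ge0 andbT eq_sym.
  by case: eqVneq => //= ->; rewrite expr0n/= !mulr0.
move=> H; have : (2%:E * ((2^-1)%:E * \int[leb n.+2]_z (W (enorm z) * enorm z ^+ 2)%:E) =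
  (2 * n.+2%:R)%:E)%E by rewrite H -EFinM.
by rewrite muleA -EFinM divff// mul1e.
Qed.

Lemma omegahat_moment :
  (\int[leb n.+2]_z (Wh (enorm z) * enorm z)%:E = (n.+2%:R)%:E)%E.
Proof.
rewrite -(kernel_K2 hker ltr01); apply: eq_integral => z _.
rewrite scale_omegahat1 /Wh /on_pos lt_neqAle enorm_ge0 andbT eq_sym.
by case: eqVneq => //= ->; rewrite !mulr0.
Qed.

(** Rotate the frequency to the first axis, then dilate by [delta]. *)
Lemma lambda_symbolE (delta : R) (xi : 'rV[int]_n.+2) : 0 < delta -> xi != 0 ->
  lambda_symbol omega delta xi = delta ^- 2 * fine (\int[leb n.+2]_z
    (W (enorm z) * (1 - cos (delta * freq_norm R xi * tnth z ord0)))%:E).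
Proof.
move=> d0 xi0; have hw := omega_profile hker.
pose q := freq_norm R xi.
pose H (p : RR * RR) : R := delta ^- (n.+2 + 2) * W (p.1 / delta) * (1 - cos (q * p.2)).
have mWd : measurable_fun setT (fun r : RR => delta ^- (n.+2 + 2) * W (r / delta) : RR).
  apply: measurable_funM => //; apply: (measurableT_comp (measurable_profile hw)).
  exact: measurable_funM.
have mH : measurable_fun setT (H : RR * RR -> RR).
  exact: (measurable_radial2 mWd (measurable_1cos q)).
have H0 p : 0 <= H p.
  rewrite mulr_ge0 ?subr_ge0 ?cos_le1// mulr_ge0 ?profile_ge0//.
  by rewrite invr_ge0 exprn_ge0// ltW.
have mI : measurable_fun setT (fun z : Rn R n.+2 =>
    (W (enorm z) * (1 - cos (delta * q * tnth z ord0)))%:E).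
  exact: (measurable_radial2_Rn (n := n.+1) (measurable_profile hw) (measurable_1cos (delta * q))).
rewrite /lambda_symbol /Rintegral integral_mkcond.
transitivity (fine (\int[leb n.+2]_z (H (enorm z, dotRn (direction xi) z))%:E)).
  congr fine; apply: eq_integral => s _; rewrite patchE.
  rewrite (_ : (s \in _) = (enorm s <= delta)); last by apply/idP/idP => /[!inE].
  rewrite /H/= /W -(on_pos_ball hw d0 (enorm_ge0 s)) -freq_dotE//.
  case: ifP => _; last by rewrite mulr0 mul0r.
  rewrite /scale_omega; case: eqVneq => // s0.
  by rewrite freq_dot0// cos0 subrr !mulr0.
rewrite (integral_dot_rotation_scale (enorm_direction xi0) d0 mH H0).
rewrite (eq_integral (fun z => (delta ^- 2)%:E *
    (W (enorm z) * (1 - cos (delta * q * tnth z ord0)))%:E)%E); last first.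
  move=> z _; rewrite /H/= -EFinM; congr EFin.
  rewrite (mulrC delta (enorm z)) mulfK ?gt_eqF//.
  rewrite (_ : q * (delta * tnth z ord0) = delta * q * tnth z ord0); last by ring.
  rewrite !mulrA; congr (_ * _ * _); rewrite exprD invfM mulrA divff ?mul1r//.
  by rewrite expf_neq0// gt_eqF.
rewrite (ge0_integralZl_T (leb n.+2) mI)//; last 2 first.
- by move=> z; rewrite lee_fin mulr_ge0 ?profile_ge0// subr_ge0 cos_le1.
- by rewrite invr_ge0 exprn_ge0// ltW.
by rewrite fine_posZ// invr_gt0 exprn_gt0.
Qed.

(** After rotating the frequency to the first axis, the reflection [flip] kills
    every part of the integrand that is odd in the first coordinate. What
    remains of [tnth (T z) j] is its part [tnth e j * z_0], by the third property of
    [exists_rotation], so the vector [b] is parallel to the frequency. *)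
Lemma b_symbolE (delta : R) (xi : 'rV[int]_n.+2) (j : 'I_n.+2) (D : R) :
  0 < delta -> xi != 0 -> sine_defect n Wh (delta * freq_norm R xi) = D%:E ->
  b_symbol omegahat delta xi j =
    tnth (direction xi) j * (delta^-1 * (delta * freq_norm R xi - D)).
Proof.
move=> d0 xi0 DE; have hw := omegahat_profile hker.
have mW := measurable_profile hw; have W0 := profile_ge0 hw; have W1 := profile_gt1 hw.
have q1 := freq_norm_ge1 xi0; set q := freq_norm R xi in q1 DE *.
have q0 : 0 < q by lra.
pose A (r : RR) : RR := delta ^- (n.+2 + 1) * Wh (r / delta) / r.
have dp : 0 < delta ^- (n.+2 + 1) by rewrite invr_gt0 exprn_gt0.
have mA : measurable_fun setT A.
  apply: measurable_funM; last exact: measurable_invr.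
  apply: measurable_funM => //; apply: (measurableT_comp mW).
  exact: measurable_funM.
have A0 (r : R) : 0 <= A r.
  rewrite /A; have [r0|r0] := ltP 0 r.
    by rewrite divr_ge0 ?(ltW r0)// mulr_ge0 ?W0// ltW.
  by rewrite /Wh profile_npos ?mulr0 ?mul0r// pmulr_lle0// invr_gt0.
pose G (u : Rn R n.+2 -> R) (z : Rn R n.+2) : R := A (enorm z) * (u z * sin (q * tnth z ord0)).
have msin : measurable_fun setT (fun z : Rn R n.+2 => sin (q * tnth z ord0) : RR).
  have cs : continuous (fun y : R => sin (q * y)).
    move=> x; apply: (@continuous_comp _ _ _ (fun y : R => q * y) (@sin R)).
      by apply: cvgM; [exact: cvg_cst|exact: cvg_id].
    exact: continuous_sin.
  apply: (@measurableT_comp _ _ _ _ _ _ (fun y : RR => sin (q * y) : RR)).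
    exact: continuous_measurable_fun.
  exact: measurable_tnth.
have mAe : measurable_fun setT (fun z : Rn R n.+2 => A (enorm z) : RR).
  by apply: measurableT_comp => //; exact: measurable_enorm.
have mG u : measurable_fun setT (u : Rn R n.+2 -> RR) ->
    measurable_fun setT (fun z => (G u z)%:E).
  move=> mu; apply/measurable_EFinP; apply: measurable_funM => //.
  exact: measurable_funM.
(* [G u] is dominated by [q |z|] times the kernel, which is integrable. *)
have iG u : measurable_fun setT (u : Rn R n.+2 -> RR) -> (forall z, `|u z| <= enorm z) ->
    (leb n.+2).-integrable setT (fun z => (G u z)%:E).
  move=> mu uz.
  pose B (z : Rn R n.+2) : R := delta ^- (n.+2 + 1) * Wh (enorm z / delta) * enorm z.
  have mB0 : measurable_fun setT (B : Rn R n.+2 -> RR).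
    apply: measurable_funM; last exact: measurable_enorm.
    apply: measurable_funM => //; apply: (measurableT_comp mW).
    by apply: measurable_funM => //; exact: measurable_enorm.
  have mB : measurable_fun setT (fun z => (q * B z)%:E).
    by apply/measurable_EFinP; apply: measurable_funM.
  have B0 z : 0 <= B z.
    by rewrite mulr_ge0 ?enorm_ge0// mulr_ge0 ?(ltW dp)// W0.
  have IB : (\int[leb n.+2]_z (B z)%:E = n.+2%:R%:E)%E.
    rewrite -(kernel_K2 hker d0); apply: eq_integral => z _; congr EFin.
    rewrite /B /scale_omegahat /Wh /on_pos.
    have [->|z0] := eqVneq (enorm z) 0; first by rewrite !mulr0.
    by rewrite divr_gt0// lt_neqAle eq_sym z0 enorm_ge0.
  have iB : (leb n.+2).-integrable setT (fun z => (q * B z)%:E).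
    apply/integrableP; split => //.
    rewrite (eq_integral (fun z => q%:E * (B z)%:E)%E); last first.
      by move=> z _; rewrite -EFinM abse_EFin ger0_norm// mulr_ge0// ltW.
    rewrite ge0_integralZl_T//; first by rewrite IB -EFinM ltry.
      exact/measurable_EFinP.
    exact: ltW.
  apply: (le_integrable measurableT (mG _ mu) _ iB) => z _ /=.
  rewrite lee_fin /G (ger0_norm (x := q * _)); last by rewrite mulr_ge0// ltW.
  have -> : `|A (enorm z) * (u z * sin (q * tnth z ord0))| =
      A (enorm z) * (`|u z| * `|sin (q * tnth z ord0)|).
    by rewrite normrM (ger0_norm (A0 (enorm z))) normrM.
  apply: (@le_trans _ _ (A (enorm z) * (enorm z * (q * enorm z)))).
    rewrite ler_wpM2l// ler_pM//; apply: le_trans (abs_sin_le _) _.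
    by rewrite normrM (gtr0_norm q0) ler_wpM2l ?(ltW q0)// ler_tnth_enorm.
  rewrite /A /B; have [->|z0] := eqVneq (enorm z) 0; first by rewrite !(mulr0, mul0r).
  rewrite le_eqVlt; apply/orP; left; apply/eqP; set c := delta ^- _ * Wh _.
  by field.
have [T [L [pT isoT decT dotT]]] := exists_rotation (enorm_direction xi0).
pose e0 := basisRn (R := R) (ord0 : 'I_n.+2).
have mT := pT.1.
have mTj : measurable_fun setT (fun z => tnth (T z) j : RR).
  by apply: (measurableT_comp (f := fun z : Rn R n.+2 => tnth z j)) => //; exact: measurable_tnth.
pose F (z : Rn R n.+2) : R := A (enorm z) * (tnth z j * sin (q * dotRn (direction xi) z)).
have mF : measurable_fun setT (fun z => (F z)%:E).
  apply/measurable_EFinP; apply: measurable_funM => //; apply: measurable_funM.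
    exact: measurable_tnth.
  apply: (@measurableT_comp _ _ _ _ _ _ (fun y : RR => sin (q * y) : RR)).
    apply: continuous_measurable_fun => x.
    apply: (@continuous_comp _ _ _ (fun y : R => q * y) (@sin R)).
      by apply: cvgM; [exact: cvg_cst|exact: cvg_id].
    exact: continuous_sin.
  exact: measurable_dotRn.
have FG : (\int[leb n.+2]_z (F z)%:E = \int[leb n.+2]_z (G (fun z => tnth (T z) j) z)%:E)%E.
  rewrite -(preserves_integral pT mF); apply: eq_integral => z _.
  by rewrite /F /G isoT /dotRn dotT.
have bF : b_symbol omegahat delta xi j = fine (\int[leb n.+2]_z (F z)%:E)%E.
  rewrite /b_symbol /Rintegral integral_mkcond; congr fine.
  apply: eq_integral => s _; rewrite patchE.
  rewrite (_ : (s \in _) = (enorm s <= delta)); last by apply/idP/idP => /[!inE].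
  rewrite /F /A /Wh -(on_pos_ball hw d0 (enorm_ge0 s)) freq_dotE//.
  case: ifP => _; last by rewrite mulr0 !mul0r.
  rewrite /scale_omegahat; case: eqVneq => [->|s0]; last by congr EFin; ring.
  by rewrite invr0 !(mulr0, mul0r).
have flipE (z : Rn R n.+2) : enorm (flip z) = enorm z :> R.
  move: z; apply: Rn_ind => x t; apply: enorm_eq.
  by rewrite /flip /head_map consRnK !sqr_enorm_cons/= sqrrN.
have dec (z : Rn R n.+2) : tnth (T z) j - tnth (T (flip z)) j = 2 * tnth (direction xi) j * tnth z ord0.
  move: z; apply: Rn_ind => x t; rewrite /flip /head_map consRnK/=.
  by rewrite !decT tnth_consRn0/=; ring.
pose I := (\int[leb n.+2]_z (A (enorm z) * (tnth z ord0 * sin (q * tnth z ord0)))%:E)%E.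
have i0 := iG (fun z => tnth z ord0) (measurable_tnth _) (fun z => ler_tnth_enorm z ord0).
(* [G u] and its reflection have the same integral; they add up to a
   multiple of the integrand of [I]. *)
have symm : (\int[leb n.+2]_z (G (fun z => tnth (T z) j) z)%:E = (tnth (direction xi) j)%:E * I)%E.
  pose u z := tnth (T z) j; pose u' z := - tnth (T (flip z)) j.
  have mu' : measurable_fun setT (u' : Rn R n.+2 -> RR).
    by apply: measurable_funN; apply: (measurableT_comp mTj); exact: (preserves_flip n.+1).1.
  have uz z : `|u z| <= enorm z by rewrite -(isoT z) ler_tnth_enorm.
  have iu := iG u mTj uz.
  have iu' : (leb n.+2).-integrable setT (fun z => (G u' z)%:E).
    by apply: iG => // z; rewrite normrN -(flipE z) -(isoT (flip z)) ler_tnth_enorm.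
  have Guu' : (\int[leb n.+2]_z (G u' z)%:E = \int[leb n.+2]_z (G u z)%:E)%E.
    rewrite -(preserves_integral (preserves_flip n.+1) (mG _ mTj)).
    apply: eq_integral => z _; congr EFin; rewrite /G flipE /u'.
    rewrite (_ : tnth (flip z) ord0 = - tnth z ord0)//.
    by rewrite mulrN sinN mulrN mulNr.
  have := integralD measurableT iu iu'; rewrite Guu'.
  rewrite (eq_integral (fun z => (2 * tnth (direction xi) j)%:E * (G (fun z => tnth z ord0) z)%:E)%E); last first.
    move=> z _; rewrite -EFinD -EFinM; congr EFin; rewrite /G /u /u'.
    transitivity (A (enorm z) * ((tnth (T z) j - tnth (T (flip z)) j) * sin (q * tnth z ord0))).
      by ring.
    by rewrite dec; ring.
  rewrite integralZl// -/I.
  have /fineK <- := integrable_fin_num measurableT iu.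
  have /fineK <- : I \is a fin_num by exact: (integrable_fin_num measurableT i0).
  rewrite -!EFinM -EFinD => -[] H; congr EFin; lra.
have IE : I = (delta^-1 * (delta * q - D))%:E.
  pose H1 (p : RR * RR) : R := A p.1 * (q * p.2 ^+ 2).
  pose H2 (p : RR * RR) : R := A p.1 * (p.2 * (q * p.2 - sin (q * p.2))).
  have mq : measurable_fun setT (fun y : RR => q * y ^+ 2 : RR).
    by apply: measurable_funM => //; exact: measurable_funX.
  have H10 p : 0 <= H1 p by rewrite mulr_ge0// mulr_ge0 ?sqr_ge0// ltW.
  have H20 p : 0 <= H2 p by rewrite mulr_ge0//; have /andP[] := mul_sub_sin_scaled p.2 q0.
  have e01 := @enorm_basisRn R _ (ord0 : 'I_n.+2).
  have dn : delta != 0 by rewrite gt_eqF.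
  have dz (H : RR * RR -> R) : measurable_fun setT (H : RR * RR -> RR) -> (forall p, 0 <= H p) ->
      (\int[leb n.+2]_z (H (enorm z, tnth z ord0))%:E =
       \int[leb n.+2]_z (delta ^+ n.+2 * H (delta * enorm z, delta * tnth z ord0))%:E)%E.
    move=> mH H0; rewrite -(integral_dot_rotation_scale e01 d0 mH H0).
    by apply: eq_integral => z _; rewrite dot_basisRn.
  have Ascale e : delta ^+ n.+2 * A (delta * e) = delta ^- 2 * (Wh e / e).
    rewrite /A (mulrC delta e) mulfK// addn1 (exprS delta n.+2) invfM (invfM e).
    have Xn : delta ^+ n.+2 != 0 by rewrite expf_neq0.
    move: Xn; set X := delta ^+ n.+2; set ei := e^-1; set w := Wh e => Xn.
    by field; rewrite dn.
  have mH1' : measurable_fun setT (H1 : RR * RR -> RR) by exact: (measurable_radial2 mA mq).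
  have mH2' : measurable_fun setT (H2 : RR * RR -> RR).
    exact: (measurable_radial2 mA (measurable_sub_sin q)).
  have mV : measurable_fun setT (fun r : RR => Wh r / r : RR).
    by apply: measurable_funM => //; exact: measurable_invr.
  have V0 r : 0 <= Wh r / r.
    have [r0|r0] := ltP 0 r; first by rewrite divr_ge0 ?W0// ltW.
    by rewrite /Wh profile_npos// mul0r.
  have J1 : (\int[leb n.+2]_z (H1 (enorm z, tnth z ord0))%:E = q%:E)%E.
    rewrite dz// -[RHS]mule1 -(sqr_moment mW W0 (@profile_npos omegahat) omegahat_moment).
    have msq : measurable_fun setT (fun y : RR => y ^+ 2 : RR) by exact: measurable_funX.
    rewrite -(integral_radialZ n.+1 mV msq V0 (fun y => sqr_ge0 y) (ltW q0)).
    apply: eq_integral => z _; congr EFin; rewrite /H1/= mulrA Ascale.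
    by set ei := Wh _ / _; field.
  have J2 : (\int[leb n.+2]_z (H2 (enorm z, tnth z ord0))%:E = (delta^-1 * D)%:E)%E.
    rewrite dz// EFinM -DE /sine_defect.
    have gs (y : RR) : 0 <= y * (delta * q * y - sin (delta * q * y)).
      by have /andP[] := mul_sub_sin_scaled y (mulr_gt0 d0 q0).
    have di : 0 <= delta^-1 by rewrite invr_ge0 ltW.
    rewrite -(integral_radialZ n.+1 mV (measurable_sub_sin (delta * q)) V0 gs di).
    apply: eq_integral => z _; congr EFin; rewrite /H2/= mulrA Ascale.
    rewrite (_ : q * (delta * tnth z ord0) = delta * q * tnth z ord0); last by ring.
    by set ei := Wh _ / _; set S := sin _; field.
  have posI (H : RR * RR -> R) r : measurable_fun setT (H : RR * RR -> RR) -> (forall p, 0 <= H p) ->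
      (\int[leb n.+2]_z (H (enorm z, tnth z ord0))%:E = r%:E)%E ->
      (leb n.+2).-integrable setT (fun z : Rn R n.+2 => (H (enorm z, tnth z ord0))%:E).
    move=> mH H0 Hr; apply/integrableP; split.
      apply: (measurable_enorm_comp (u := fun z => tnth z ord0) (H := EFin \o H)).
        exact: measurable_tnth.
      exact/measurable_EFinP.
    rewrite (eq_integral (fun z => (H (enorm z, tnth z ord0))%:E)) ?Hr ?ltry// => z _.
    by rewrite gee0_abs// lee_fin.
  have i1 := posI _ _ mH1' H10 J1.
  have i2 := posI _ _ mH2' H20 J2.
  have := integralB measurableT i1 i2; rewrite J1 J2 -EFinB => H.
  rewrite /I; transitivity (q - delta^-1 * D)%:E; last by congr EFin; field; rewrite gt_eqF.
  rewrite -H; apply: eq_integral => z _; rewrite /H1 /H2/= -EFinB; congr EFin; ring.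
by rewrite bF FG symm IE.
Qed.
End with_kernels.
End symbols.

(** * Symbol errors *)

Section symbol_errors.
Context {R : realType} (n : nat) (omega omegahat : R -> R) (beta : R).
Hypothesis hker : kernel_assumptions n.+2 omega omegahat beta.
Local Notation leb n := (lebesgueRn R n).

(** The error is [delta^2 (k^2 - L) / (k^2 L)]. For [k <= 1] the numerator is
    [O(k^4)] and the denominator at least [c k^4]; for [k >= 1] the quotient is at
    most [1 / L <= 1 / c]. *)
Lemma lambda_symbol_error : exists2 C : R, 0 < C &
  forall (delta : R) (xi : 'rV[int]_n.+2), 0 < delta -> xi != 0 ->
  0 < lambda_symbol omega delta xi /\
  `|freq_norm R xi ^- 2 - (lambda_symbol omega delta xi)^-1| <= C * delta ^+ 2.
Proof.
have hw := omega_profile hker.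
have mW := measurable_profile hw; have W0 := profile_ge0 hw; have W1 := profile_gt1 hw.
have M0 : (0 : R) < 2 * n.+2%:R by rewrite mulr_gt0// ltr0n.
have [c c0 cL] := cos_integral_bounds mW W0 (profile_npos omega (lexx 0)) W1 M0 (omega_moment hker).
exists c^-1 => [|delta xi d0 xi0]; first by rewrite invr_gt0.
have q1 := freq_norm_ge1 (R := R) xi0; rewrite (lambda_symbolE hker)//.
set q := freq_norm R xi in q1 *; have q0 : 0 < q by lra.
have k0 : 0 < delta * q by rewrite mulr_gt0.
set k := delta * q in k0 *.
have [] := cos_integral_expansion mW W0 W1 k0 (omega_moment hker).
have := cL k k0; set I := (\int[_]_z _)%E => cI Ik kI.
have : I \is a fin_num.
  rewrite ge0_fin_numE; last first.
    by apply: integral_ge0 => z _; rewrite lee_fin mulr_ge0 ?W0// subr_ge0 cos_le1.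
  by apply: le_lt_trans Ik _; rewrite ltry.
move: cI Ik kI; case: I => // L; rewrite !lee_fin => cL' Lk kL _ /=.
have m0 : 0 < Num.min 1 (k ^+ 2) by rewrite lt_min ltr01 exprn_gt0.
have L0 : 0 < L by apply: lt_le_trans cL'; rewrite mulr_gt0.
have d2 : 0 < delta ^+ 2 by rewrite exprn_gt0.
split; first by rewrite mulr_gt0// invr_gt0.
have qk : q ^- 2 = delta ^+ 2 / k ^+ 2 by rewrite /k; field; rewrite !gt_eqF.
have -> : q ^- 2 - (delta ^- 2 * L)^-1 = - (delta ^+ 2 * ((k ^+ 2 - L) / (k ^+ 2 * L))).
  by rewrite qk; field; rewrite !gt_eqF.
rewrite normrN ger0_norm; last first.
  by rewrite mulr_ge0 ?(ltW d2)// divr_ge0 ?subr_ge0// mulr_ge0 ?(ltW L0)// sqr_ge0.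
rewrite mulrC ler_wpM2r ?(ltW d2)// ler_pdivrMr ?mulr_gt0// ?exprn_gt0//.
rewrite -ler_pdivrMl ?invr_gt0// invrK.
have k20 : 0 < k ^+ 2 by rewrite exprn_gt0.
rewrite (_ : k ^+ 4 = k ^+ 2 * k ^+ 2) in kL; last by ring.
move: cL' Lk kL k20; set x := k ^+ 2 => cL' Lx xL x0.
have [x1|x1] := leP x 1.
  move: cL'; rewrite min_r// => cL'.
  have : c * (x - L) <= c * (x * x / 12) by rewrite ler_wpM2l ?(ltW c0)//; lra.
  have : x * (c * x) <= x * L by rewrite ler_wpM2l// ltW.
  have : 0 <= x * (c * x) by rewrite !mulr_ge0// ltW.
  set A := x * (c * x); rewrite (_ : c * (x * x / 12) = A / 12); last by rewrite /A; field.
  by lra.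
move: cL'; rewrite min_l ?(ltW x1)// mulr1 => cL'.
have : c * (x - L) <= L * (x - L) by rewrite ler_wpM2r// subr_ge0.
have : 0 <= L * L by rewrite mulr_ge0// ltW.
by rewrite mulrBr; lra.
Qed.

(** The error is [delta D / (k (k - D))], which is [O(delta k)] for [k <= 1] and
    [O(delta k^-beta)] for [k >= 1]. Since [q >= 1], larger [eta] than [1] is no
    better than [eta = 1]; for [eta <= 1] both bounds are at most
    [delta k^eta = delta^(1+eta) q^eta], the second one because [- beta <= eta]. *)
Lemma b_symbol_error : exists2 C : R, 0 < C &
  forall (delta : R) (xi : 'rV[int]_n.+2), 0 < delta -> xi != 0 ->
  exists s : R, [/\ 0 < s,
    forall j, b_symbol omegahat delta xi j = tnth (direction xi) j * s &
    forall eta, - beta <= eta ->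
      `|(freq_norm R xi)^-1 - s^-1| <= C * delta `^ Num.min 2 (1 + eta) * freq_norm R xi `^ eta].
Proof.
have hw := omegahat_profile hker.
have mW := measurable_profile hw; have W0 := profile_ge0 hw; have W1 := profile_gt1 hw.
have [b11 [eps [c0 [eps01 c00 WE]]]] := kernel_K4 hker.
have Wmono r s : 0 < r -> r <= s -> s < 1 ->
    s ^+ n.+1 * on_pos omegahat s <= r ^+ n.+1 * on_pos omegahat r.
  move=> r0 rs s1; rewrite /on_pos r0 (lt_le_trans r0 rs).
  exact: (kernel_K3 hker).
have WE' r : 0 < r < eps -> on_pos omegahat r = c0 * r `^ (- n.+2%:R - beta).
  by move=> r0; rewrite /on_pos; case/andP: (r0) => -> _; exact: WE.
have WM := omegahat_moment hker.
have [c cp H] := sine_symbol_bounds mW W0 (@profile_npos R omegahat) W1 WM Wmono c00 eps01 b11 WE'.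
exists c^-1 => [|delta xi d0 xi0]; first by rewrite invr_gt0.
have q1 := freq_norm_ge1 (R := R) xi0.
have bE j D := b_symbolE hker j (D := D) d0 xi0.
set q := freq_norm R xi in q1 bE *; have q0 : 0 < q by lra.
have k0 : 0 < delta * q by rewrite mulr_gt0.
set k := delta * q in k0 bE *.
have [Hs Hl] := H k k0.
have := sine_defect_le mW W0 (@profile_npos R omegahat) W1 WM k0.
have D0 : (0 <= sine_defect n (on_pos omegahat) k)%E.
  apply: integral_ge0 => z _; rewrite lee_fin mulr_ge0//.
    by rewrite divr_ge0 ?enorm_ge0 ?W0.
  by have /andP[] := mul_sub_sin_scaled (tnth z ord0) k0.
move: Hs Hl D0 bE; case: (sine_defect n (on_pos omegahat) k) => [D||] Hs Hl D0 bE;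
  [|by rewrite leye_eq|by move: D0; rewrite leeNy_eq].
move: D0; rewrite !lee_fin => D0 Dk.
have [b1 b2] : -1 < beta /\ beta < 1 by case/andP: b11.
have Bs : 0 < k - D.
  have [k1|/ltW k1] := leP k 1.
    have := Hs k1; rewrite -EFinD lee_fin.
    by have := mulr_gt0 cp k0; lra.
  have := Hl k1; rewrite -EFinD lee_fin.
  by have := mulr_gt0 cp (powR_gt0 beta k0); lra.
exists (delta^-1 * (k - D)); split.
- by rewrite mulr_gt0// invr_gt0.
- by move=> j; exact: bE.
move=> eta beta_eta.
have -> : q^-1 - (delta^-1 * (k - D))^-1 = - (delta * (D / (k * (k - D)))).
  by rewrite /k; field; rewrite !gt_eqF//= -/k.
rewrite normrN ger0_norm; last first.
  by rewrite mulr_ge0 ?(ltW d0)// divr_ge0// mulr_ge0 ?(ltW k0)// ltW.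
have dE : delta `^ (1 + eta) * q `^ eta = delta * k `^ eta.
  rewrite /k powRM ?(ltW d0) ?(ltW q0)// powRD ?(gt_eqF d0) ?implybT// powRr1 ?(ltW d0)//.
  by rewrite mulrA.
have dk : delta * k = delta ^+ 2 * q by rewrite /k; ring.
have d2E : delta `^ 2 = delta ^+ 2 by rewrite powR_mulrn// ltW.
have key : delta * (c * (D / (k * (k - D)))) <= delta `^ Num.min 2 (1 + eta) * q `^ eta.
  have cD0 : 0 <= c * (D / (k * (k - D))).
    by rewrite mulr_ge0 ?(ltW cp)// divr_ge0// mulr_ge0 ?(ltW k0)// ltW.
  have [k1|/ltW k1] := leP k 1.
    have ck : c * k <= k - D by have := Hs k1; rewrite -EFinD lee_fin; lra.
    have Xk : c * (D / (k * (k - D))) <= k.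
      rewrite mulrA ler_pdivrMr ?mulr_gt0//.
      have : c * k * (k * k) <= (k - D) * (k * k) by rewrite ler_wpM2r// mulr_ge0// ltW.
      have : c * D <= c * (k ^+ 3 / 6) by rewrite ler_wpM2l// ltW.
      rewrite !exprS expr0 mulr1.
      have : 0 <= c * k * (k * k) by rewrite !mulr_ge0// ltW.
      set A := c * k * (k * k); set B := c * D.
      rewrite (_ : c * (k * (k * k) / 6) = A / 6); last by rewrite /A; field.
      by rewrite (_ : k * (k * (k - D)) = (k - D) * (k * k)); [lra|ring].
    apply: (@le_trans _ _ (delta * k)); first by rewrite ler_wpM2l// ltW.
    have [eta1|eta1] := leP 1 eta.
      rewrite min_l; last by lra.
      rewrite d2E dk ler_wpM2l ?sqr_ge0//.
      by rewrite -{1}(powRr1 (ltW q0)) ler_powR.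
    rewrite min_r; last by lra.
    by rewrite dE ler_wpM2l ?(ltW d0)//; apply: ger1_powR; [rewrite k0|exact: ltW].
  have ck : c * k `^ beta <= k - D by have := Hl k1; rewrite -EFinD lee_fin; lra.
  have Xk : c * (D / (k * (k - D))) <= k `^ (- beta).
    have p0 : 0 < k `^ beta by rewrite powR_gt0.
    rewrite powRN -[leRHS]div1r ler_pdivlMr// mulrA mulrAC ler_pdivrMr ?mulr_gt0// mul1r.
    have Dk' : D <= k by lra.
    rewrite mulrAC [leRHS]mulrC; apply: ler_pM => //; rewrite ?mulr_ge0// ltW//.
  apply: (@le_trans _ _ (delta * k `^ (- beta))); first by rewrite ler_wpM2l// ltW.
  have [eta1|eta1] := leP 1 eta.
    rewrite min_l; last by lra.
    apply: (@le_trans _ _ (delta * k)).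
      by rewrite ler_wpM2l ?(ltW d0)// ler1_powR//; lra.
    by rewrite d2E dk ler_wpM2l ?sqr_ge0// -{1}(powRr1 (ltW q0)) ler_powR.
  rewrite min_r; last by lra.
  by rewrite dE ler_wpM2l ?(ltW d0)// ler_powR.
by rewrite -mulrA ler_pdivlMl// mulrCA.
Qed.
End symbol_errors.

(** * Saddle point systems and Sobolev norms *)

Section saddle_point.
Context {R : realType} (n : nat).
Local Notation "x %:C" := (real_complex R x).
Local Notation normc := (@Normc.normc R).

(** Pairing the momentum equation with [e] eliminates [u] by the divergence
    constraint and determines [p]. *)
Lemma saddle_point_solution (a s : R) (e : 'I_n -> R) (u f : 'I_n -> R[i]) (p : R[i]) :
  a != 0 -> s != 0 -> \sum_j e j ^+ 2 = 1 ->
  (forall j, a%:C * u j + 'i * (e j * s)%:C * p = f j) ->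
  \sum_j 'i * (e j * s)%:C * u j = 0 ->
  let phi := \sum_j (e j)%:C * f j in
  p = - 'i * s^-1%:C * phi /\ forall j, u j = a^-1%:C * (f j - (e j)%:C * phi).
Proof.
move=> a0 s0 e1 eqf eq0 phi.
have i2 : 'i * 'i = -1 :> R[i] by rewrite -expr2 sqrCi.
have sC : s%:C != 0 by rewrite fmorph_eq0.
have aC : a%:C != 0 by rewrite fmorph_eq0.
have i0 : 'i != 0 :> R[i].
  by apply/eqP => i0; move/eqP: i2; rewrite i0 mul0r eq_sym oppr_eq0 oner_eq0.
have eu : \sum_j (e j)%:C * u j = 0.
  apply: (mulfI (mulf_neq0 i0 sC)); rewrite mulr0 -[RHS]eq0 mulr_sumr.
  by apply: eq_bigr => j _; rewrite rmorphM/=; ring.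
have phiE : phi = 'i * s%:C * p.
  rewrite /phi (eq_bigr (fun j => a%:C * ((e j)%:C * u j) + (e j ^+ 2)%:C * ('i * s%:C * p))).
    by rewrite big_split/= -mulr_sumr eu mulr0 add0r -mulr_suml -rmorph_sum e1 mul1r.
  by move=> j _; rewrite -eqf rmorphXn/= rmorphM/=; ring.
split.
  rewrite phiE fmorphV; transitivity (- ('i * 'i) * (s%:C^-1 * s%:C) * p); last by ring.
  by rewrite i2 mulVf// opprK !mul1r.
move=> j; rewrite fmorphV phiE; apply: (mulfI aC); rewrite mulVKf//.
by rewrite -eqf rmorphM/=; ring.
Qed.

Lemma normc_real (x : R) : normc x%:C = `|x|.
Proof. by rewrite /= expr0n/= addr0 sqrtr_sqr. Qed.


Lemma normc_ge0 (x : R[i]) : 0 <= normc x.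
Proof. by case: x => x y /=; exact: sqrtr_ge0. Qed.

Lemma normc_i : normc 'i = 1.
Proof.
apply/eqP; rewrite -(@eqrXn2 _ 2%N) ?normc_ge0// expr1n expr2 -Normc.normcM -expr2 sqrCi.
by rewrite normcN Normc.normc1.
Qed.

Lemma normc_sum (f : 'I_n -> R[i]) : normc (\sum_j f j) <= \sum_j normc (f j).
Proof.
apply: (big_ind2 (fun x y => normc x <= y)) => //.
- by rewrite -[0]/(0%:C) normc_real normr0.
- by move=> x1 y1 x2 y2 h1 h2; apply: le_trans (le_normcD _ _) _; exact: lerD.
Qed.

Lemma sqr_sum_normc (f : 'I_n -> R[i]) :
  (\sum_j normc (f j)) ^+ 2 <= n%:R ^+ 2 * \sum_j normc (f j) ^+ 2.
Proof.
set S := \sum_j normc (f j) ^+ 2.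
have S0 : 0 <= S by apply: sumr_ge0 => j _; exact: sqr_ge0.
have H : \sum_j normc (f j) <= n%:R * Num.sqrt S.
  have -> : n%:R * Num.sqrt S = \sum_(j < n) Num.sqrt S by rewrite sumr_const card_ord mulr_natl.
  apply: ler_sum => j _.
  rewrite -[leLHS]ger0_norm ?normc_ge0// -sqrtr_sqr ler_wsqrtr//.
  by rewrite /S (bigD1 j)//= lerDl sumr_ge0// => i _; exact: sqr_ge0.
rewrite -(sqr_sqrtr S0) -exprMn lerXn2r ?nnegrE//.
by apply: sumr_ge0 => j _; exact: normc_ge0.
Qed.

Lemma projection_bounds (e : 'I_n -> R) (f : 'I_n -> R[i]) :
  (forall j, `|e j| <= 1) -> let phi := \sum_j (e j)%:C * f j in
  normc phi <= \sum_j normc (f j) /\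
  forall j, normc (f j - (e j)%:C * phi) <= 2 * \sum_j normc (f j).
Proof.
move=> e1 phi.
have pb : normc phi <= \sum_j normc (f j).
  apply: le_trans (normc_sum _) _; apply: ler_sum => j _.
  by rewrite Normc.normcM normc_real ler_piMl ?normc_ge0.
split=> // j; apply: le_trans (le_normcD _ _) _; rewrite normcN Normc.normcM normc_real.
rewrite mulrDl mul1r lerD//.
  by rewrite (bigD1 j)//= lerDl sumr_ge0// => i _; exact: normc_ge0.
by apply: le_trans pb; rewrite ler_piMl ?normc_ge0.
Qed.

End saddle_point.

Section sobolev.
Context {R : realType} (n : nat).
Local Open Scope ereal_scope.

Lemma esumZ_le (T : choiceType) (S : set T) (a : T -> \bar R) (c : R) : (0 <= c)%R ->
  (forall x, 0 <= a x) -> esum S (fun x => c%:E * a x) <= c%:E * esum S a.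
Proof.
move=> c0 a0; apply: ge_ereal_sup => _ [X SX <-].
rewrite -ge0_mule_fsumr// lee_wpmul2l ?lee_fin//.
by apply: ereal_sup_ubound; exists X.
Qed.

Lemma sqr_sobolev_ge0 s (g : pdistr R n) : 0 <= sqr_sobolev s g.
Proof.
rewrite /sqr_sobolev mule_ge0 ?lee_fin ?invr_ge0 ?exprn_ge0 ?mulr_ge0 ?pi_ge0//.
by apply: esum_ge0 => xi _; rewrite lee_fin mulr_ge0 ?powR_ge0 ?sqr_ge0.
Qed.

(** A weighted bound frequency by frequency passes to the norms; the frequency
    [0] does not enter them. *)
Lemma sqr_sobolev_le (s M : R) (g : pdistr R n) (f : pfield R n) : (0 <= M)%R ->
  (forall xi, xi != 0%R -> Normc.normc (g xi) ^+ 2 <=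
    M * (freq_norm R xi `^ (2 * s) * \sum_j Normc.normc (f j xi) ^+ 2))%R ->
  sqr_sobolev 0 g <= M%:E * \sum_j sqr_sobolev s (f j).
Proof.
move=> M0 gf; rewrite /sqr_sobolev.
have p0 : (0 <= (2 * @pi R) ^- n)%R by rewrite invr_ge0 exprn_ge0// mulr_ge0// pi_ge0.
rewrite -ge0_sume_distrr; last first.
  by move=> j _; apply: esum_ge0 => xi _; rewrite lee_fin mulr_ge0 ?powR_ge0 ?sqr_ge0.
rewrite muleCA lee_wpmul2l ?lee_fin//.
rewrite -esum_sum; last by move=> xi j _ _; rewrite lee_fin mulr_ge0 ?powR_ge0 ?sqr_ge0.
apply: le_trans (esumZ_le _ M0 _); last first.
  by move=> xi; apply: sume_ge0 => j _; rewrite lee_fin mulr_ge0 ?powR_ge0 ?sqr_ge0.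
apply: le_esum => xi /= xi0; rewrite mulr0 powRr0 mul1r sumEFin -EFinM lee_fin.
by rewrite -mulr_sumr; exact: gf.
Qed.

Lemma sqrte_le (K : R) (x y : \bar R) : (0 <= K)%R -> 0 <= y ->
  x <= (K ^+ 2)%:E * y -> sqrte x <= K%:E * sqrte y.
Proof.
move=> K0 y0 xy; apply: (@le_trans _ _ (sqrte ((K ^+ 2)%:E * y))).
  by rewrite lee_sqrt// mule_ge0// lee_fin sqr_ge0.
rewrite sqrteM ?lee_fin ?sqr_ge0//; apply: lee_wpmul2r; first exact: sqrte_ge0.
by rewrite /= sqrtr_sqr ger0_norm.
Qed.

End sobolev.

(** * The Stokes systems *)

Section stokes.
Context {R : realType} (n : nat).
Local Notation "x %:C" := (real_complex R x).
Local Notation normc := (@Normc.normc R).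
Implicit Types (nu delta : R) (f u : pfield R n.+2) (p : pdistr R n.+2).

Lemma sum_direction_sqr (xi : 'rV[int]_n.+2) : xi != 0 ->
  \sum_j (tnth (direction xi) j : R) ^+ 2 = 1.
Proof. by move=> xi0; rewrite -sqr_enorm enorm_direction// expr1n. Qed.

Lemma local_stokes_solution nu f u p (xi : 'rV[int]_n.+2) : 0 < nu -> xi != 0 ->
  local_stokes nu f u p ->
  let e := tnth (direction xi) in let phi := \sum_j (e j)%:C * f j xi in
  p xi = - 'i * (freq_norm R xi)^-1%:C * phi /\
  forall j, u j xi = (nu * freq_norm R xi ^+ 2)^-1%:C * (f j xi - (e j)%:C * phi).
Proof.
move=> nu0 xi0 [eqf eq0] e phi; have q1 := freq_norm_ge1 (R := R) xi0.
have q0 : freq_norm R xi != 0 by rewrite gt_eqF//; lra.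
have eE j : e j * freq_norm R xi = (xi 0 j)%:~R by rewrite /e tnth_mktuple divfK.
apply: (saddle_point_solution (u := fun j => u j xi) (f := fun j => f j xi)) => //.
- by rewrite mulf_neq0 ?gt_eqF// exprn_gt0//; lra.
- exact: sum_direction_sqr.
- move=> j; rewrite -eqf /laplacian /gradient eE rmorphM/=; ring.
- have /eqP := eq0 xi; rewrite oppr_eq0 /divergence => /eqP H.
  by rewrite -[RHS]H; apply: eq_bigr => j _; rewrite eE.
Qed.

Lemma nonlocal_stokes_solution nu (omega omegahat : R -> R) delta f u p
    (xi : 'rV[int]_n.+2) (s : R) :
  0 < nu -> xi != 0 -> 0 < lambda_symbol omega delta xi -> 0 < s ->
  (forall j, b_symbol omegahat delta xi j = tnth (direction xi) j * s) ->
  nonlocal_stokes nu omega omegahat delta f u p ->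
  let e := tnth (direction xi) in let phi := \sum_j (e j)%:C * f j xi in
  p xi = - 'i * s^-1%:C * phi /\
  forall j, u j xi = (nu * lambda_symbol omega delta xi)^-1%:C * (f j xi - (e j)%:C * phi).
Proof.
move=> nu0 xi0 l0 s0 bE [eqf eq0] e phi.
apply: (saddle_point_solution (u := fun j => u j xi) (f := fun j => f j xi)) => //.
- by rewrite mulf_neq0 ?gt_eqF.
- by rewrite gt_eqF.
- exact: sum_direction_sqr.
- move=> j; rewrite -eqf /nl_laplacian /nl_gradient bE rmorphM/=; ring.
- have /eqP := eq0 xi; rewrite oppr_eq0 /nl_divergence => /eqP H.
  by rewrite -[RHS]H; apply: eq_bigr => j _; rewrite bE.
Qed.

(** The velocity error is [(q^-2 - lambda^-1) / nu] times the projection of [f]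
    orthogonal to [e], the pressure error [q^-1 - s^-1] times the component of [f]
    along [e]. The bounds on projections and on sums of moduli are crude, costing
    powers of the dimension that are absorbed in the constant. *)
Lemma stokes_error nu (omega omegahat : R -> R) (beta : R) : 0 < nu ->
  kernel_assumptions n.+2 omega omegahat beta ->
  exists2 C : R, 0 < C &
    forall delta f u u_delta p p_delta, 0 < delta ->
      local_stokes nu f u p ->
      nonlocal_stokes nu omega omegahat delta f u_delta p_delta ->
      (L2_norm_field (fun j xi => (u j xi - u_delta j xi)%R)
          <= (C * delta ^+ 2)%:E * L2_norm_field f)%E /\
      (forall eta : R, - beta <= eta ->
        (L2_norm (fun xi => (p xi - p_delta xi)%R)
          <= (C * delta `^ Num.min 2 (1 + eta))%:E
             * sobolev_norm_field eta f)%E).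
Proof.
move=> nu0 hker.
have [Cl Cl0 Hl] := lambda_symbol_error hker.
have [Cb Cb0 Hb] := b_symbol_error hker.
pose N : R := n.+2%:R.
have N1 : 1 <= N by rewrite ler1n.
have N0 : 0 < N by lra.
pose K1 := 2 * N ^+ 2 * Cl / nu; pose K2 := N * Cb.
have K10 : 0 < K1 by rewrite divr_gt0// !mulr_gt0// exprn_gt0.
have K20 : 0 < K2 by rewrite mulr_gt0.
exists (K1 + K2) => [|delta f u ud p pd d0 loc nloc]; first exact: addr_gt0.
have d20 : 0 <= delta ^+ 2 by exact: sqr_ge0.
have e1 (xi : 'rV[int]_n.+2) : xi != 0 -> forall j, `|tnth (direction xi) j : R| <= 1.
  by move=> xi0 j; rewrite -(enorm_direction xi0) ler_tnth_enorm.
have X0 s : (0 <= \sum_(j < n.+2) sqr_sobolev s (f j))%E.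
  by apply: sume_ge0 => j _; exact: sqr_sobolev_ge0.
split.
  rewrite /L2_norm_field /sobolev_norm_field; apply: sqrte_le => //.
    by rewrite mulr_ge0// addr_ge0// ltW.
  pose M : R := (2 * N * Cl * delta ^+ 2 / nu) ^+ 2.
  have Hj j : (sqr_sobolev 0 (fun xi => (u j xi - ud j xi)%R) <=
      M%:E * \sum_(k < n.+2) sqr_sobolev 0 (f k))%E.
    apply: sqr_sobolev_le; first exact: sqr_ge0.
    move=> xi xi0; rewrite mulr0 powRr0 mul1r.
    have [l0 lerr] := Hl delta xi d0 xi0.
    have [s [s0 bE _]] := Hb delta xi d0 xi0.
    have [_ uE] := local_stokes_solution nu0 xi0 loc.
    have [_ udE] := nonlocal_stokes_solution nu0 xi0 l0 s0 bE nloc.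
    rewrite uE udE -mulrBl -rmorphB/= Normc.normcM normc_real.
    have [_ /(_ j) pj] := projection_bounds (fun k => f k xi) (e1 _ xi0).
    set q := freq_norm R xi in lerr *; set l := lambda_symbol _ _ _ in l0 lerr *.
    have -> : (nu * q ^+ 2)^-1 - (nu * l)^-1 = nu^-1 * (q ^- 2 - l^-1).
      by rewrite !invfM mulrBr.
    rewrite normrM (gtr0_norm (x := nu^-1)) ?invr_gt0//.
    have step : nu^-1 * `|q ^- 2 - l^-1| * normc (f j xi - (tnth (direction xi) j)%:C *
        \sum_k (tnth (direction xi) k)%:C * f k xi) <=
        (2 * Cl * delta ^+ 2 / nu) * \sum_k normc (f k xi).
      have -> : 2 * Cl * delta ^+ 2 / nu * \sum_k normc (f k xi) =
        nu^-1 * (Cl * delta ^+ 2) * (2 * \sum_k normc (f k xi)) by ring.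
      apply: ler_pM => //; last by rewrite ler_wpM2l// invr_ge0 ltW.
        by rewrite mulr_ge0// invr_ge0 ltW.
      exact: normc_ge0.
    have := sqr_sum_normc (fun k => f k xi).
    set S := \sum_k normc (f k xi) in step *; set S2 := \sum_k _ ^+ 2 => SS.
    apply: (@le_trans _ _ ((2 * Cl * delta ^+ 2 / nu * S) ^+ 2)).
      rewrite lerXn2r// ?nnegrE.
        by rewrite mulr_ge0 ?normc_ge0// mulr_ge0// invr_ge0 ltW.
      by apply: le_trans step; rewrite mulr_ge0 ?normc_ge0// mulr_ge0// invr_ge0 ltW.
    rewrite exprMn; apply: (@le_trans _ _ ((2 * Cl * delta ^+ 2 / nu) ^+ 2 * (N ^+ 2 * S2))).
      by rewrite ler_wpM2l// sqr_ge0.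
    by rewrite /M le_eqVlt; apply/orP; left; apply/eqP; field; rewrite gt_eqF.
  apply: (@le_trans _ _ (\sum_(j < n.+2) (M%:E * \sum_(k < n.+2) sqr_sobolev 0 (f k)))%E).
    by apply: lee_sum => j _; exact: Hj.
  have -> : (\sum_(j < n.+2) (M%:E * \sum_(k < n.+2) sqr_sobolev 0 (f k)) =
     (N * M)%:E * \sum_(k < n.+2) sqr_sobolev 0 (f k))%E.
    rewrite -ge0_sume_distrl; last by move=> i _; rewrite lee_fin sqr_ge0.
    by rewrite sumEFin sumr_const card_ord mulr_natl.
  rewrite lee_wpmul2r// lee_fin.
  apply: (@le_trans _ _ ((K1 * delta ^+ 2) ^+ 2)).
    have -> : N * M = N ^+ 3 * (2 * Cl * delta ^+ 2 / nu) ^+ 2.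
      by rewrite /M; field; rewrite gt_eqF.
    have -> : (K1 * delta ^+ 2) ^+ 2 = N ^+ 4 * (2 * Cl * delta ^+ 2 / nu) ^+ 2.
      by rewrite /K1; field; rewrite gt_eqF.
    by rewrite ler_wpM2r ?sqr_ge0// ler_weXn2l.
  apply: lerXn2r; rewrite ?nnegrE.
  - by rewrite mulr_ge0// ltW.
  - by rewrite mulr_ge0// addr_ge0// ltW.
  - by rewrite ler_wpM2r// lerDl ltW.
move=> eta beta_eta.
set m := Num.min _ _.
rewrite /L2_norm /sobolev_norm /sobolev_norm_field; apply: sqrte_le => //.
  by rewrite mulr_ge0 ?powR_ge0// addr_ge0// ltW.
apply: (@le_trans _ _ (((K2 * delta `^ m) ^+ 2)%:E *
    \sum_(k < n.+2) sqr_sobolev eta (f k))%E); last first.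
  rewrite lee_wpmul2r// lee_fin.
  apply: lerXn2r; rewrite ?nnegrE.
  - by rewrite mulr_ge0 ?powR_ge0// ltW.
  - by rewrite mulr_ge0 ?powR_ge0// addr_ge0// ltW.
  - by rewrite ler_wpM2r ?powR_ge0// lerDr ltW.
apply: sqr_sobolev_le; first exact: sqr_ge0.
move=> xi xi0; have [l0 lerr] := Hl delta xi d0 xi0.
have [s [s0 bE serr]] := Hb delta xi d0 xi0.
have [pE _] := local_stokes_solution nu0 xi0 loc.
have [pdE _] := nonlocal_stokes_solution nu0 xi0 l0 s0 bE nloc.
rewrite pE pdE -mulrBl -mulrBr -rmorphB/= !Normc.normcM normcN normc_i mul1r normc_real.
have [pb _] := projection_bounds (fun k => f k xi) (e1 _ xi0).
have se := serr eta beta_eta; rewrite -/m in se.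
have := sqr_sum_normc (fun k => f k xi).
set q := freq_norm R xi in se *.
set S := \sum_k normc (f k xi) in pb *; set S2 := \sum_k _ ^+ 2 => SS.
apply: (@le_trans _ _ ((Cb * delta `^ m * q `^ eta * S) ^+ 2)).
  have le1 : `|q^-1 - s^-1| * normc (\sum_j (tnth (direction xi) j)%:C * f j xi) <=
      Cb * delta `^ m * q `^ eta * S.
    by apply: ler_pM => //; exact: normc_ge0.
  rewrite lerXn2r// ?nnegrE; first by rewrite mulr_ge0 ?normc_ge0.
  by apply: le_trans le1; rewrite mulr_ge0 ?normc_ge0.
rewrite exprMn; apply: (@le_trans _ _ ((Cb * delta `^ m * q `^ eta) ^+ 2 * (N ^+ 2 * S2))).
  by rewrite ler_wpM2l// sqr_ge0.
have -> : q `^ (2 * eta) = (q `^ eta) ^+ 2.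
  by rewrite mulrC powRrM powR_mulrn// powR_ge0.
by rewrite /K2 le_eqVlt; apply/orP; left; apply/eqP; ring.
Qed.

End stokes.

Theorem theorem14 (R : realType) (d : nat) (hd : d = 2%N \/ d = 3%N)
    (nu : R) (hnu : 0 < nu) (omega omegahat : R -> R) (beta : R)
    (hker : kernel_assumptions d omega omegahat beta) :
  exists2 C : R, 0 < C &
    forall (delta : R) (f u u_delta : pfield R d) (p p_delta : pdistr R d),
      0 < delta ->
      mean_zero_field f ->
      mean_zero_field u -> mean_zero p ->
      local_stokes nu f u p ->
      mean_zero_field u_delta -> mean_zero p_delta ->
      nonlocal_stokes nu omega omegahat delta f u_delta p_delta ->
      ((L2_norm_field f < +oo)%E ->
        (L2_norm_field (fun j xi => (u j xi - u_delta j xi)%R)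
          <= (C * delta ^+ 2)%:E * L2_norm_field f)%E) /\
      (forall eta : R, - beta <= eta ->
        (sobolev_norm_field eta f < +oo)%E ->
        (L2_norm (fun xi => (p xi - p_delta xi)%R)
          <= (C * delta `^ Num.min 2 (1 + eta))%:E
             * sobolev_norm_field eta f)%E).
Proof.
have [n dE] : exists n, d = n.+2 by case: hd => ->; [exists 0%N|exists 1%N].
rewrite {hd}dE in hker *.
have [C C0 HC] := stokes_error hnu hker.
exists C => // delta f u ud p pd d0 _ _ _ loc _ _ nloc.
have [uu pp] := HC _ _ _ _ _ _ d0 loc nloc.
by split=> // eta beta_eta _; exact: pp.
Qed.
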